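(* Let $I\subset\mathbb{R}$ be a closed bounded interval and let $\Gamma=(f,g,h):I\to\mathbb{H}$ be a horizontal curve such that for every $m\in\mathbb{N}$, $f'$ and $g'$ are $m$-times $L^1$ differentiable at almost every point of $I$. Then $\Gamma$ has the $\infty$-Lusin property; that is, for every $\varepsilon>0$ there exists a $C^\infty$ horizontal curve $\widetilde\Gamma:I\to\mathbb{H}$ such that $\mathcal{L}^1(\{x\in I:\widetilde\Gamma(x)\neq\Gamma(x)\})<\varepsilon$.
   Context: $\mathcal{L}^1$ is Lebesgue measure on $\mathbb{R}$. The Heisenberg group $\mathbb{H}$ is $\mathbb{R}^3$ with group law $(x,y,z)*(x',y',z')=(x+x',y+y',z+z'+2(yx'-xy'))$. With $X(p)=\partial_x+2y\,\partial_z$ and $Y(p)=\partial_y-2x\,\partial_z$ at $p=(x,y,z)$, a curve $(f,g,h):I\to\mathbb{R}^3$ is horizontal if it is absolutely continuous and its derivative lies in $\mathrm{span}\{X,Y\}$ at the corresponding point of the curve for a.e. $t\in I$; equivalently, it is absolutely continuous and $h'=2(f'g-fg')$ a.e. in $I$. A measurable map $u$ defined almost everywhere on $[a,b]$ is $m$-times $L^1$ differentiable at $x\in(a,b)$ if there exists a polynomial $P$ of degree at most $m$ such that $\frac{1}{2\rho}\int_{B(x,\rho)}|u(y)-P(y)|\,dy=o(\rho^m)$ as $\rho\to0^+$, where $B(x,\rho)=(x-\rho,x+\rho)$. *)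

(* Defs.v *)
From HB Require Import structures.
From mathcomp Require Import all_boot all_order all_algebra.
From mathcomp Require Import all_classical all_reals all_analysis.
From mathcomp Require Import ring.

Set Implicit Arguments.
Unset Strict Implicit.
Unset Printing Implicit Defensive.

Import Order.TTheory GRing.Theory Num.Theory.
Import numFieldNormedType.Exports.

Local Open Scope classical_set_scope.
Local Open Scope ring_scope.

(* The Heisenberg group is R^3; a point (x, y, z) is ((x, y), z), so that its
   coordinates are p.1.1, p.1.2 and p.2. *)
Notation heis R := (R * R * R)%type (only parsing).

Definition heis_mul (R : realType) (p q : heis R) : heis R :=
  (p.1.1 + q.1.1, p.1.2 + q.1.2,
   p.2 + q.2 + 2 * (p.1.2 * q.1.1 - p.1.1 * q.1.2)).

Definition heisX (R : realType) (p : heis R) : heis R := (1, 0, 2 * p.1.2).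
Definition heisY (R : realType) (p : heis R) : heis R := (0, 1, - 2 * p.1.1).

Lemma heis_mulX (R : realType) (p : heis R) (s : R) :
  heis_mul p (s, 0, 0) = p + s *: heisX p.
Proof.
case: p => [[x y] z]; rewrite /heis_mul /heisX /=.
by congr (_, _, _); rewrite /= /GRing.scale /=; ring.
Qed.

Lemma heis_mulY (R : realType) (p : heis R) (s : R) :
  heis_mul p (0, s, 0) = p + s *: heisY p.
Proof.
case: p => [[x y] z]; rewrite /heis_mul /heisY /=.
by congr (_, _, _); rewrite /= /GRing.scale /=; ring.
Qed.

(* A map defined on [a, b] is represented by a total function, of which only
   the values on [a, b] matter: derivatives are taken almost everywhere in
   [a, b], and the values outside could affect them at a and b only. *)

Definition abs_continuous (R : realType) (V : normedModType R)
    (a b : R) (f : R -> V) : Prop :=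
  forall eps : R, 0 < eps -> exists2 delta : R, 0 < delta &
    forall (n : nat) (u v : 'I_n -> R),
      (forall i, [/\ a <= u i, u i <= v i & v i <= b]) ->
      trivIset [set: 'I_n] (fun i => `]u i, v i[%classic) ->
      \sum_(i < n) (v i - u i) < delta ->
      \sum_(i < n) `|f (v i) - f (u i)| < eps.

(* The norm of R * R * R is the sup norm, so both absolute continuity and
   derivability of a curve are those of its three coordinates. *)
Definition horizontal (R : realType) (a b : R) (G : R -> heis R) : Prop :=
  abs_continuous a b G /\
  {ae lebesgue_measure, forall t : R, t \in `[a, b] ->
    exists c d : R, is_derive t 1 G
      (c *: heisX (G t) + d *: heisY (G t))}.

(* The o(rho ^ m) is spelled out in the extended reals, where an infinite
   integral is not o(rho ^ m). *)
Definition L1_differentiable (R : realType) (a b : R) (m : nat) (u : R -> R)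
    (x : R) : Prop :=
  a < x < b /\
  exists P : {poly R}, (size P <= m.+1)%N /\
    forall eps : R, 0 < eps -> \forall rho \near 0^'+,
      (((2 * rho)^-1)%:E *
        \int[lebesgue_measure]_(y in ball x rho) `|u y - P.[y]|%:E
      <= (eps * rho ^+ m)%:E)%E.

(* Smoothness on the closed interval [a, b], as the existence of a smooth
   extension. *)
Definition smooth_on (R : realType) (V : normedModType R) (a b : R)
    (f : R -> V) : Prop :=
  exists F : R -> V, (forall (n : nat) (t : R), derivable (derive1n n F) t 1) /\
    {in `[a, b], F =1 f}.

Definition lusin_infty (R : realType) (a b : R) (G : R -> heis R) : Prop :=
  forall eps : R, 0 < eps -> exists G' : R -> heis R,
    [/\ smooth_on a b G', horizontal a b G' &
      (lebesgue_measure [set x | x \in `[a, b] /\ G' x <> G x] < eps%:E)%E].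

(* Main.v *)
(* If f' is m-times L^1 differentiable at x, then, f being absolutely continuous, f has
   at x a Taylor expansion of order m with remainder O(|z - x|^(m+1)), valid on all of
   [a, b].  The points where this holds with a given constant form a compact set, so off a
   set of small measure the expansions of f and g of all orders are uniform on a compact
   set K, and they extend from K to smooth functions f1 and g1: on each gap of K, Borel sums
   at the two ends are glued together by a cutoff.

   For x < y in K, the increment of h and that of the horizontal lift of (f1, g1) differ by
   the increment of a function whose derivative is bilinear in (f - f1, g - g1) and in the
   derivatives of f, g, f1 and g1, hence by O(|y - x|^n) for every n.  On each gap, f1 and
   g1 are perturbed by t b(t) and b(t), b a rescaled bump, times an amplitude e: the area
   changes by a quadratic polynomial in e, and one of two opposite signs gives any prescribed
   defect D with |e| <= C sqrt |D|.  As D decays faster than any power of the gap, the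
   perturbed functions remain smooth with the same jets on K.  Finally h minus the lift
   takes the same value at the two ends of every gap and has zero derivative along K, so
   that it is constant on K. *)
Require Import Defs.
From mathcomp Require Import all_boot all_order all_algebra.
From mathcomp Require Import all_classical all_reals all_analysis.
From mathcomp Require Import ring lra.

Set Implicit Arguments.
Unset Strict Implicit.
Unset Printing Implicit Defensive.

Import Order.TTheory GRing.Theory Num.Theory.
Import numFieldNormedType.Exports.

Local Open Scope classical_set_scope.
Local Open Scope ring_scope.

(** The repair loses orders of decay. A perturbation rescaled to a gap of length [l] costs a factor
    [l^-k] in its [k]-th derivative, and solving a quadratic equation for its amplitude replaces the
    defect by its square root; the [k]-th derivatives stay bounded because the defect is [O(l^(2k))]
    for every [k]. Hence expansions of all orders on one set [K], and bounds independent of the gap,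
    since infinitely many gaps may accumulate. The pair [t b], [b] is taken because
    [(t b)' b - b' (t b) = b^2]: the quadratic part of the area change has a sign, and its integral
    is the same on all gaps. The linear part is not controlled, but there is a root for which it has
    the favourable sign, and this root is no larger than if the linear part were absent. The
    derivatives of [f], [g], [h] exist only almost everywhere and may be unbounded, so increments
    are compared directly: off an open set of small measure a local estimate holds at each point,
    and absolute continuity absorbs the rest. This serves both to integrate [f'] minus a polynomial
    and to estimate the defect. *)

(** * Derivatives and smooth functions *)

(* [is_derive x 1 F L] in epsilon-delta form; unlike [is_derive] it is not a type
   class, so that unification does not trigger instance resolution. *)
Variant has_derivative (R : realType) (F : R -> R) (x L : R) : Prop :=
  HasDerivative of forall e : R, 0 < e -> exists2 d : R, 0 < d &
    forall s, `|s - x| < d -> `|F s - F x - L * (s - x)| <= e * `|s - x|.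

Lemma has_derivativeP (R : realType) (F : R -> R) (x L : R) :
  has_derivative F x L <-> is_derive x (1 : R) F L.
Proof.
have derE : (fun h => h^-1 *: ((F \o shift x) (h *: (1 : R)) - F x)) =
            (fun h => h^-1 * (F (h + x) - F x)).
  by apply/funext => h /=; rewrite /GRing.scale /= mulr1.
split=> [[H]|[dF FL]]; last split=> e e0.
- have cv : (h^-1 * (F (h + x) - F x)) @[h --> 0^'] --> L.
    apply/cvgrPdist_le => e e0; have [d d0 Hd] := H e e0.
    near=> h; have h0 : h != 0 by near: h; exact: nbhs_dnbhs_neq.
    have hd : `|h| < d by near: h; apply: dnbhs0_lt.
    have := Hd (h + x); rewrite addrK => /(_ hd) Hh.
    have -> : L - h^-1 * (F (h + x) - F x) = - (F (h + x) - F x - L * h) / h.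
      by field.
    by rewrite normrM normrN normfV ler_pdivrMr // normr_gt0.
  have dF : derivable F x (1 : R).
    by rewrite /derivable derE; apply/cvg_ex; exists L.
  split; first exact: dF.
  by rewrite /derive derE; exact/cvg_lim.
- have : (h^-1 * (F (h + x) - F x)) @[h --> 0^'] --> L.
    by rewrite -derE -FL; exact: dF.
  move/cvgrPdist_le => /(_ e e0) [d /= d0 Hd]; exists d => // s sx.
  have [->|sx0] := eqVneq s x; first by rewrite !subrr mulr0 subr0 normr0 mulr0.
  have h0 : s - x != 0 by rewrite subr_eq0.
  have := Hd (s - x); rewrite /= sub0r normrN => /(_ sx h0).
  rewrite subrK => Hs.
  have -> : F s - F x - L * (s - x) = - (L - (s - x)^-1 * (F s - F x)) * (s - x).
    by field.
  by rewrite normrM normrN ler_wpM2r.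
Unshelve. all: by end_near. Qed.

Lemma has_derivative_quad (R : realType) (F : R -> R) (x L C : R) :
  (forall s, `|F s - F x - L * (s - x)| <= C * (s - x) ^+ 2) ->
  has_derivative F x L.
Proof.
move=> H; split=> e e0.
have C0 : 0 < `|C| + 1 by rewrite ltr_wpDl.
exists (e / (`|C| + 1)); first by rewrite divr_gt0.
move=> s; rewrite ltr_pdivlMr // => sx; apply: le_trans (H s) _.
rewrite -real_normK ?num_real // expr2 mulrA ler_wpM2r //.
apply: (@le_trans _ _ (`|s - x| * (`|C| + 1))); last exact: ltW.
by rewrite mulrC ler_wpM2l // (le_trans (ler_norm C)) // lerDl.
Qed.

Lemma has_derivative_unique (R : realType) (F : R -> R) (x L L' : R) :
  has_derivative F x L -> has_derivative F x L' -> L = L'.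
Proof. by move=> /has_derivativeP[_ <-] /has_derivativeP[_ <-]. Qed.

Lemma has_derivative_derive1 (R : realType) (F : R -> R) (x L : R) :
  has_derivative F x L -> derive1 F x = L.
Proof. by move=> /has_derivativeP[_ <-]; rewrite derive1E. Qed.

Lemma has_derivative_eq (R : realType) (F : R -> R) (x L L' : R) :
  has_derivative F x L -> L = L' -> has_derivative F x L'.
Proof. by move=> + <-. Qed.

Lemma has_derivative_cont (R : realType) (F F' : R -> R) :
  (forall t, has_derivative F t (F' t)) -> continuous F.
Proof.
move=> dF x; apply/differentiable_continuous/derivable1_diffP.
by have /has_derivativeP[] := dF x.
Qed.

Lemma near_has_derivative (R : realType) (F G : R -> R) (x L r : R) : 0 < r ->
  (forall s, `|s - x| < r -> F s = G s) ->
  has_derivative G x L -> has_derivative F x L.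
Proof.
move=> r0 FG [H]; split=> e e0.
have [d d0 Hd] := H e e0; exists (Num.min d r); first by rewrite lt_min d0.
by move=> s; rewrite lt_min => /andP[sd sr]; rewrite !FG ?Hd // subrr normr0.
Qed.

Lemma has_derivative_cst (R : realType) (c x : R) : has_derivative (fun=> c) x 0.
Proof. by apply/has_derivativeP; exact: is_derive_cst. Qed.

Lemma has_derivative_id (R : realType) (x : R) : has_derivative (fun t => t) x 1.
Proof. by apply/has_derivativeP; exact: is_derive_id. Qed.

Lemma has_derivativeD (R : realType) (F G : R -> R) (t f' g' : R) :
  has_derivative F t f' -> has_derivative G t g' ->
  has_derivative (fun t => F t + G t) t (f' + g').
Proof.
by move=> /has_derivativeP dF /has_derivativeP dG; apply/has_derivativeP; exact: is_deriveD.
Qed.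

Lemma has_derivativeB (R : realType) (F G : R -> R) (t f' g' : R) :
  has_derivative F t f' -> has_derivative G t g' ->
  has_derivative (fun t => F t - G t) t (f' - g').
Proof.
by move=> /has_derivativeP dF /has_derivativeP dG; apply/has_derivativeP; exact: is_deriveB.
Qed.

Lemma has_derivativeM (R : realType) (F G : R -> R) (t f' g' : R) :
  has_derivative F t f' -> has_derivative G t g' ->
  has_derivative (fun t => F t * G t) t (f' * G t + F t * g').
Proof.
move=> /has_derivativeP dF /has_derivativeP dG; apply/has_derivativeP.
apply: is_derive_eq (is_deriveM dF dG) _.
by rewrite /GRing.scale /= addrC [X in X + _]mulrC.
Qed.

Lemma has_derivativeZ (R : realType) (c : R) (F : R -> R) (t f' : R) :
  has_derivative F t f' -> has_derivative (fun t => c * F t) t (c * f').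
Proof.
move=> dF; apply: has_derivative_eq (has_derivativeM (has_derivative_cst c t) dF) _.
by rewrite mul0r add0r.
Qed.

Lemma has_derivativeV (R : realType) (F : R -> R) (t f' : R) :
  has_derivative F t f' -> F t != 0 ->
  has_derivative (fun t => (F t)^-1) t (- f' * (F t)^-1 * (F t)^-1).
Proof.
move=> /has_derivativeP dF F0; apply/has_derivativeP.
have H := @is_deriveV _ F t f' (1 : R) F0 dF.
by apply: is_derive_eq H _; rewrite /GRing.scale /=; field.
Qed.

Lemma has_derivative_affine (R : realType) (F : R -> R) (l c t f' : R) :
  has_derivative F (l * t + c) f' ->
  has_derivative (fun t => F (l * t + c)) t (l * f').
Proof.
move=> [H]; split=> e e0.
have l0 : 0 < `|l| + 1 by rewrite ltr_wpDl.
have [d d0 Hd] := H (e / (`|l| + 1)) (divr_gt0 e0 l0).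
exists (d / (`|l| + 1)); first by rewrite divr_gt0.
move=> s st; have E : l * s + c - (l * t + c) = l * (s - t) by ring.
have := Hd (l * s + c); rewrite E => H1.
have -> : l * f' * (s - t) = f' * (l * (s - t)) by ring.
apply: le_trans (H1 _) _.
  rewrite normrM; move: st; rewrite ltr_pdivlMr //; apply: le_lt_trans.
  by rewrite mulrC ler_wpM2l // lerDl.
rewrite normrM mulrA ler_wpM2r // mulrAC ler_pdivrMr // ler_wpM2l ?(ltW e0) //.
by rewrite lerDl.
Qed.

Lemma MVT_itv (R : realType) (F F' : R -> R) (c d x y M : R) :
  (forall t, has_derivative F t (F' t)) ->
  c <= x <= d -> c <= y <= d -> (forall t, c <= t <= d -> `|F' t| <= M) ->
  `|F y - F x| <= M * `|y - x|.
Proof.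
move=> dF + + HM; wlog xy : x y / x <= y.
  move=> W xcd ycd; have [|/ltW] := leP x y; first by move/W; apply.
  by move=> /W h; rewrite distrC [`|y - x|]distrC; exact: h.
move=> /andP[cx xd] /andP[cy yd]; have cF := has_derivative_cont dF.
have dF1 (t : R) : is_derive t (1 : R) F (F' t) by exact/has_derivativeP.
have [|t /[!in_itv]/= /andP[xt ty] ->] := MVT_segment xy (fun t _ => dF1 t).
  by apply: continuous_subspaceT => z; exact: cF.
by rewrite normrM ler_wpM2r // HM // (le_trans cx xt) (le_trans ty yd).
Qed.

(** A candidate for every derivative at once. Smoothness is proved by exhibiting a tower, and
    [tower_derive1n] then identifies [derive1n] with the given functions. *)
Definition tower (R : realType) (Fs : nat -> R -> R) :=
  forall n t, has_derivative (Fs n) t (Fs n.+1 t).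

Variant smooth (R : realType) (F : R -> R) : Prop :=
  Smooth of tower (fun n => derive1n n F).

Lemma smooth_has_derivative_n (R : realType) n (F : R -> R) t :
  smooth F -> has_derivative (derive1n n F) t (derive1n n.+1 F t).
Proof. by case=> /(_ n t). Qed.

Lemma tower_derive1n (R : realType) (Fs : nat -> R -> R) n :
  tower Fs -> derive1n n (Fs 0%N) = Fs n.
Proof.
by move=> tF; elim: n => //= n ->; apply/funext => t; exact: has_derivative_derive1.
Qed.

Lemma tower_smooth (R : realType) (Fs : nat -> R -> R) :
  tower Fs -> smooth (Fs 0%N).
Proof. by move=> tF; split=> n t; rewrite !tower_derive1n. Qed.

Lemma tower_cont (R : realType) (Fs : nat -> R -> R) n :
  tower Fs -> continuous (Fs n).
Proof. by move=> tF; exact: (has_derivative_cont (tF n)). Qed.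

Lemma derive1nSr (R : realType) n (F : R -> R) :
  derive1n n.+1 F = derive1n n (derive1 F).
Proof. by elim: n => //= n <-. Qed.

Lemma smooth_derive1 (R : realType) (F : R -> R) : smooth F -> smooth (derive1 F).
Proof.
move=> sF; split=> n t; rewrite -!derive1nSr; exact: smooth_has_derivative_n.
Qed.

Lemma smooth_derive1n (R : realType) n (F : R -> R) : smooth F -> smooth (derive1n n F).
Proof. by move=> sF; elim: n => [//|n IH]; exact: smooth_derive1 IH. Qed.

Lemma smooth_cont (R : realType) (F : R -> R) : smooth F -> continuous F.
Proof. by case=> tF; exact: (tower_cont (n := 0%N) tF). Qed.

Lemma smooth_has_derivative (R : realType) (F : R -> R) t :
  smooth F -> has_derivative F t (derive1 F t).
Proof. by move=> /(smooth_has_derivative_n 0 t). Qed.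

(** The derivative is peeled off on the inside: the derivative of a product or of an inverse is
    again built from functions that can be differentiated [n] times, so an induction on [n] replaces
    explicit Leibniz formulas. *)
Fixpoint diffn (R : realType) n (F : R -> R) : Prop :=
  if n is m.+1 then (forall t, has_derivative F t (derive1 F t)) /\ diffn m (derive1 F)
  else True.

Lemma smoothP (R : realType) (F : R -> R) : smooth F <-> forall n, diffn n F.
Proof.
split=> [sF n|H].
  elim: n F sF => [//|n IH F sF]; split=> [t|]; first exact: smooth_has_derivative.
  exact/IH/smooth_derive1.
split=> n t.
have := H n.+1; elim: n F {H} => [F [] //|n IH F [_ /IH]].
by rewrite -!derive1nSr.
Qed.

Lemma diffnW (R : realType) n (F : R -> R) : diffn n.+1 F -> diffn n F.
Proof. by elim: n F => // n IH F [dF d1]; split => //; exact: IH. Qed.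

Lemma diffnS (R : realType) n (F F' : R -> R) :
  (forall t, has_derivative F t (F' t)) -> diffn n F' -> diffn n.+1 F.
Proof.
move=> dF nF'; have E : derive1 F = F'.
  by apply/funext => t; exact: has_derivative_derive1.
by split; rewrite E.
Qed.

Lemma diffn_cst (R : realType) n (c : R) : diffn n (fun=> c).
Proof.
elim: n c => [//|n IH] c; apply: (diffnS (F' := fun=> 0)) => // t; exact: has_derivative_cst.
Qed.

Lemma diffnD (R : realType) n (F G : R -> R) :
  diffn n F -> diffn n G -> diffn n (fun t => F t + G t).
Proof.
elim: n F G => [//|n IH] F G [dF nF] [dG nG].
apply: (diffnS (F' := fun t => derive1 F t + derive1 G t)); last exact: IH.
by move=> t; exact: has_derivativeD.
Qed.

Lemma diffnM (R : realType) n (F G : R -> R) :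
  diffn n F -> diffn n G -> diffn n (fun t => F t * G t).
Proof.
elim: n F G => [//|n IH] F G HF HG.
have [dF nF] := HF; have [dG nG] := HG.
apply: (diffnS (F' := fun t => derive1 F t * G t + F t * derive1 G t)).
  by move=> t; exact: has_derivativeM.
by apply: diffnD; apply: IH => //; exact: diffnW.
Qed.

Lemma diffnV (R : realType) n (F : R -> R) :
  (forall t, F t != 0) -> diffn n F -> diffn n (fun t => (F t)^-1).
Proof.
move=> F0; elim: n F F0 => [//|n IH] F F0 HF; have [dF nF] := HF.
apply: (diffnS (F' := fun t => -1 * derive1 F t * (F t)^-1 * (F t)^-1)).
  by move=> t; rewrite mulN1r; exact: has_derivativeV.
by do !apply: diffnM => //; try exact: diffn_cst; apply: IH => //; exact: diffnW.
Qed.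

Lemma derive1n_affine (R : realType) (F : R -> R) (l c : R) n t : smooth F ->
  derive1n n (fun t => F (l * t + c)) t = l ^+ n * derive1n n F (l * t + c).
Proof.
move=> sF; pose Fs n t := l ^+ n * derive1n n F (l * t + c).
have tF : tower Fs.
  move=> k s; rewrite /Fs exprSr -mulrA.
  by apply: has_derivativeZ; apply: has_derivative_affine; exact: smooth_has_derivative_n.
have := tower_derive1n n tF; rewrite /Fs.
by under [X in derive1n _ X]eq_fun do rewrite expr0 mul1r; move=> ->.
Qed.

Lemma smooth_affine (R : realType) (F : R -> R) (l c : R) : smooth F ->
  smooth (fun t => F (l * t + c)).
Proof.
move=> sF; pose Fs n t := l ^+ n * derive1n n F (l * t + c).
have tF : tower Fs.
  move=> k s; rewrite /Fs exprSr -mulrA.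
  by apply: has_derivativeZ; apply: has_derivative_affine; exact: smooth_has_derivative_n.
have := tower_smooth tF; rewrite /Fs.
by under [X in smooth X]eq_fun do rewrite expr0 mul1r.
Qed.

Lemma smooth_cst (R : realType) (c : R) : smooth (fun=> c).
Proof. by apply/smoothP => n; exact: diffn_cst. Qed.

Lemma smoothD (R : realType) (F G : R -> R) :
  smooth F -> smooth G -> smooth (fun t => F t + G t).
Proof. by move=> /smoothP sF /smoothP sG; apply/smoothP => n; exact: diffnD. Qed.

Lemma smoothM (R : realType) (F G : R -> R) :
  smooth F -> smooth G -> smooth (fun t => F t * G t).
Proof. by move=> /smoothP sF /smoothP sG; apply/smoothP => n; exact: diffnM. Qed.

Lemma smoothZ (R : realType) (c : R) (F : R -> R) :
  smooth F -> smooth (fun t => c * F t).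
Proof. by move=> sF; apply: smoothM => //; exact: smooth_cst. Qed.

Lemma smoothB (R : realType) (F G : R -> R) :
  smooth F -> smooth G -> smooth (fun t => F t - G t).
Proof.
move=> sF sG; apply: smoothD => //.
by under eq_fun do rewrite -mulN1r; exact: smoothZ.
Qed.

Lemma smoothV (R : realType) (F : R -> R) :
  (forall t, F t != 0) -> smooth F -> smooth (fun t => (F t)^-1).
Proof. by move=> F0 /smoothP sF; apply/smoothP => n; exact: diffnV. Qed.

Lemma smooth_antiderivative (R : realType) (F F' : R -> R) :
  (forall t, has_derivative F t (F' t)) -> smooth F' -> smooth F.
Proof.
by move=> dF /smoothP sF'; apply/smoothP => -[//|n]; exact: (diffnS dF).
Qed.

Lemma smooth_id (R : realType) : smooth (fun t : R => t).
Proof.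
apply: (smooth_antiderivative (F' := fun=> 1)); last exact: smooth_cst.
by move=> t; exact: has_derivative_id.
Qed.

Lemma smooth_exp (R : realType) n : smooth (fun t : R => t ^+ n).
Proof.
elim: n => [|n IH]; first exact: smooth_cst.
by under eq_fun do rewrite exprS; apply: smoothM => //; exact: smooth_id.
Qed.

Lemma derive1nD (R : realType) n (F G : R -> R) t : smooth F -> smooth G ->
  derive1n n (fun t => F t + G t) t = derive1n n F t + derive1n n G t.
Proof.
move=> sF sG; pose Hs n t := derive1n n F t + derive1n n G t.
have tH : tower Hs by move=> k s; apply: has_derivativeD; exact: smooth_has_derivative_n.
by rewrite (tower_derive1n n tH).
Qed.

Lemma derive1nZ (R : realType) n (c : R) (F : R -> R) t : smooth F ->
  derive1n n (fun t => c * F t) t = c * derive1n n F t.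
Proof.
move=> sF; pose Hs n t := c * derive1n n F t.
have tH : tower Hs.
  by move=> k s; apply: has_derivativeZ; exact: smooth_has_derivative_n.
by rewrite (tower_derive1n n tH).
Qed.

Lemma derive1nB (R : realType) n (F G : R -> R) t : smooth F -> smooth G ->
  derive1n n (fun t => F t - G t) t = derive1n n F t - derive1n n G t.
Proof.
move=> sF sG; pose Hs n t := derive1n n F t - derive1n n G t.
have tH : tower Hs by move=> k s; apply: has_derivativeB; exact: smooth_has_derivative_n.
by rewrite (tower_derive1n n tH).
Qed.

Lemma derive1n_near (R : realType) n (F G : R -> R) (x r : R) :
  smooth F -> smooth G -> 0 < r -> (forall s, `|s - x| < r -> F s = G s) ->
  derive1n n F x = derive1n n G x.
Proof.
move=> sF sG r0 FG; suff : forall s, `|s - x| < r -> derive1n n F s = derive1n n G s.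
  by apply; rewrite subrr normr0.
elim: n => //= n IH s sx.
apply: has_derivative_derive1; apply: (@near_has_derivative _ _ (derive1n n G) _ _ (r - `|s - x|)).
- by rewrite subr_gt0.
- move=> u us; apply: IH; rewrite ltrBrDr in us; apply: le_lt_trans us.
  by rewrite -[u - x](subrKA s) ler_normD.
- exact: (smooth_has_derivative_n n s sG).
Qed.

Lemma cont_eq_at_left (R : realType) (F G : R -> R) (x r : R) : 0 < r ->
  continuous F -> continuous G -> (forall s, x - r < s < x -> F s = G s) -> F x = G x.
Proof.
move=> r0 cF cG FG; apply/eqP; rewrite -subr_eq0 -normr_le0; apply/ler_addgt0Pl => e e0.
have e2 : 0 < e / 2 by rewrite divr_gt0.
have /cvgrPdist_le/(_ _ e2)[d1 /= d10 H1] := cF x.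
have /cvgrPdist_le/(_ _ e2)[d2 /= d20 H2] := cG x.
pose m := Num.min (Num.min d1 d2) r.
have m0 : 0 < m by rewrite !lt_min d10 d20.
have mr : m <= r by rewrite ge_min lexx orbT.
have m1 : m <= d1 by rewrite !ge_min lexx.
have m2 : m <= d2 by rewrite !ge_min lexx orbT.
pose s := x - m / 2.
have xs : `|x - s| = m / 2 by rewrite /s subKr gtr0_norm // divr_gt0.
have h1 : `|F x - F s| <= e / 2 by apply: H1; rewrite /= xs; lra.
have h2 : `|G x - G s| <= e / 2 by apply: H2; rewrite /= xs; lra.
have E : F s = G s by apply: FG; rewrite /s; apply/andP; split; lra.
rewrite addr0 (splitr e) -[F x - G x](subrKA (F s)) {2}E.
by apply: le_trans (ler_normD _ _) _; rewrite [`|G s - _|]distrC lerD.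
Qed.

(** Left of [x] the derivatives agree by locality, and at [x] itself by continuity. One-sided
    agreement is what is available at the end of a gap. *)
Lemma derive1n_left (R : realType) n (F G : R -> R) (x : R) :
  smooth F -> smooth G -> (forall s, s <= x -> F s = G s) ->
  derive1n n F x = derive1n n G x.
Proof.
move=> sF sG FG; apply: (@cont_eq_at_left _ _ _ _ 1) => //.
- exact/smooth_cont/smooth_derive1n.
- exact/smooth_cont/smooth_derive1n.
move=> s /andP[_ sx]; apply: (@derive1n_near _ _ _ _ _ (x - s)) => //.
  by rewrite subr_gt0.
by move=> u us; apply: FG; rewrite ltW // -(ltrD2r (- s)); apply: le_lt_trans us; exact: ler_norm.
Qed.

Lemma derive1n_right (R : realType) n (F G : R -> R) (x : R) :
  smooth F -> smooth G -> (forall s, x <= s -> F s = G s) ->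
  derive1n n F x = derive1n n G x.
Proof.
move=> sF sG FG.
(* Reflection in the origin exchanges the two sides; the sign [(-1) ^+ n] that it produces is
   cancelled afterwards. *)
have := @derive1n_left _ n (fun t => F (-1 * t + 0)) (fun t => G (-1 * t + 0)) (- x).
have xx : -1 * - x + 0 = x by rewrite mulN1r opprK addr0.
rewrite !derive1n_affine // xx => H.
apply: (@mulfI _ ((-1) ^+ n)); first by rewrite signr_eq0.
apply: H; [exact: smooth_affine|exact: smooth_affine|].
by move=> s sx; apply: FG; rewrite mulN1r addr0 lerNr.
Qed.

Lemma derive1n_cst (R : realType) n (c t : R) :
  derive1n n (fun=> c) t = if n is 0%N then c else 0.
Proof.
case: n => // n; pose Hs n (t : R) := if n is 0%N then c else 0.
have tH : tower Hs by move=> [|k] s; exact: has_derivative_cst.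
by rewrite (tower_derive1n n.+1 tH).
Qed.

Lemma cont_bounded (R : realType) (F : R -> R) (x y : R) : continuous F ->
  exists2 M : R, 0 <= M & forall t, x <= t <= y -> `|F t| <= M.
Proof.
move=> cF; have [xy|yx] := leP x y; last first.
  by exists 0 => // t /andP[/le_trans h /h]; rewrite leNgt yx.
have [|c _ Hc] := @EVT_max _ (fun t => `|F t|) x y xy.
  by apply: continuous_subspaceT => z; apply: cvg_norm; exact: cF.
by exists `|F c| => // t txy; apply: Hc; rewrite in_itv.
Qed.

Lemma smooth_bounded (R : realType) n (F : R -> R) (x y : R) : smooth F ->
  exists2 M : R, 0 <= M & forall k t, (k <= n)%N -> x <= t <= y -> `|derive1n k F t| <= M.
Proof.
move=> sF; elim: n => [|n [M M0 HM]].
  have [M M0 HM] := cont_bounded x y (smooth_cont sF).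
  by exists M => // k t; rewrite leqn0 => /eqP -> ; exact: HM.
have [M' M'0 HM'] := cont_bounded x y (smooth_cont (smooth_derive1n n.+1 sF)).
exists (M + M'); first exact: addr_ge0.
move=> k t; rewrite leq_eqVlt => /orP[/eqP->/HM'|kn txy].
  by move/le_trans; apply; rewrite lerDr.
by apply: le_trans (HM k t kn txy) _; rewrite lerDl.
Qed.

(** * Taylor polynomials and termwise differentiation of series *)

(** The sequence [c] lists derivatives rather than coefficients, so that differentiation is a shift
    of [c]; [n] counts terms, and the degree is below [n]. *)
Definition taylor (R : realType) n (c : nat -> R) (s : R) : R :=
  \sum_(k < n) c k / k`!%:R * s ^+ k.

Lemma taylorS (R : realType) n (c : nat -> R) s :
  taylor n.+1 c s = taylor n c s + c n / n`!%:R * s ^+ n.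
Proof. by rewrite /taylor big_ord_recr. Qed.

Lemma taylor_at0 (R : realType) n (c : nat -> R) : taylor n.+1 c 0 = c 0%N.
Proof.
elim: n => [|n IH]; rewrite taylorS.
  by rewrite /taylor big_ord0 expr0 mulr1 divr1 add0r.
by rewrite IH expr0n mulr0 addr0.
Qed.

Lemma has_derivative_exp (R : realType) n (x : R) :
  has_derivative (fun t => t ^+ n.+1) x (n.+1%:R * x ^+ n).
Proof.
elim: n => [|n IH]; first by rewrite expr0 mulr1; exact: has_derivative_id.
under eq_fun do rewrite exprS.
apply: has_derivative_eq (has_derivativeM (has_derivative_id x) IH) _.
by rewrite mul1r mulrCA -exprS -[n.+2%:R]natr1 mulrDl mul1r addrC.
Qed.

Lemma has_derivative_taylor (R : realType) n (c : nat -> R) s :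
  has_derivative (taylor n.+1 c) s (taylor n (fun k => c k.+1) s).
Proof.
elim: n => [|n IH].
  have -> : taylor 1 c = fun=> c 0%N.
    by apply/funext => t; rewrite /taylor big_ord1 expr0 mulr1 divr1.
  by rewrite /taylor big_ord0; exact: has_derivative_cst.
have -> : taylor n.+2 c = fun t => taylor n.+1 c t + c n.+1 / n.+1`!%:R * t ^+ n.+1.
  by apply/funext => t; rewrite taylorS.
rewrite taylorS; apply: has_derivativeD => //.
apply: has_derivative_eq (has_derivativeZ _ (has_derivative_exp n s)) _.
rewrite factS natrM invfM.
have n0 : n.+1%:R != 0 :> R by rewrite pnatr_eq0.
set N := n.+1%:R in n0 *; set q' := n`!%:R^-1.
by have -> : c n.+1 * (N^-1 * q') * (N * s ^+ n) = c n.+1 * q' * s ^+ n * (N^-1 * N);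
  [ring|rewrite mulVf // mulr1].
Qed.

Lemma has_derivative_shift (R : realType) (F : R -> R) (x t f' : R) :
  has_derivative F (t - x) f' -> has_derivative (fun t => F (t - x)) t f'.
Proof.
move=> dF; have := @has_derivative_affine _ F 1 (- x) t f'; rewrite !mul1r => /(_ dF).
by under [X in has_derivative X]eq_fun do rewrite mul1r.
Qed.

(** The remainder with one more term vanishes at [x] and its derivative is the remainder of
    [derive1 F], so each induction step gains a factor [|z - x|] by the mean value theorem. The
    usual [1/n!] is given up. *)
Lemma taylor_remainder (R : realType) n (F : R -> R) (c d x z M : R) : smooth F ->
  c <= x <= d -> c <= z <= d ->
  (forall t, c <= t <= d -> `|derive1n n F t| <= M) ->
  `|F z - taylor n (fun k => derive1n k F x) (z - x)| <= M * `|z - x| ^+ n.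
Proof.
elim: n F c d z M => [|n IH] F c d z M sF xcd zcd HM.
  by rewrite /taylor big_ord0 subr0 expr0 mulr1 HM.
(* On the segment between [x] and [z] every [t] satisfies [|t - x| <= |z - x|], which turns the
   inductive bound at [t] into one in terms of [z]. *)
wlog [cE dE] : c d xcd zcd HM / c = Num.min x z /\ d = Num.max x z.
  move=> W; apply: (W (Num.min x z) (Num.max x z)) => //.
  - by rewrite ge_min le_max !lexx.
  - by rewrite ge_min le_max !lexx !orbT.
  move=> t /andP[t1 t2]; apply: HM; apply/andP; split.
    by apply: le_trans t1; rewrite le_min; case/andP: xcd => ->; case/andP: zcd => ->.
  apply: (le_trans t2); rewrite ge_max.
  by case/andP: xcd => _ ->; case/andP: zcd => _ ->.
pose G w := F w - taylor n.+1 (fun k => derive1n k F x) (w - x).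
pose G' w := derive1 F w - taylor n (fun k => derive1n k (derive1 F) x) (w - x).
have dG w : has_derivative G w (G' w).
  apply: has_derivativeB; first exact: smooth_has_derivative.
  apply: has_derivative_shift; apply: has_derivative_eq (has_derivative_taylor _ _ _) _.
  by congr taylor; apply/funext => k; rewrite -derive1nSr.
have Gx : G x = 0 by rewrite /G subrr taylor_at0 subrr.
have M0 : 0 <= M by apply: le_trans (HM x xcd).
have B t : c <= t <= d -> `|G' t| <= M * `|z - x| ^+ n.
  move=> tcd; apply: le_trans (IH (derive1 F) c d t M _ xcd tcd _) _.
  - exact: smooth_derive1.
  - by move=> u /HM; rewrite derive1nSr.
  rewrite ler_wpM2l // lerXn2r ?nnegrE ?normr_ge0 //.
  move: tcd; rewrite cE dE; case: (leP x z) => xz /andP[t1 t2].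
    by rewrite !ger0_norm ?subr_ge0 // lerD2r.
  by rewrite !ler0_norm ?subr_le0 // ?lerN2 ?lerD2r // ltW.
have := MVT_itv dG xcd zcd B; rewrite Gx subr0 /G => /le_trans; apply.
by rewrite exprSr mulrA.
Qed.

(** The values at the [n + 1] points [r i / (n + 1)] determine the numbers [c k * r ^+ k] through an
    inverse Vandermonde matrix that does not depend on [r]; [C] is the sum of the absolute values of
    its entries. *)
Lemma coef_bound (R : realType) n : exists2 C : R, 0 <= C &
  forall (c : nat -> R) (r A : R), 0 < r ->
    (forall s, 0 <= s <= r -> `|\sum_(k < n.+1) c k * s ^+ k| <= A) ->
    forall k : nat, (k <= n)%N -> `|c k| * r ^+ k <= C * A.
Proof.
pose a : 'rV[R]_n.+1 := \row_(i < n.+1) (i%:R / n.+1%:R).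
pose V := Vandermonde n.+1 a.
have Vu : V \in unitmx.
  rewrite unitmxE det_Vandermonde unitfE; apply/prodf_neq0 => i _.
  apply/prodf_neq0 => j ij; rewrite !mxE -mulrBl mulf_neq0 //.
  by rewrite subr_eq0 eqr_nat gtn_eqF.
pose C := \sum_(i < n.+1) \sum_(j < n.+1) `|invmx V i j|.
exists C; first by apply: sumr_ge0 => i _; apply: sumr_ge0.
move=> c r A r0 H k kn.
have A0 : 0 <= A by apply: le_trans (H 0 _) => //; rewrite lexx ltW.
pose w : 'rV[R]_n.+1 := \row_k (c k * r ^+ k).
have wV i : `|(w *m V) 0 i| <= A.
  have -> : (w *m V) 0 i = \sum_(k < n.+1) c k * (r * a 0 i) ^+ k.
    by rewrite mxE; apply: eq_bigr => j _; rewrite [w 0 j]mxE [V j i]mxE exprMn mulrA.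
  apply: H; rewrite mxE mulr_ge0 ?(ltW r0) ?divr_ge0 //= ler_piMr ?(ltW r0) //.
  by rewrite ler_pdivrMr // mul1r ler_nat ltnW.
have wE : w = (w *m V) *m invmx V by rewrite mulmxK.
have k' : (k < n.+1)%N by [].
have -> : `|c k| * r ^+ k = `|w 0 (Ordinal k')|.
  by rewrite mxE normrM (ger0_norm (exprn_ge0 _ (ltW r0))).
rewrite wE mxE; apply: le_trans (ler_norm_sum _ _ _) _.
rewrite mulr_suml; apply: ler_sum => i _; rewrite normrM mulrC mulr_suml.
rewrite (bigD1 (Ordinal k')) //= -[leLHS]addr0 lerD //.
  by rewrite ler_wpM2l.
by apply: sumr_ge0 => j _; rewrite mulr_ge0.
Qed.

(** The sign [sg] allows testing on one side of the centre only, as is necessary near an end of an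
    interval. The factor [n!] pays for the division of the derivatives by [k!]. *)
Lemma taylor_coef_bound (R : realType) n : exists2 C : R, 0 <= C &
  forall (c : nat -> R) (sg r A : R), 0 < r -> `|sg| = 1 ->
    (forall s, 0 <= s <= r -> `|taylor n.+1 c (sg * s)| <= A) ->
    forall k : nat, (k <= n)%N -> `|c k| * r ^+ k <= C * A.
Proof.
have [C C0 HC] := @coef_bound R n.
exists (C * n`!%:R); first by rewrite mulr_ge0.
move=> c sg r A r0 sg1 H k kn.
have A0 : 0 <= A by apply: le_trans (H 0 _) => //; rewrite lexx ltW.
have := HC (fun k => c k / k`!%:R * sg ^+ k) r A r0 _ k kn => /(_ _)Hk.
have : `|c k / k`!%:R * sg ^+ k| * r ^+ k <= C * A.
  apply: Hk => s /H; rewrite /taylor.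
  by under eq_bigr do rewrite exprMn mulrA.
rewrite !normrM normrX sg1 expr1n mulr1 normfV normr_nat mulrAC.
have kf : (0 < k`!)%N by rewrite fact_gt0.
rewrite ler_pdivrMr ?ltr0n // => /le_trans; apply.
rewrite [leRHS]mulrAC ler_wpM2l ?mulr_ge0 //.

by rewrite ler_nat; apply: leq_fact.
Qed.

(** A Landau-Kolmogorov inequality. From any [t], one of the two sides contains a segment of half
    the length of [[c, d]]. There the Taylor polynomial at [t] differs from [H] by a remainder, so
    it is at most [2 A (d - c)^(n+1)], and its coefficients are bounded by [taylor_coef_bound]. The
    factor [2 ^+ n] comes from the half length. *)
Lemma derivative_interpolation (R : realType) n : exists2 C : R, 0 <= C &
  forall (H : R -> R) (c d A : R), smooth H -> c < d ->
    (forall t, c <= t <= d -> `|H t| <= A * (d - c) ^+ n.+1) ->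
    (forall t, c <= t <= d -> `|derive1n n.+1 H t| <= A) ->
    forall k t, (k <= n)%N -> c <= t <= d ->
      `|derive1n k H t| <= C * A * (d - c) ^+ (n.+1 - k).
Proof.
have [C C0 HC] := @taylor_coef_bound R n.
exists (C * 2 * 2 ^+ n); first by rewrite !mulr_ge0 // exprn_ge0.
move=> H c d A sH cd HA HD k t kn tcd.
pose l := d - c; have l0 : 0 < l by rewrite subr_gt0.
have A0 : 0 <= A by apply: le_trans (HD t tcd).
have key sg : `|sg| = 1 -> (forall s, 0 <= s <= l / 2 -> c <= t + sg * s <= d) ->
    `|derive1n k H t| * (l / 2) ^+ k <= C * (2 * A * l ^+ n.+1).
  move=> sg1 Hs; apply: (HC (fun k => derive1n k H t) sg) => //.
    by rewrite divr_gt0.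
  move=> s sl; have tsd := Hs _ sl.
  have := taylor_remainder sH tcd tsd HD.
  have -> : t + sg * s - t = sg * s by ring.
  move=> h1; have := HA _ tsd; rewrite -/l => h2.
  set T := taylor _ _ _ in h1 *.
  have -> : T = H (t + sg * s) - (H (t + sg * s) - T) by ring.
  apply: le_trans (ler_normB _ _) _.
  have : A * `|sg * s| ^+ n.+1 <= A * l ^+ n.+1.
    rewrite ler_wpM2l // lerXn2r ?nnegrE ?(ltW l0) // normrM sg1 mul1r.
    by case/andP: sl => s0 sl; rewrite ger0_norm //; lra.
  lra.
have {key} : `|derive1n k H t| * (l / 2) ^+ k <= C * (2 * A * l ^+ n.+1).
  have [tm|tm] := leP (t - c) (l / 2).
    apply: (key 1); first by rewrite normr1.
    by move=> s; rewrite /l in tm *; case/andP: tcd => *; lra.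
  apply: (key (-1)); first by rewrite normrN1.
  by move=> s; rewrite /l in tm *; case/andP: tcd => *; lra.
have lk : 0 < l ^+ k by rewrite exprn_gt0.
have -> : l ^+ n.+1 = l ^+ (n.+1 - k) * l ^+ k by rewrite -exprD subnK // ltnW.
rewrite expr_div_n [X in X <= _ -> _]mulrA ler_pdivrMr ?exprn_gt0 // => h.
rewrite -(ler_pM2r lk); apply: (le_trans h); rewrite -/l.
have h2 : (2 : R) ^+ k <= 2 ^+ n by rewrite ler_weXn2l // ler1n.
have B0 : 0 <= C * (2 * A * (l ^+ (n.+1 - k) * l ^+ k)).
  by rewrite !mulr_ge0 // exprn_ge0 // ltW.
have := ler_wpM2l B0 h2.
by move/le_trans; apply; rewrite le_eqVlt; apply/orP; left; apply/eqP; ring.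
Qed.

Lemma series_norm_le (R : realType) (u M : R ^nat) :
  (forall i, `|u i| <= M i) -> cvgn (series M) ->
  cvgn (series u) /\ `|limn (series u)| <= limn (series M).
Proof.
move=> uM cM.
have cn : cvgn [normed series u].
  apply: (series_le_cvg _ _ uM cM) => i; first exact: normr_ge0.
  exact: (le_trans (normr_ge0 (u i)) (uM i)).
split; first exact: normed_cvg.
by apply: le_trans (lim_series_norm cn) _; exact: lim_series_le.
Qed.

Lemma tower_quad (R : realType) (Fs : nat -> R -> R) n (s t M : R) : tower Fs ->
  (forall x, `|Fs n.+2 x| <= M) ->
  `|Fs n s - Fs n t - Fs n.+1 t * (s - t)| <= M * (s - t) ^+ 2.
Proof.
move=> tF HM; have tF' : tower (fun k => Fs (n + k)%N).
  by move=> k x; rewrite addnS; exact: tF.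
pose c := Num.min s t; pose d := Num.max s t.
have cd x : x = s \/ x = t -> c <= x <= d.
  by rewrite /c /d ge_min le_max => -[] ->; rewrite lexx ?orbT.
have := @taylor_remainder _ 2 (Fs n) c d t s M.
have D1 : derive1 (Fs n) = Fs n.+1.
  by have := tower_derive1n 1 tF'; rewrite /= addn0 addn1.
have D2 : derive1 (Fs n.+1) = Fs n.+2.
  by have := tower_derive1n 2 tF'; rewrite /= addn0 addn2 D1.
rewrite /taylor !big_ord_recr big_ord0 /= D1 D2 expr0 expr1 add0r !divr1 mulr1.
rewrite opprD addrA real_normK ?num_real //; apply.
- by have := tower_smooth tF'; rewrite addn0.
- by apply: cd; right.
- by apply: cd; left.
- by move=> x _; exact: HM.
Qed.

(** The M-test in second-order form: each term has a quadratic Taylor error with constant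
    [M n.+2 i]. These constants are summable, so the sum has a quadratic error too, and this is
    differentiability. *)
Lemma tower_series (R : realType) (Fs : nat -> nat -> R -> R) (M : nat -> R ^nat) :
  (forall i, tower (Fs i)) -> (forall n, cvgn (series (M n))) ->
  (forall i n t, `|Fs i n t| <= M n i) ->
  tower (fun n t => limn (series (fun i => Fs i n t))) /\
  forall n t, `|limn (series (fun i => Fs i n t))| <= limn (series (M n)).
Proof.
move=> tF cM FM; have S n t := series_norm_le (fun i => FM i n t) (cM n).
split=> n t; last exact: (S n t).2.
apply: (@has_derivative_quad _ _ _ _ (limn (series (M n.+2)))) => s.
have -> : limn (series (fun i => Fs i n s)) - limn (series (fun i => Fs i n t)) -
    limn (series (fun i => Fs i n.+1 t)) * (s - t) =
    limn (series (fun i => Fs i n s - Fs i n t - Fs i n.+1 t * (s - t))).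
  pose f m x := fun i => Fs i m x.
  have -> : (fun i => Fs i n s - Fs i n t - Fs i n.+1 t * (s - t)) =
      f n s - f n t - (s - t) *: f n.+1 t.
    by apply/funext => i; rewrite /f !fctE /= [_ *: _]mulrC.
  rewrite lim_seriesB; [|exact: is_cvg_seriesB (S n s).1 (S n t).1|exact: is_cvg_seriesZ (S n.+1 t).1].
  rewrite lim_seriesB; [|exact: (S n s).1|exact: (S n t).1].
  by rewrite lim_seriesZ ?[_ *: _]mulrC //; exact: (S n.+1 t).1.
have cM2 : cvgn (series ((s - t) ^+ 2 *: M n.+2)) by exact: is_cvg_seriesZ.
have [|_] := @series_norm_le _ (fun i => Fs i n s - Fs i n t - Fs i n.+1 t * (s - t)) _ _ cM2.
  move=> i; rewrite fctE /= [_ *: _]mulrC; exact: tower_quad.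
by rewrite lim_seriesZ //= [_ *: _]mulrC.
Qed.

(** * Flat functions, cutoffs and Borel's lemma *)

Lemma has_derivative_comp (R : realType) (F G : R -> R) (t f' g' : R) :
  has_derivative F (G t) f' -> has_derivative G t g' ->
  has_derivative (fun t => F (G t)) t (f' * g').
Proof.
move=> /has_derivativeP dF /has_derivativeP dG.
by have /has_derivativeP := is_derive1_comp dF dG.
Qed.

Lemma has_derivative_horner (R : realType) (p : {poly R}) t :
  has_derivative (horner p) t p^`().[t].
Proof. by apply/has_derivativeP; exact: is_derive_poly. Qed.

Lemma horner_le_expR (R : realType) (q : {poly R}) :
  exists C : R, forall u, 0 <= u -> `|q.[u]| <= C * expR u.
Proof.
exists (\sum_(k < size q) `|q`_k| * k`!%:R) => u u0.
rewrite horner_coef mulr_suml; apply: le_trans (ler_norm_sum _ _ _) _.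
apply: ler_sum => k _; rewrite normrM -mulrA ler_wpM2l // ger0_norm ?exprn_ge0 //.
case: (nat_of_ord k) => [|n]; first by rewrite expr0 mul1r -expR0 ler_expR.
rewrite mulrC -ler_pdivrMr ?ltr0n ?fact_gt0 //.
by apply: le_trans (expR_ge1Dxn n u0); rewrite lerDr.
Qed.

(* [flat_fun p t] is [p(1/t) exp(-1/t)] for [t > 0] and [0] for [t <= 0]; these functions
   are stable under derivation. *)
Definition flat_fun (R : realType) (p : {poly R}) (t : R) : R :=
  if 0 < t then p.[t^-1] * expR (- t^-1) else 0.

Lemma has_derivative_flat_fun (R : realType) (p : {poly R}) t :
  has_derivative (flat_fun p) t (flat_fun ('X ^+ 2 * (p - p^`())) t).
Proof.
have [t0|t0|->] := ltgtP t 0.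
- rewrite {2}/flat_fun ltNge (ltW t0) /=.
  apply: (@near_has_derivative _ _ (fun=> 0) _ _ (- t)); rewrite ?oppr_gt0 //.
    move=> s; rewrite ltr_norml => /andP[_ h]; rewrite /flat_fun ifF //.
    by apply/negbTE; rewrite -leNgt; lra.
  exact: has_derivative_cst.
- apply: (@near_has_derivative _ _ (fun t => p.[t^-1] * expR (- t^-1)) _ _ t) => //.
    move=> s; rewrite ltr_norml => /andP[h _]; rewrite /flat_fun ifT //; lra.
  have tn : t != 0 by rewrite gt_eqF.
  have dV := has_derivativeV (has_derivative_id t) tn.
  have d1 := has_derivative_comp (has_derivative_horner p t^-1) dV.
  have dN : has_derivative (fun t : R => - t^-1) t (-1 * (- 1 / t / t)).
    by under eq_fun do rewrite -mulN1r; exact: has_derivativeZ.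
  have dE : has_derivative (@expR R) (- t^-1) (expR (- t^-1)).
    by apply/has_derivativeP; exact: is_derive_expR.
  have d2 := has_derivative_comp (G := fun t => - t^-1) dE dN.
  apply: has_derivative_eq (has_derivativeM d1 d2) _.
  by rewrite /flat_fun t0 hornerM hornerXn hornerD hornerN; field.
(* At 0 a quadratic bound is enough: with [u = 1/s], the inequality [|u^2 p(u)| <= C e^u] reads
   [|flat_fun p s| <= C s^2]. *)
- have [C HC] := horner_le_expR ('X ^+ 2 * p).
  apply: (@has_derivative_quad _ _ _ _ C) => s.
  rewrite {2 3}/flat_fun ltxx mul0r !subr0 /flat_fun.
  have C0 : 0 <= C.
    have := HC 0 (lexx _); rewrite expR0 mulr1; exact: le_trans.
  case: ltP => s0; last by rewrite normr0 mulr_ge0 // sqr_ge0.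
  have := HC s^-1; rewrite invr_ge0 => /(_ (ltW s0)).
  rewrite hornerM hornerXn normrM ger0_norm ?exprn_ge0 ?invr_ge0 ?(ltW s0) // => h.
  rewrite normrM (ger0_norm (expR_ge0 _)) expRN ler_pdivrMr ?expR_gt0 //.
  have s2 : 0 < s ^+ 2 by rewrite exprn_gt0.
  rewrite -(ler_pM2l (x := (s ^+ 2)^-1)) ?invr_gt0 // -exprVn.
  apply: le_trans h _; rewrite exprVn.
  by have -> : s ^- 2 * (C * s ^+ 2 * expR s^-1) = C * expR s^-1; [field; rewrite gt_eqF|].
Qed.

Definition psi (R : realType) : R -> R := flat_fun (1 : {poly R}).

Lemma smooth_psi (R : realType) : smooth (@psi R).
Proof.
pose p := fix p n := if n is m.+1 then 'X ^+ 2 * (p m - (p m)^`()) else 1 : {poly R}.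
have t : tower (fun n => flat_fun (p n)) by move=> n t; exact: has_derivative_flat_fun.
exact: (tower_smooth t).
Qed.

Lemma psi_gt0 (R : realType) (t : R) : 0 < t -> 0 < psi t.
Proof. by move=> t0; rewrite /psi /flat_fun t0 hornerE mul1r expR_gt0. Qed.

Lemma psi_eq0 (R : realType) (t : R) : t <= 0 -> psi t = 0.
Proof. by rewrite leNgt /psi /flat_fun => /negbTE ->. Qed.

Lemma psi_ge0 (R : realType) (t : R) : 0 <= psi t.
Proof. by case: (ltP 0 t) => t0; [exact/ltW/psi_gt0|rewrite psi_eq0]. Qed.

(** The reflection is written in the shape [l * t + c], to which [smooth_affine] applies. *)
Definition step (R : realType) (t : R) : R := psi t / (psi t + psi (-1 * t + 1)).

Lemma step_den_gt0 (R : realType) (t : R) : 0 < psi t + psi (-1 * t + 1).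
Proof.
case: (ltP 0 t) => t0; first by rewrite ltr_pwDl ?psi_gt0 ?psi_ge0.
by rewrite ltr_wpDl ?psi_ge0 ?psi_gt0 //; lra.
Qed.

Lemma smooth_step (R : realType) : smooth (@step R).
Proof.
apply: smoothM; first exact: smooth_psi.
apply: smoothV => [t|]; first by rewrite gt_eqF ?step_den_gt0.
by apply: smoothD; [exact: smooth_psi|exact/smooth_affine/smooth_psi].
Qed.

Lemma step0 (R : realType) (t : R) : t <= 0 -> step t = 0.
Proof. by move=> t0; rewrite /step psi_eq0 // mul0r. Qed.

Lemma step1 (R : realType) (t : R) : 1 <= t -> step t = 1.
Proof.
move=> t1; rewrite /step (psi_eq0 (t := -1 * t + 1)); last by lra.
by rewrite addr0 divff // gt_eqF // psi_gt0 //; lra.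
Qed.

Definition cutoff (R : realType) (t : R) : R := step (-1 * t + 2) * step (1 * t + 2).

Lemma smooth_cutoff (R : realType) : smooth (@cutoff R).
Proof. by apply: smoothM; apply: smooth_affine; exact: smooth_step. Qed.

Lemma cutoff1 (R : realType) (t : R) : `|t| <= 1 -> cutoff t = 1.
Proof.
by rewrite ler_norml => /andP[h1 h2]; rewrite /cutoff !step1 ?mulr1 //; lra.
Qed.

Lemma cutoff0 (R : realType) (t : R) : 2 <= `|t| -> cutoff t = 0.
Proof.
rewrite ler_normr => /orP[h|h]; rewrite /cutoff.
  by rewrite (step0 (t := -1 * t + 2)) ?mul0r //; lra.
by rewrite (step0 (t := 1 * t + 2)) ?mulr0 //; lra.
Qed.

Definition bump_fun (R : realType) (t : R) : R := psi t * psi (-1 * t + 1).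

Lemma smooth_bump_fun (R : realType) : smooth (@bump_fun R).
Proof. by apply: smoothM; [|apply: smooth_affine]; exact: smooth_psi. Qed.

Lemma bump_fun0 (R : realType) (t : R) : t <= 0 \/ 1 <= t -> bump_fun t = 0.
Proof.
rewrite /bump_fun => -[h|h]; first by rewrite psi_eq0 ?mul0r.
by rewrite (psi_eq0 (t := -1 * t + 1)) ?mulr0 //; lra.
Qed.

Lemma bump_fun_gt0 (R : realType) (t : R) : 0 < t < 1 -> 0 < bump_fun t.
Proof. by move=> /andP[h1 h2]; rewrite mulr_gt0 ?psi_gt0 //; lra. Qed.

(** Truncated subtraction makes the tower stop by itself: from order [n] on, the Taylor sums are
    empty. *)
Lemma tower_taylor (R : realType) n (c : nat -> R) :
  tower (fun m => taylor (n - m) (fun k => c (m + k)%N)).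
Proof.
move=> m s; rewrite subnS; case: (n - m)%N => [|k] /=.
  have -> : taylor 0 (fun k => c (m + k)%N) = fun=> 0.
    by apply/funext => t; rewrite /taylor big_ord0.
  by rewrite /taylor big_ord0; exact: has_derivative_cst.
apply: has_derivative_eq (has_derivative_taylor _ _ _) _.
by congr taylor; apply/funext => j; rewrite addnS addSn.
Qed.

Lemma derive1n_exp0 (R : realType) n k :
  derive1n n (fun s : R => s ^+ k) 0 = if n == k then k`!%:R else 0.
Proof.
pose c j : R := if j == k then k`!%:R else 0.
have E : (fun s : R => s ^+ k) = taylor (k.+1 - 0) (fun j => c (0 + j)%N).
  apply/funext => s; rewrite subn0 taylorS /c add0n eqxx divff ?pnatr_eq0 -?lt0n ?fact_gt0 //.
  rewrite mul1r /taylor big1 ?add0r // => i _.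
  by rewrite add0n ltn_eqF // !mul0r.
rewrite E (tower_derive1n n (tower_taylor k.+1 c)).
have [nk|kn] := leqP n k; first by rewrite subSn // taylor_at0 addn0 /c.
by rewrite (eqP (_ : k.+1 - n == 0)%N) ?subn_eq0 // /taylor big_ord0 gtn_eqF.
Qed.

Lemma cutoff_exp_bounded (R : realType) k n : exists2 C : R, 0 <= C &
  forall s, `|derive1n n (fun t : R => t ^+ k * cutoff t) s| <= C.
Proof.
have sE : smooth (fun t : R => t ^+ k * cutoff t).
  by apply: smoothM; [exact: smooth_exp|exact: smooth_cutoff].
have [C C0 HC] := smooth_bounded n (-2) 2 sE.
exists C => // s; have [s2|s2] := leP `|s| 2.
  by apply: HC => //; rewrite -ler_norml.
rewrite (@derive1n_near _ n _ (fun=> 0) s (`|s| - 2)) ?subr_gt0 //.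
- by rewrite derive1n_cst; case: (n) => [|?]; rewrite normr0.
- exact: smooth_cst.
move=> u us; rewrite cutoff0 ?mulr0 //.
by have := lerB_dist s u; rewrite distrC => h; lra.
Qed.

Lemma derive1n_cutoff_exp0 (R : realType) k n :
  derive1n n (fun t : R => t ^+ k * cutoff t) 0 = if n == k then k`!%:R else 0.
Proof.
rewrite -derive1n_exp0; apply: (@derive1n_near _ _ _ _ _ 1) => //.
- by apply: smoothM; [exact: smooth_exp|exact: smooth_cutoff].
- exact: smooth_exp.
by move=> s; rewrite subr0 => s1; rewrite cutoff1 ?mulr1 // ltW.
Qed.

(** The extension [B] and the bounds [M] come before [c]: they depend only on the bound [A] of the
    jets. This uniformity lets one family of constants serve all points of [K]. The sum is
    [c k / k!] times [t^k] cut off at scale [1 / la k]. *)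
Lemma borel (R : realType) (A : nat -> R) :
  exists (B : (nat -> R) -> R -> R) (M : nat -> R), forall c : nat -> R,
    (forall k, `|c k| <= A k) ->
    [/\ smooth (B c), forall k, derive1n k (B c) 0 = c k &
      forall k t, `|derive1n k (B c) t| <= M k].
Proof.
pose E k (t : R) := t ^+ k * cutoff t.
have sE k : smooth (E k).
  by apply: smoothM; [exact: smooth_exp|exact: smooth_cutoff].
have [C HC] : exists C : nat -> nat -> R,
    forall k n, 0 <= C k n /\ forall s, `|derive1n n (E k) s| <= C k n.
  have /choice[C HC] : forall k, exists Ck : nat -> R,
    forall n, 0 <= Ck n /\ forall s, `|derive1n n (E k) s| <= Ck n.
    move=> k; have /choice[Ck HCk] : forall n, exists Ckn : R,
        0 <= Ckn /\ forall s, `|derive1n n (E k) s| <= Ckn.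
      by move=> n; have [Ck] := cutoff_exp_bounded R k n; exists Ck.
    by exists Ck.
  by exists C.
have C0 k n : 0 <= C k n by case: (HC k n).
have {}HC k n s : `|derive1n n (E k) s| <= C k n by case: (HC k n).
(* The [n]-th derivative of term [k] is at most [D k n], which is proportional to [la k] to the
   power [n - k]. For [n < k] at least one factor [1 / la k] remains, and it brings [D k n] below
   [2^-k]. *)
pose la k := 1 + 2 ^+ k * `|A k| * \sum_(n < k) C k n.
have la1 k : 1 <= la k.
  by rewrite lerDl mulr_ge0 ?sumr_ge0 // mulr_ge0 ?exprn_ge0.
have la0 k : 0 < la k by apply: lt_le_trans (la1 k).
have lan0 k : la k != 0 by rewrite gt_eqF.
pose Fs (c : nat -> R) k n t :=
  c k / k`!%:R / la k ^+ k * (la k ^+ n * derive1n n (E k) (la k * t + 0)).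
pose D k n := `|A k| / la k ^+ k * la k ^+ n * C k n.
have D0 k n : 0 <= D k n by rewrite !mulr_ge0 ?invr_ge0 ?exprn_ge0 ?(ltW (la0 k)).
(* For fixed [n], the finitely many terms [k <= n], which [la] does not make small, are paid for by
   enlarging the constant of the geometric majorant. *)
pose K n := 1 + \sum_(k < n.+1) 2 ^+ k * D k n.
have K1 n : 1 <= K n.
  by rewrite lerDl sumr_ge0 // => k _; rewrite mulr_ge0 ?exprn_ge0.
pose M n k : R := geometric (K n) (2^-1) k.
have cM n : cvgn (series (M n)).
  by apply: is_cvg_geometric_series; rewrite gtr0_norm ?invr_gt0 // invf_lt1 // ltr1n.
have DM k n : D k n <= M n k.
  rewrite /M /geometric /= exprVn ler_pdivlMr ?exprn_gt0 //.
  have [kn|nk] := ltnP k n.+1.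
    rewrite /K (bigD1 (Ordinal kn)) //= mulrC addrCA lerDl addr_ge0 //.
    by rewrite sumr_ge0 // => j _; rewrite mulr_ge0 ?exprn_ge0.
  apply: le_trans (K1 n); rewrite /D.
  have -> : la k ^+ k = la k ^+ (k - n) * la k ^+ n by rewrite -exprD subnK // ltnW.
  have -> : `|A k| / (la k ^+ (k - n) * la k ^+ n) * la k ^+ n * C k n * 2 ^+ k =
            2 ^+ k * `|A k| * C k n / la k ^+ (k - n).
    by field; rewrite ?expf_neq0 ?lan0.
  rewrite ler_pdivrMr ?exprn_gt0 // mul1r.
  have -> : (k - n = (k - n).-1.+1)%N by rewrite prednK // subn_gt0.
  rewrite exprS; apply: (@le_trans _ _ (la k)); last first.
    by rewrite ler_peMr ?(ltW (la0 k)) // exprn_ege1.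
  rewrite /la (bigD1 (Ordinal nk)) //= mulrDr [in leRHS]addrCA lerDl addr_ge0 //.
  by rewrite mulr_ge0 ?sumr_ge0 // mulr_ge0 ?exprn_ge0.
exists (fun c t => limn (series (fun k => Fs c k 0%N t))).
exists (fun n => limn (series (M n))) => c cA.
have tF k : tower (Fs c k).
  move=> n t; apply: has_derivativeZ; rewrite exprSr -mulrA; apply: has_derivativeZ.
  by apply: has_derivative_affine; exact: smooth_has_derivative_n.
have FM k n t : `|Fs c k n t| <= M n k.
  apply: le_trans (DM k n); rewrite /Fs /D.
  have f1 : 1 <= k`!%:R :> R by rewrite ler1n fact_gt0.
  rewrite !normrM !normfV !normrX (gtr0_norm (la0 k)) normr_nat !mulrA.
  apply: ler_pM => //; rewrite ?mulr_ge0 ?invr_ge0 ?exprn_ge0 ?(ltW (la0 k)) //.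
  rewrite ler_wpM2r ?exprn_ge0 ?(ltW (la0 k)) //.
  rewrite ler_wpM2r ?invr_ge0 ?exprn_ge0 ?(ltW (la0 k)) //.
  apply: le_trans (_ : `|c k| <= _); last exact: le_trans (cA k) (ler_norm _).
  by rewrite ler_pdivrMr ?(lt_le_trans _ f1) // ler_peMr.
have [tS HS] := tower_series tF cM FM.
split; first exact: (tower_smooth tS).
- move=> k; rewrite (tower_derive1n k tS).
  have E0 j : Fs c j k 0 = if j == k then c k else 0.
    rewrite /Fs mulr0 addr0 derive1n_cutoff_exp0 eq_sym.
    case: eqP => [->|_]; last by rewrite !mulr0.
    by rewrite mulrA !divfK // ?expf_neq0 // pnatr_eq0 -lt0n fact_gt0.
  under [X in series X]eq_fun do rewrite E0.
  apply/cvg_lim; first exact: Rhausdorff.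
  apply: cvg_near_cst; exists k.+1 => // m /= km.
  rewrite /series /= big_mkord (bigD1 (Ordinal km)) //= eqxx big1 ?addr0 // => j.
  by move=> /negbTE jk; rewrite ifF.
- by move=> k t; rewrite (tower_derive1n k tS).
Qed.

(** * Whitney extension on the line *)

Lemma has_derivative_quad_near (R : realType) (F : R -> R) (x L C : R) :
  (forall s, `|s - x| <= 1 -> `|F s - F x - L * (s - x)| <= C * (s - x) ^+ 2) ->
  has_derivative F x L.
Proof.
move=> H; pose F1 s := if `|s - x| <= 1 then F s else F x + L * (s - x).
have C0 : 0 <= C.
  have := H (x + 1); rewrite addrAC subrr add0r normr1 lexx expr1n !mulr1 => /(_ isT).
  by move=> h; rewrite (le_trans _ h).
apply: (@near_has_derivative _ _ F1 _ _ 1) => //.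
  by move=> s /ltW sx; rewrite /F1 sx.
apply: (@has_derivative_quad _ _ _ _ C) => s; rewrite /F1 subrr normr0 ler01.
case: ifP => [/H //|_]; have -> : F x + L * (s - x) - F x - L * (s - x) = 0 by ring.
by rewrite normr0 mulr_ge0 // sqr_ge0.
Qed.

Lemma smooth_quad (R : realType) (F : R -> R) k (c d x z M : R) : smooth F ->
  c <= x <= d -> c <= z <= d -> (forall t, c <= t <= d -> `|derive1n k.+2 F t| <= M) ->
  `|derive1n k F z - derive1n k F x - derive1n k.+1 F x * (z - x)| <= M * (z - x) ^+ 2.
Proof.
move=> sF xcd zcd HM.
have := taylor_remainder (n := 2) (smooth_derive1n k sF) xcd zcd HM.
rewrite /taylor !big_ord_recr big_ord0 /= expr0 expr1 add0r !divr1 mulr1.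
by rewrite opprD addrA real_normK ?num_real.
Qed.

(** [G t] is the smooth piece around [t], the same function for all nearby points. To differentiate
    at [x] in [K], a point [t] off [K] is reached through [c] in [K]: the error is that of the piece
    from [c] to [t], plus that of the jets from [x] to [c], plus the change of the slope between [x]
    and [c] times [t - c]. All three are quadratic in [|t - x| = |t - c| + |c - x|]. *)
Lemma glue (R : realType) (K : set R) (al : nat -> R -> R) (G : R -> R -> R)
    (C M : nat -> R) :
  closed K ->
  (forall k x y, K x -> K y ->
     `|al k y - al k x - al k.+1 x * (y - x)| <= C k * (y - x) ^+ 2) ->
  (forall t, ~ K t -> smooth (G t) /\
     exists2 r, 0 < r & forall s, `|s - t| < r -> G s = G t) ->
  (forall t x, ~ K t -> K x -> exists c, [/\ K c, x <= c <= t \/ t <= c <= x,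
     forall k, derive1n k (G t) c = al k c &
     forall k s, c <= s <= t \/ t <= s <= c -> `|derive1n k (G t) s| <= M k]) ->
  tower (fun k t => if t \in K then al k t else derive1n k (G t) t).
Proof.
move=> cK H1 H2 H3 k t; have [tK|/negP tK] := boolP (t \in K); last first.
  have nKt : ~ K t by move=> Kt; apply: tK; rewrite inE.
  have [sG [r r0 Gr]] := H2 t nKt.
  have [r' r'0 Kr'] : exists2 r', 0 < r' & forall s, `|s - t| < r' -> ~ K s.
    have := closed_openC cK; rewrite openE => /(_ t nKt)[r' /= r'0 Hr'].
    by exists r' => // s st; apply: Hr'; rewrite /ball /= distrC.
  apply: (@near_has_derivative _ _ (derive1n k (G t)) _ _ (Num.min r r')).
  - by rewrite lt_min r0.
  - move=> s; rewrite lt_min => /andP[sr sr']; rewrite ifF ?Gr //.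
    by apply/negbTE/negP; rewrite inE; exact: Kr'.
  - exact: smooth_has_derivative_n.
have Kt : K t by rewrite inE in tK.
pose Q := `|C k| + (`|M k.+2| + (`|al k.+2 t| + `|C k.+1|)).
have Ck : C k <= Q.
  by rewrite /Q (le_trans (ler_norm _)) // lerDl !addr_ge0.
apply: (@has_derivative_quad_near _ _ _ _ Q) => s st; rewrite tK.
case: (boolP (s \in K)) => [sK|/negP sK].
  rewrite inE in sK; apply: le_trans (H1 k _ _ Kt sK) _.
  by rewrite ler_wpM2r ?sqr_ge0.
have nKs : ~ K s by move=> Ks; apply: sK; rewrite inE.
have [c [Kc tcs Gc GM]] := H3 s t nKs Kt; have [sG _] := H2 s nKs.
have ord : `|s - t| = `|s - c| + `|c - t|.
  case: tcs => /andP[h1 h2].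
    by rewrite !ger0_norm ?subr_ge0 ?(le_trans h1) //; ring.
  by rewrite !ler0_norm ?subr_le0 ?(le_trans h1) //; ring.
have e1 : `|derive1n k (G s) s - al k c - al k.+1 c * (s - c)| <= `|M k.+2| * `|s - c| ^+ 2.
  rewrite -!Gc real_normK ?num_real //; case: tcs => /andP[h1 h2].
    apply: (@smooth_quad _ _ _ c s) => //; rewrite ?lexx ?h2 ?h1 //.
    by move=> u us; apply: le_trans (ler_norm _); apply: GM; left.
  apply: (@smooth_quad _ _ _ s c) => //; rewrite ?lexx ?h2 ?h1 //.
  by move=> u us; apply: le_trans (ler_norm _); apply: GM; right.
have e2 : `|al k c - al k t - al k.+1 t * (c - t)| <= `|C k| * `|c - t| ^+ 2.
  rewrite real_normK ?num_real //; apply: le_trans (H1 k _ _ Kt Kc) _.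
  by rewrite ler_wpM2r ?sqr_ge0 ?ler_norm.
(* The slope must vary at most linearly; the restriction [|s - t| <= 1] turns the quadratic error of
   its expansion into a linear one. *)
have e3 : `|al k.+1 c - al k.+1 t| <= (`|al k.+2 t| + `|C k.+1|) * `|c - t|.
  have -> : al k.+1 c - al k.+1 t =
    al k.+1 c - al k.+1 t - al k.+2 t * (c - t) + al k.+2 t * (c - t) by ring.
  apply: le_trans (ler_normD _ _) _; rewrite [X in _ + X <= _]normrM.
  rewrite addrC mulrDl lerD2l; apply: le_trans (H1 k.+1 _ _ Kt Kc) _.
  apply: (@le_trans _ _ (`|C k.+1| * (c - t) ^+ 2)).
    by rewrite ler_wpM2r ?sqr_ge0 ?ler_norm.
  rewrite ler_wpM2l // -real_normK ?num_real // expr2 ler_piMl //.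
  by apply: le_trans st; rewrite ord lerDr.
have -> : derive1n k (G s) s - al k t - al k.+1 t * (s - t) =
  (derive1n k (G s) s - al k c - al k.+1 c * (s - c)) +
  (al k c - al k t - al k.+1 t * (c - t)) + (al k.+1 c - al k.+1 t) * (s - c) by ring.
apply: le_trans (ler_normD _ _) _; apply: le_trans (lerD (ler_normD _ _) (lexx _)) _.
rewrite normrM -[in leRHS](real_normK (num_real (s - t))) ord.
apply: le_trans (lerD (lerD e1 e2) (ler_wpM2r (normr_ge0 _) e3)) _.
have n1 := normr_ge0 (s - c); have n2 := normr_ge0 (c - t).
have q1 := normr_ge0 (M k.+2); have q2 := normr_ge0 (C k).
have q3 : 0 <= `|al k.+2 t| + `|C k.+1| by rewrite addr_ge0.
rewrite /Q; move: `|s - c| `|c - t| `|M k.+2| `|C k| (`|al k.+2 t| + `|C k.+1|)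
  n1 n2 q1 q2 q3 => p q m u e p0 q0 m0 u0 e0.
rewrite -subr_ge0.
have -> : (u + (m + e)) * (p + q) ^+ 2 - (m * p ^+ 2 + u * q ^+ 2 + e * q * p) =
  u * (p ^+ 2 + 2 * p * q) + m * (2 * p * q + q ^+ 2) +
  e * (p ^+ 2 + p * q + q ^+ 2) by ring.
by rewrite ?(addr_ge0, mulr_ge0, sqr_ge0).
Qed.

(** Weighting the [j]-th derivative by [l ^+ j] makes the bounds invariant under rescaling to a gap
    of length [l]. Each differentiation splits the product in two, whence [2 ^+ i]. *)
Lemma scaled_leibniz (R : realType) i (F G : R -> R) (t l A B : R) :
  smooth F -> smooth G -> 0 < l ->
  (forall j, (j <= i)%N -> `|derive1n j F t| * l ^+ j <= A) ->
  (forall j, (j <= i)%N -> `|derive1n j G t| * l ^+ j <= B) ->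
  `|derive1n i (fun t => F t * G t) t| * l ^+ i <= 2 ^+ i * A * B.
Proof.
elim: i F G A B => [|i IH] F G A B sF sG l0 HA HB.
  have := HA 0%N isT; have := HB 0%N isT; rewrite /= !expr0 !mulr1 mul1r => h1 h2.
  by rewrite normrM ler_pM.
have E : derive1 (fun t => F t * G t) = fun t => derive1 F t * G t + F t * derive1 G t.
  apply/funext => x; apply: has_derivative_derive1.
  by apply: has_derivativeM; exact: smooth_has_derivative.
have sF' := smooth_derive1 sF; have sG' := smooth_derive1 sG.
rewrite derive1nSr E derive1nD; [|exact: smoothM|exact: smoothM].
have h1 : `|derive1n i (fun t => derive1 F t * G t) t| * l ^+ i <= 2 ^+ i * (A / l) * B.
  apply: IH => // j ji; last by apply: HB; exact: ltnW.
  by rewrite -derive1nSr ler_pdivlMr // -mulrA -exprSr HA.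
have h2 : `|derive1n i (fun t => F t * derive1 G t) t| * l ^+ i <= 2 ^+ i * A * (B / l).
  apply: IH => // j ji; first by apply: HA; exact: ltnW.
  by rewrite -derive1nSr ler_pdivlMr // -mulrA -exprSr HB.
rewrite exprSr mulrA -ler_pdivlMr //.
apply: le_trans (ler_wpM2r _ (ler_normD _ _)) _; first by rewrite exprn_ge0 // ltW.
rewrite mulrDl; apply: le_trans (lerD h1 h2) _.
by rewrite le_eqVlt; apply/orP; left; apply/eqP; rewrite exprS; field; rewrite gt_eqF.
Qed.

Section gaps.
Variables (R : realType) (K : set R).
Hypothesis cK : closed K.

Definition below t : set R := [set x | K x /\ x <= t].
Definition above t : set R := [set x | K x /\ t <= x].

Lemma sup_below t : below t !=set0 ->
  [/\ K (sup (below t)), sup (below t) <= t & forall x, K x -> x <= t -> x <= sup (below t)].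
Proof.
move=> L0; have hs : has_sup (below t) by split => //; exists t => x [].
have clL : closed (below t).
  by rewrite (_ : below t = K `&` [set x | x <= t]) //; apply: closedI => //; exact: closed_le.
have [Kt tt] : below t (sup (below t)).
  by apply: clL; apply: closure_sup => //; case: hs.
by split => // x Kx xt; apply: ub_le_sup => //; case: hs.
Qed.

Lemma inf_above t : above t !=set0 ->
  [/\ K (inf (above t)), t <= inf (above t) & forall x, K x -> t <= x -> inf (above t) <= x].
Proof.
move=> L0; have hs : has_inf (above t) by split => //; exists t => x [].
have clL : closed (above t).
  by rewrite (_ : above t = K `&` [set x | t <= x]) //; apply: closedI => //; exact: closed_ge.
have [Kt tt] : above t (inf (above t)).
  apply: clL => V [e /= e0 HV]; have [z Lz zlt] := inf_adherent e0 hs.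
  exists z; split => //; apply: HV; have := ge_inf hs.2 Lz; rewrite /ball_ /= distrC => h.
  by rewrite ger0_norm ?subr_ge0 // ltrBlDl.
by split => // x Kx xt; apply: ge_inf => //; case: hs.
Qed.

(** Anything defined through these two sets alone is therefore locally constant off [K]; in this way
    the pieces satisfy the local requirement of [glue]. *)
Lemma below_above_near t : ~ K t -> exists2 r : R, 0 < r & forall s, `|s - t| < r ->
  below s = below t /\ above s = above t.
Proof.
move=> nKt; have := closed_openC cK; rewrite openE => /(_ t nKt)[r /= r0 Hr].
exists r => // s st.
have far x : K x -> r <= `|t - x|.
  by move=> Kx; rewrite leNgt; apply/negP => h; apply: (Hr x).
move: st; rewrite ltr_norml => /andP[s1 s2].
split; apply/seteqP; split => x [Kx xs]; split => //; move: (far x Kx);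
  by case: (lerP x t) => h1 h2; lra.
Qed.

End gaps.

(** A point off the closed set [K] lies either in a bounded gap, whose ends are a supremum and an
    infimum of points of [K], or beyond all of [K]; [GG] and [E] provide the pieces in the two
    cases. The bounds [M] must not depend on the gap. The last clause allows computing with the
    glued function inside a gap. *)
Lemma glue_gaps (R : realType) (K : set R) (al : nat -> R -> R) (GG : R -> R -> R -> R)
    (E : R -> R -> R) (C M : nat -> R) :
  closed K -> K !=set0 ->
  (forall k x y, K x -> K y ->
     `|al k y - al k x - al k.+1 x * (y - x)| <= C k * (y - x) ^+ 2) ->
  (forall c d, K c -> K d -> c < d -> (forall x, K x -> x <= c \/ d <= x) ->
     [/\ smooth (GG c d), forall k, derive1n k (GG c d) c = al k c,
       forall k, derive1n k (GG c d) d = al k d &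
       forall k t, c <= t <= d -> `|derive1n k (GG c d) t| <= M k]) ->
  (forall c, K c -> [/\ smooth (E c), forall k, derive1n k (E c) c = al k c &
     forall k t, `|derive1n k (E c) t| <= M k]) ->
  exists F, [/\ smooth F, forall k x, K x -> derive1n k F x = al k x &
    forall k t, ~ K t ->
      (exists c d, [/\ K c, K d, c < t < d, forall x, K x -> x <= c \/ d <= x &
         derive1n k F t = derive1n k (GG c d) t]) \/
      (exists c, [/\ K c, (forall x, K x -> x <= t) \/ (forall x, K x -> t <= x) &
         derive1n k F t = derive1n k (E c) t])].
Proof.
move=> cK [x0 Kx0] H1 HG HE.
pose G0 (L U : set R) := if pselect (L !=set0) then
  (if pselect (U !=set0) then GG (sup L) (inf U) else E (sup L)) else E (inf U).
pose G t := G0 (below K t) (above K t).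
pose F k t := if t \in K then al k t else derive1n k (G t) t.
have lt_sup t : ~ K t -> below K t !=set0 -> sup (below K t) < t.
  move=> nKt /(sup_below cK)[Ks st _]; rewrite lt_neqAle st andbT.
  by apply/eqP => e; apply: nKt; rewrite -e.
have gt_inf t : ~ K t -> above K t !=set0 -> t < inf (above K t).
  move=> nKt /(inf_above cK)[Ks st _]; rewrite lt_neqAle st andbT.
  by apply/eqP => e; apply: nKt; rewrite e.
have gap t : ~ K t -> below K t !=set0 -> above K t !=set0 ->
    [/\ K (sup (below K t)), K (inf (above K t)), sup (below K t) < t < inf (above K t) &
     forall x, K x -> x <= sup (below K t) \/ inf (above K t) <= x].
  move=> nKt L0 U0; have [Ks st mx] := sup_below cK L0.
  have [Ki ti mn] := inf_above cK U0; split=> //; first by rewrite lt_sup ?gt_inf.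
  by move=> x Kx; have [xt|/ltW tx] := leP x t; [left; exact: mx|right; exact: mn].
have Gcase t : ~ K t ->
    (exists c d, [/\ K c, K d, c < t < d, forall x, K x -> x <= c \/ d <= x & G t = GG c d]) \/
    (exists c, [/\ K c, (forall x, K x -> x <= t) \/ (forall x, K x -> t <= x) & G t = E c]).
  move=> nKt; rewrite /G /G0; case: pselect => [L0|nL] /=; last first.
    have U0 : above K t !=set0.
      exists x0; split=> //; rewrite leNgt; apply/negP => h; apply: nL.
      by exists x0; split => //; exact: ltW.
    right; exists (inf (above K t)); split=> //; first by case: (inf_above cK U0).
    right=> x Kx; rewrite leNgt; apply/negP => h; apply: nL.
    by exists x; split => //; exact: ltW.
  case: pselect => [U0|?] /=; last first.
    right; exists (sup (below K t)); split=> //; first by case: (sup_below cK L0).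
    left=> x Kx; rewrite leNgt; apply/negP => h.
    by have : above K t !=set0 by exists x; split => //; exact: ltW.
  have [Ks Ki st gp] := gap t nKt L0 U0.
  by left; exists (sup (below K t)), (inf (above K t)).
have tF : tower F.
  apply: (@glue _ K al G C M) => //.
  - move=> t nKt; split.
      case: (Gcase t nKt) => [[c [d [Kc Kd /andP[ct td] gp ->]]]|[c [Kc _ ->]]].
        by have [] := HG c d Kc Kd (lt_trans ct td) gp.
      by have [] := HE c Kc.
    have [r r0 Hr] := below_above_near cK nKt; exists r => // s /Hr[e1 e2].
    by rewrite /G e1 e2.
  - move=> t x nKt Kx; case: (leP x t) => xt.
      have L0 : below K t !=set0 by exists x.
      have [Ks st mx] := sup_below cK L0; have lst := lt_sup t nKt L0.
      exists (sup (below K t)); rewrite /G /G0; case: pselect => //= ?.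
      case: pselect => [U0|?] /=.
        have [_ Ki /andP[_ ti] gp] := gap t nKt L0 U0.
        have [_ Gc _ GM] := HG _ _ Ks Ki (lt_trans lst ti) gp.
        split=> //; first by left; rewrite mx.
        move=> k s [/andP[h1 h2]|/andP[h1 h2]]; apply: GM.
          by rewrite h1 (le_trans h2 (ltW ti)).
        by exfalso; move: lst; rewrite ltNge (le_trans h1 h2).
      have [_ Ec EM] := HE _ Ks.
      by split=> //; left; rewrite mx.
    have U0 : above K t !=set0 by exists x; split => //; exact: ltW.
    have [Ki ti mn] := inf_above cK U0; have lti := gt_inf t nKt U0.
    exists (inf (above K t)); rewrite /G /G0; case: pselect => [L0|?] /=.
      case: pselect => //= ?.
      have [Ks _ /andP[st _] gp] := gap t nKt L0 U0.
      have [_ _ Gc GM] := HG _ _ Ks Ki (lt_trans st lti) gp.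
      split=> //; first by right; rewrite ti mn // ltW.
      move=> k s [/andP[h1 h2]|/andP[h1 h2]]; apply: GM.
        by exfalso; move: lti; rewrite ltNge (le_trans h1 h2).
      by rewrite h2 (le_trans (ltW st) h1).
    have [_ Ec EM] := HE _ Ki.
    by split=> //; right; rewrite ti mn // ltW.
exists (F 0%N); split; first exact: (tower_smooth tF).
  by move=> k x Kx; rewrite (tower_derive1n k tF) /F mem_set.
move=> k t nKt; rewrite (tower_derive1n k tF) /F ifF; last first.
  by apply/negbTE/negP; rewrite inE.
case: (Gcase t nKt) => [[c [d [Kc Kd ctd gp ->]]]|[c [Kc side ->]]]; last by right; exists c.
by left; exists c, d.
Qed.

(** The jets at two points of [K] need no separate compatibility condition: both expand the same [f]
    on the whole of [[a, b]], so their Borel sums are close to each other between the two points. *)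
Lemma whitney (R : realType) (K : set R) (a b : R) (f : R -> R) (al : nat -> R -> R)
    (A N : nat -> R) :
  closed K -> (forall x, K x -> a <= x <= b) ->
  (forall k x, K x -> `|al k x| <= A k) ->
  (forall n x z, K x -> a <= z <= b ->
     `|f z - taylor n.+1 (al^~ x) (z - x)| <= N n * `|z - x| ^+ n.+1) ->
  exists F, smooth F /\ forall k x, K x -> derive1n k F x = al k x.
Proof.
move=> cK Kab alA fT; have [B0 [M HB]] := borel A.
pose B x t := B0 (al^~ x) (1 * t + (- x)).
have sB x : K x -> smooth (B x).
  by move=> Kx; apply: smooth_affine; have [] := HB (al^~ x) (fun k => alA k x Kx).
have dB k x t : K x -> derive1n k (B x) t = derive1n k (B0 (al^~ x)) (t - x).
  move=> Kx; rewrite /B derive1n_affine ?expr1n ?mul1r //.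
  by have [] := HB (al^~ x) (fun k => alA k x Kx).
have Bx k x : K x -> derive1n k (B x) x = al k x.
  move=> Kx; rewrite dB // subrr.
  by have [_ ->] := HB (al^~ x) (fun k => alA k x Kx).
have BM k x t : K x -> `|derive1n k (B x) t| <= M k.
  by move=> Kx; rewrite dB //; have [_ _] := HB (al^~ x) (fun k => alA k x Kx); apply.
have [[x0 Kx0]|K0] := pselect (K !=set0); last first.
  exists (fun=> 0); split=> [|k x Kx]; first exact: smooth_cst.
  by exfalso; apply: K0; exists x.
have M0 k : 0 <= M k by apply: le_trans (BM k x0 x0 Kx0).
have NB n : 0 <= `|N n| by [].
have BT n x z : K x -> a <= z <= b ->
    `|B x z - f z| <= (M n.+1 + `|N n|) * `|z - x| ^+ n.+1.
  move=> Kx zab; have xab := Kab x Kx.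
  have h1 := @taylor_remainder _ n.+1 (B x) a b x z (M n.+1) (sB x Kx) xab zab
    (fun t _ => BM n.+1 x t Kx).
  rewrite (_ : (fun k => derive1n k (B x) x) = al^~ x) in h1; last first.
    by apply/funext => k; exact: Bx.
  have h2 := fT n x z Kx zab.
  have -> : B x z - f z = (B x z - taylor n.+1 (al^~ x) (z - x)) -
      (f z - taylor n.+1 (al^~ x) (z - x)) by ring.
  apply: le_trans (ler_normB _ _) _; rewrite mulrDl lerD //.
  by apply: (le_trans h2); rewrite ler_wpM2r ?exprn_ge0 // ler_norm.
(* Between [x] and [y] both Borel sums differ from [f] by [O(|y - x|^(n+1))], and the [(n+1)]-st
   derivative of their difference is bounded; interpolation gives the derivatives in between. *)
have [C keyC] : exists C : nat -> R, forall n, 0 <= C n /\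
    forall x y k t, K x -> K y -> (k <= n)%N -> x <= t <= y \/ y <= t <= x ->
    `|derive1n k (fun t => B y t - B x t) t| <= C n * `|y - x| ^+ (n.+1 - k).
  suff H n : exists Cn : R, 0 <= Cn /\
    forall x y k t, K x -> K y -> (k <= n)%N -> x <= t <= y \/ y <= t <= x ->
    `|derive1n k (fun t => B y t - B x t) t| <= Cn * `|y - x| ^+ (n.+1 - k).
    by have [C HC] := choice H; exists C.
  have [D D0 HD] := derivative_interpolation R n.
  pose Q := 2 * (M n.+1 + `|N n|); have Q0 : 0 <= Q by rewrite mulr_ge0 ?addr_ge0.
  exists (D * Q); split=> [|x y k t Kx Ky kn]; first exact: mulr_ge0.
  wlog xy : x y Kx Ky / x < y.
    move=> W; case: (ltgtP x y) => [xy|yx|<-].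
    - exact: W.
    - move=> h; have := W y x Ky Kx yx.
      rewrite !derive1nB; [|exact: sB..].
      rewrite (distrC x y) (distrC (derive1n k (B x) t)).
      by apply; case: h; [right|left].
    move=> _; rewrite derive1nB; [|exact: sB..].
    by rewrite !subrr normr0 mulr_ge0 ?exprn_ge0 // mulr_ge0.
  move=> [xty|/andP[h1 h2]]; last by exfalso; move: (le_trans h1 h2); rewrite leNgt xy.
  rewrite (gtr0_norm (x := y - x)) ?subr_gt0 //; apply: HD => //.
  - by apply: smoothB; exact: sB.
  - move=> u /andP[xu uy]; have uab : a <= u <= b.
      have /andP[ax _] := Kab x Kx; have /andP[_ yb] := Kab y Ky.
      by rewrite (le_trans ax xu) (le_trans uy yb).
    have h1 := BT n x u Kx uab; have h2 := BT n y u Ky uab.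
    have -> : B y u - B x u = (B y u - f u) - (B x u - f u) by ring.
    apply: le_trans (ler_normB _ _) _.
    have ge0 : 0 <= M n.+1 + `|N n| by rewrite addr_ge0.
    rewrite /Q -mulrA mulr2n mulrDl mul1r lerD //.
      apply: le_trans h2 _; rewrite ler_wpM2l // lerXn2r ?nnegrE ?subr_ge0 ?(ltW xy) //.
      by rewrite distrC ger0_norm ?subr_ge0 // lerB.
    apply: le_trans h1 _; rewrite ler_wpM2l // lerXn2r ?nnegrE ?subr_ge0 ?(ltW xy) //.
    by rewrite ger0_norm ?subr_ge0 // lerB.
  move=> u _; rewrite derive1nB; [|exact: sB..].
  apply: le_trans (ler_normB _ _) _.
  have hy := BM n.+1 y u Ky; have hx := BM n.+1 x u Kx.
  by apply: le_trans (lerD hy hx) _; rewrite /Q mulr2n mulrDl mul1r lerD // lerDl.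
have C0 n : 0 <= C n by case: (keyC n).
have {}keyC n : _ := proj2 (keyC n).
have [S HS] : exists S : nat -> R, forall n, 0 <= S n /\
    forall k t, (k <= n)%N -> 0 <= t <= 1 -> `|derive1n k (@step R) t| <= S n.
  suff H n : exists Sn : R, 0 <= Sn /\ forall k t, (k <= n)%N -> 0 <= t <= 1 ->
    `|derive1n k (@step R) t| <= Sn by have [S HS] := choice H; exists S.
  by have [Sn] := smooth_bounded n 0 1 (smooth_step R); exists Sn.
have S0 n : 0 <= S n by case: (HS n).
have {}HS n : _ := proj2 (HS n).
(* The affine map sends [[c, d]] onto [[0, 1]], so the blend is [B c] up to [c] and [B d] from [d]
   on, and has their jets there. *)
pose blend c d t := B c t + step ((d - c)^-1 * t + (- c / (d - c))) * (B d t - B c t).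
(* On a gap of length [l], the [j]-th derivative of the step costs [l^-j], while those of
   [B d - B c] weighted by [l^j] are at most [C k * l^(k+1)]. After division by [l^k] one factor
   [l <= b - a] remains. *)
pose MM k := M k + 2 ^+ k * S k * (C k * `|b - a|).
have sblend c d : K c -> K d -> smooth (blend c d).
  move=> Kc Kd; apply: smoothD; first exact: sB.
  by apply: smoothM; [exact/smooth_affine/smooth_step|apply: smoothB; exact: sB].
have Mblend c d k t : K c -> K d -> c < d -> c <= t <= d ->
    `|derive1n k (blend c d) t| <= MM k.
  move=> Kc Kd cd ctd; have sBd : smooth (fun t => B d t - B c t) by apply: smoothB; exact: sB.
  have sst : smooth (fun t => step ((d - c)^-1 * t + (- c / (d - c)))).
    exact/smooth_affine/smooth_step.
  have l0 : 0 < d - c by rewrite subr_gt0.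
  rewrite derive1nD; [|exact: sB|exact: smoothM].
  apply: le_trans (ler_normD _ _) _; apply: lerD; first exact: BM.
  have := @scaled_leibniz _ k _ _ t (d - c) (S k) (C k * `|b - a| * (d - c) ^+ k) sst sBd l0.
  rewrite mulrA ler_pM2r ?exprn_gt0 //; apply => j jk.
    rewrite derive1n_affine; last exact: smooth_step.
    rewrite normrM normrX gtr0_norm ?invr_gt0 // mulrAC exprVn mulVf ?mul1r; last first.
      by rewrite expf_neq0 // gt_eqF.
    apply: HS => //; have -> : (d - c)^-1 * t + - c / (d - c) = (t - c) / (d - c) by ring.
    case/andP: ctd => h1 h2; rewrite divr_ge0 ?subr_ge0 ?(ltW cd) //=.
    by rewrite ler_pdivrMr // mul1r lerB.
  have := keyC k c d j t Kc Kd jk (or_introl ctd).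
  rewrite (gtr0_norm l0) => h.
  apply: le_trans (ler_wpM2r _ h) _; first by rewrite exprn_ge0 // ltW.
  rewrite -!mulrA ler_wpM2l // -exprD subnK; last exact: leqW.
  rewrite exprS ler_wpM2r ?exprn_ge0 ?(ltW l0) //.
  have /andP[ac _] := Kab c Kc; have /andP[_ db] := Kab d Kd.
  by apply: le_trans (ler_norm _); rewrite lerB.
have blend_l c d k : K c -> K d -> c < d -> derive1n k (blend c d) c = al k c.
  move=> Kc Kd cd; rewrite -Bx //; apply: derive1n_left; [exact: sblend|exact: sB|].
  move=> s sc; rewrite /blend step0 ?mul0r ?addr0 //.
  have -> : (d - c)^-1 * s + - c / (d - c) = (s - c) / (d - c) by ring.
  by rewrite pmulr_lle0 ?invr_gt0 ?subr_gt0 // subr_le0.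
have blend_r c d k : K c -> K d -> c < d -> derive1n k (blend c d) d = al k d.
  move=> Kc Kd cd; rewrite -Bx //; apply: derive1n_right; [exact: sblend|exact: sB|].
  move=> s sc; rewrite /blend step1 ?mul1r; first by ring.
  have -> : (d - c)^-1 * s + - c / (d - c) = (s - c) / (d - c) by ring.
  by rewrite ler_pdivlMr ?subr_gt0 // mul1r lerB.
have MMM k : M k <= MM k by rewrite lerDl !mulr_ge0 ?exprn_ge0.
have [|||F [sF Fal _]] := @glue_gaps _ K al blend B (fun k => C k.+1 + M k.+2) MM cK
    (ex_intro _ x0 Kx0) _ _ _.
- move=> k x y Kx Ky.
  (* The Borel sum at [x] stands in for the Taylor polynomial; comparison at order [k + 1] leaves
     exactly the exponent 2. *)
  have h1 : `|al k y - derive1n k (B x) y| <= C k.+1 * (y - x) ^+ 2.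
    have := keyC k.+1 x y k y Kx Ky (leqnSn k).
    rewrite derive1nB; [|exact: sB..].
    rewrite Bx // (_ : k.+2 - k = 2)%N ?real_normK ?num_real //; last first.
      by rewrite subSn // subSnn.
    by apply; case: (leP x y) => h; [left|right]; rewrite lexx ?h ?(ltW h).
  have h2 : `|derive1n k (B x) y - al k x - al k.+1 x * (y - x)| <= M k.+2 * (y - x) ^+ 2.
    rewrite -!Bx //.
    apply: (@smooth_quad _ _ _ a b) => //; [exact: sB|exact: Kab|exact: Kab|].
    by move=> t _; exact: BM.
  have -> : al k y - al k x - al k.+1 x * (y - x) = (al k y - derive1n k (B x) y) +
    (derive1n k (B x) y - al k x - al k.+1 x * (y - x)) by ring.
  by apply: le_trans (ler_normD _ _) _; rewrite mulrDl lerD.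
- move=> c d Kc Kd cd _; split; first exact: sblend.
  + by move=> k; exact: blend_l.
  + by move=> k; exact: blend_r.
  + by move=> k t; exact: Mblend.
- move=> c Kc; split; first exact: sB.
    by move=> k; exact: Bx.
  by move=> k t; apply: le_trans (BM k c t Kc) _.
by exists F.
Qed.

(** * Absolutely continuous functions *)

Fixpoint chain (R : realType) (I : R -> R -> Prop) (x : R) (p : seq R) : Prop :=
  if p is y :: q then [/\ x <= y, I x y & chain I y q] else True.

Fixpoint psum (R : realType) (S : R -> R -> R) (x : R) (p : seq R) : R :=
  if p is y :: q then S x y + psum S y q else 0.

Lemma chain_rcons (R : realType) (I : R -> R -> Prop) (x : R) p y :
  chain I x p -> last x p <= y -> I (last x p) y -> chain I x (rcons p y).
Proof. by elim: p x => [|z p IH] x //= [xz Ixz cz] h1 h2; split => //; exact: IH. Qed.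

Lemma chain_le_last (R : realType) (I : R -> R -> Prop) (x : R) p :
  chain I x p -> x <= last x p.
Proof. by elim: p x => [|z p IH] x //= [xz _ /IH]; exact: le_trans. Qed.

Lemma chain_path (R : realType) (I : R -> R -> Prop) (x : R) p :
  chain I x p -> path <=%R x p.
Proof. by elim: p x => [|z p IH] x //= [-> _ /IH]. Qed.

Lemma chain_impl (R : realType) (I J : R -> R -> Prop) (x : R) p :
  (forall s t, I s t -> J s t) -> chain I x p -> chain J x p.
Proof. by move=> IJ; elim: p x => [|z p IH] x //= [xz /IJ h /IH]. Qed.

Lemma ler_psum (R : realType) (I : R -> R -> Prop) (S T : R -> R -> R) x p :
  (forall s t, x <= s -> s <= t -> t <= last x p -> I s t -> S s t <= T s t) ->
  chain I x p -> psum S x p <= psum T x p.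
Proof.
elim: p x => [|z p IH] x //= H [xz Ixz cz]; rewrite lerD //.
  by apply: H => //; exact: chain_le_last cz.
by apply: IH => // s t zs; apply: H; exact: le_trans zs.
Qed.

Lemma psumD (R : realType) (S T : R -> R -> R) x p :
  psum (fun s t => S s t + T s t) x p = psum S x p + psum T x p.
Proof. by elim: p x => [|z p IH] x /=; rewrite ?addr0 // IH; ring. Qed.

Lemma psumZ (R : realType) (c : R) (S : R -> R -> R) x p :
  psum (fun s t => c * S s t) x p = c * psum S x p.
Proof. by elim: p x => [|z p IH] x /=; rewrite ?mulr0 // IH mulrDr. Qed.

Lemma psum_telescope (R : realType) (V : R -> R) x p :
  psum (fun s t => V t - V s) x p = V (last x p) - V x.
Proof. by elim: p x => [|z p IH] x /=; rewrite ?subrr // IH; ring. Qed.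

Lemma ler_norm_psum (R : realType) (V : R -> R) x p :
  `|V (last x p) - V x| <= psum (fun s t => `|V t - V s|) x p.
Proof.
elim: p x => [|z p IH] x /=; first by rewrite subrr normr0.
rewrite -(subrKA (V z)) addrC; apply: le_trans (ler_normD _ _) _.
by rewrite lerD2l.
Qed.

Lemma psum_nth (R : realType) (S : R -> R -> R) x0 x p :
  psum S x p = \sum_(i < size p) S (nth x0 (x :: p) i) (nth x0 p i).
Proof.
elim: p x => [|z p IH] x /=; first by rewrite big_ord0.
by rewrite big_ord_recl /= IH.
Qed.

(* Compactness of an interval: a gauge admits a fine partition tagged at endpoints. *)
Lemma cousin (R : realType) (I : R -> R -> Prop) (c d : R) : c <= d ->
  (forall x, c <= x <= d -> exists2 r, 0 < r &
     (forall s, c <= s -> s <= x -> x - s < r -> I s x) /\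
     (forall s, x <= s -> s <= d -> s - x < r -> I x s)) ->
  exists2 p, chain I c p & last c p = d.
Proof.
move=> cd H; pose E := [set t | c <= t <= d /\ exists2 p, chain I c p & last c p = t].
have Ec : E c by split; [rewrite lexx|exists [::]].
have hE : has_sup E by split; [exists c|exists d => t [/andP[]]].
pose s := sup E.
have cs : c <= s by apply: ub_le_sup => //; case: hE.
have sd : s <= d by apply: ge_sup; [exists c|move=> t [/andP[]]].
have [r r0 [Hl Hr]] := H s (introT andP (conj cs sd)).
have Es : E s.
  split; first by rewrite cs.
  have [t [/andP[ct td] [p cp lp]] st] := sup_adherent r0 hE.
  have ts : t <= s by apply: ub_le_sup; [case: hE|split; [rewrite ct|exists p]].
  exists (rcons p s); last by rewrite last_rcons.
  by apply: chain_rcons => //; rewrite lp //; apply: Hl => //; rewrite /s in st *; lra.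
move: sd; rewrite le_eqVlt => /orP[/eqP <-|sd]; first by case: Es.
exfalso; pose t := Num.min d (s + r / 2).
have st : s < t by rewrite lt_min sd ltrDl divr_gt0.
have td : t <= d by rewrite ge_min lexx.
suff : t <= s by rewrite leNgt st.
apply: ub_le_sup; first by case: hE.
split; first by rewrite td (le_trans cs (ltW st)).
case: Es => _ [p cp lp]; exists (rcons p t); last by rewrite last_rcons.
apply: chain_rcons => //; rewrite lp ?(ltW st) //; apply: Hr => //; first exact: ltW.
have : t <= s + r / 2 by rewrite ge_min lexx orbT.
lra.
Qed.

(* [B] selects the intervals of the partition [x :: p] that are counted. *)
Definition chain_ac (R : realType) (a b : R) (F : R -> R) : Prop :=
  forall e : R, 0 < e -> exists2 d : R, 0 < d &
    forall (B : R -> R -> bool) x p, a <= x -> last x p <= b ->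
      chain (fun _ _ => True) x p ->
      psum (fun s t => if B s t then t - s else 0) x p < d ->
      psum (fun s t => if B s t then `|F t - F s| else 0) x p < e.

Lemma abs_continuous_chain (R : realType) (V : normedModType R) (a b : R)
    (G : R -> V) (F : R -> R) :
  abs_continuous a b G -> (forall s t, `|F t - F s| <= `|G t - G s|) ->
  chain_ac a b F.
Proof.
move=> acG FG e e0; have [d d0 Hd] := acG e e0; exists d => // B x p ax pb cp Sd.
pose u (i : 'I_(size p)) := nth x (x :: p) i.
pose w (i : 'I_(size p)) := nth x p i.
(* An interval that is not counted is collapsed to its left end: it becomes empty and contributes
   nothing, so no reindexing is necessary. *)
pose v i := if B (u i) (w i) then w i else u i.
have mono i j : (i <= j)%N -> (j < (size p).+1)%N -> nth x (x :: p) i <= nth x (x :: p) j.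
  move=> ij jp; apply: (@sorted_leq_nth _ <=%R) => //; first exact: le_trans.
    exact: (chain_path cp).
  by rewrite inE /= (leq_ltn_trans ij).
have uw i : u i <= w i by apply: (mono i i.+1) => //; rewrite ltnS.
have uv i : u i <= v i by rewrite /v; case: ifP.
have vw i : v i <= w i by rewrite /v; case: ifP.
apply: le_lt_trans (Hd _ u v _ _ _).
- rewrite (psum_nth _ x); apply: ler_sum => i _; rewrite /v -/(u i) -/(w i).
  by case: ifP => // _; rewrite normr_ge0.
- move=> i; split => //.
    by apply: (le_trans ax); apply: (mono 0%N) => //; rewrite ltnW // ltnS.
  apply: le_trans (vw i) (le_trans _ pb).
  have := mono i.+1 (size p) (ltn_ord i) (ltnSn _).
  by rewrite (nth_last x (x :: p)).
- move=> i j _ _ [z []] /=; rewrite !in_itv /= => /andP[ui vi] /andP[uj vj].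
  apply: val_inj => /=; apply/eqP; rewrite eqn_leq; apply/andP; split; rewrite leqNgt.
    apply/negP => ji; move: (lt_le_trans vj (vw j)).
    have wu : w j <= u i by apply: (mono j.+1 i ji); rewrite ltnS ltnW.
    by rewrite ltNge (le_trans wu (ltW ui)).
  apply/negP => ij; move: (lt_le_trans vi (vw i)).
  have wu : w i <= u j by apply: (mono i.+1 j ij); rewrite ltnS ltnW.
  by rewrite ltNge (le_trans wu (ltW uj)).
- apply: le_lt_trans Sd; rewrite (psum_nth _ x); apply: ler_sum => i _.
  by rewrite /v -/(u i) -/(w i); case: ifP => //; rewrite subrr.
Qed.

Lemma chain_ac_sub (R : realType) (a b x y : R) (F : R -> R) :
  a <= x -> y <= b -> chain_ac a b F -> chain_ac x y F.
Proof.
move=> ax yb acF e e0; have [d d0 H] := acF e e0; exists d => // B z p xz pz.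
by apply: H; [exact: le_trans xz|exact: le_trans yb].
Qed.

(** The common source of the closure of absolute continuity under sums, differences and products. *)
Lemma chain_ac_lin (R : realType) (a b M : R) (F G H : R -> R) :
  chain_ac a b F -> chain_ac a b G ->
  (forall s t, a <= s -> s <= t -> t <= b ->
     `|H t - H s| <= M * (`|F t - F s| + `|G t - G s|)) ->
  chain_ac a b H.
Proof.
move=> acF acG HFG e e0; pose k := 2 * (`|M| + 1).
have k0 : 0 < k by rewrite mulr_gt0 // ltr_wpDl.
have [d1 d10 H1] := acF _ (divr_gt0 e0 k0); have [d2 d20 H2] := acG _ (divr_gt0 e0 k0).
exists (Num.min d1 d2); first by rewrite lt_min d10.
move=> B x p ax pb cp; rewrite lt_min => /andP[/H1 h1 /H2 h2].
have {}h1 := h1 ax pb cp; have {}h2 := h2 ax pb cp.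
pose SF s t := if B s t then `|F t - F s| else 0.
pose SG s t := if B s t then `|G t - G s| else 0.
apply: le_lt_trans (_ : (`|M| + 1) * (psum SF x p + psum SG x p) < e).
  rewrite -psumD -psumZ; apply: ler_psum cp => s t xs st tp _; rewrite /SF /SG.
  case: ifP => _; last by rewrite addr0 mulr0.
  apply: le_trans (HFG s t _ st _) _; [exact: le_trans xs|exact: le_trans pb|].
  by rewrite ler_wpM2r ?addr_ge0 // (le_trans (ler_norm M)) // lerDl.
rewrite mulrC -ltr_pdivlMr ?ltr_wpDl //.
apply: lt_le_trans (ltrD h1 h2) _.
by rewrite le_eqVlt /k; apply/orP; left; apply/eqP; field; rewrite gt_eqF // ltr_wpDl.
Qed.

Lemma lipschitz_chain_ac (R : realType) (a b M : R) (F : R -> R) :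
  (forall s t, a <= s -> s <= t -> t <= b -> `|F t - F s| <= M * (t - s)) ->
  chain_ac a b F.
Proof.
move=> FM e e0; have M0 : 0 < `|M| + 1 by rewrite ltr_wpDl.
exists (e / (`|M| + 1)); first by rewrite divr_gt0.
move=> B x p ax pb cp; rewrite ltr_pdivlMr // mulrC; apply: le_lt_trans.
rewrite -psumZ; apply: ler_psum cp => s t xs st tp _; case: ifP => _; last by rewrite mulr0.
apply: le_trans (FM s t _ st _) _; [exact: le_trans xs|exact: le_trans pb|].
by rewrite ler_wpM2r ?subr_ge0 // (le_trans (ler_norm M)) // lerDl.
Qed.

(* Unlike [le_measure], no measurability is needed: [lebesgue_measure] is defined
   on all sets, as an outer measure. *)
Lemma le_lebesgue (R : realType) (A B : set R) : A `<=` B ->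
  (lebesgue_measure A <= lebesgue_measure B)%E.
Proof. by move=> AB; exact: le_mu_ext. Qed.

Lemma lebesgue_measureU (R : realType) (A B : set R) : measurable A -> measurable B ->
  A `&` B = set0 ->
  lebesgue_measure (A `|` B) = (lebesgue_measure A + lebesgue_measure B)%E.
Proof. by move=> mA mB AB; rewrite measureU. Qed.

Lemma null_set_open_cover (R : realType) (A : set R) (e : R) :
  (@lebesgue_measure R).-negligible A -> 0 < e ->
  exists U : set R, [/\ open U, A `<=` U & (lebesgue_measure U < e%:E)%E].
Proof.
move=> [N [mN N0 AN]] e0.
have Noo : (lebesgue_measure (N : set R) < +oo)%E by rewrite [X in (X < _)%E]N0 ltry.
have [U [oU NU Ue]] := lebesgue_regularity_outer mN Noo e0.
exists U; split=> //; first exact: subset_trans NU.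
have mU : measurable U by exact: measurable_realfun.open_measurable.
rewrite (_ : U = (U `\` N) `|` N); last by rewrite setUC setDUK.
apply: le_lt_trans (measureU2 _ _ _) _ => //; first exact: measurableD.
by rewrite [X in (_ + X)%E]N0 adde0.
Qed.

(** A substitute for integrating [W']. The exceptional null set is covered by an open [U] so small
    that absolute continuity makes the variation of [W] over intervals inside [U] less than [e / 2].
    By [cousin] there is a partition whose intervals either lie in [U] or satisfy the local estimate
    at one of their ends. The majorant [S] need not be additive. *)
Lemma ac_increment (R : realType) (W : R -> R) (S : R -> R -> R) (x y : R) :
  x <= y -> chain_ac x y W ->
  (forall s t, x <= s -> s <= t -> t <= y -> 0 <= S s t) ->
  {ae lebesgue_measure, forall t : R, x <= t <= y ->
     forall e, 0 < e -> exists2 r, 0 < r & forall s, x <= s <= y -> `|s - t| < r ->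
       `|W s - W t| <= (if s <= t then S s t else S t s) + e * `|s - t|} ->
  forall e, 0 < e -> exists p, [/\ chain (fun _ _ => True) x p, last x p = y &
    `|W y - W x| <= psum S x p + e].
Proof.
move=> xy acW S0 good e e0.
(* Half of [e] is kept for the intervals inside [U]; the added 1 keeps the denominator positive when
   [x = y]. *)
pose e1 := e / 2 / (y - x + 1).
have l0 : 0 < y - x + 1 by rewrite ltr_wpDl ?subr_ge0.
have e10 : 0 < e1 by rewrite !divr_gt0.
have [d d0 Hd] := acW (e / 2) (divr_gt0 e0 (ltr0n _ 2)).
have [U [oU AU Ud]] := null_set_open_cover good d0.
have mU : measurable U by exact: measurable_realfun.open_measurable.
pose B s t := `[< `]s, t] `<=` U >].
pose I s t := B s t \/ `|W t - W s| <= S s t + e1 * (t - s).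
(* The distribution function of [U]: an interval inside [U] has length at most the increment of [m],
   so the total length of such intervals telescopes to at most the measure of [U]. *)
pose m t := fine (lebesgue_measure (U `&` `]x, t])).
have mI t : measurable (U `&` `]x, t]) by apply: measurableI.
have finI t : lebesgue_measure (U `&` `]x, t]) \is a fin_num.
  rewrite ge0_fin_numE //; apply: le_lt_trans (_ : _ <= lebesgue_measure U)%E _.
    by apply: le_lebesgue => //; exact: subIsetl.
  by apply: lt_trans Ud _; rewrite ltry.
have mono s t : s <= t -> m s <= m t.
  move=> st; apply: fine_le => //; apply: le_lebesgue => //.
  by apply: setIS => z /=; rewrite !in_itv /= => /andP[-> h]; exact: le_trans st.
have mB s t : x <= s -> s <= t -> B s t -> t - s <= m t - m s.
  move=> xs st /asboolP BU; rewrite lerBrDl -lee_fin EFinD fineK // fineK //.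
  have -> : (t - s)%:E = lebesgue_measure (`]s, t] : set R).
    rewrite lebesgue_measure_itv /= lte_fin; case: ltP => // ts.
    by rewrite (_ : t - s = 0) //; apply/eqP; rewrite subr_eq0 eq_le ts st.
  rewrite -lebesgue_measureU //; last first.
    apply/seteqP; split=> z //= -[[_ +]]; rewrite !in_itv /= => /andP[_ h2] /andP[h1 _].
    by move: h1; rewrite ltNge h2.
  apply: le_lebesgue.
  move=> z [[Uz]|] /=; rewrite !in_itv /= => /andP[h1 h2]; split => //=; rewrite ?in_itv /=.
  - by rewrite h1 (le_trans h2 st).
  - by apply: BU; rewrite /= in_itv /= h1.
  - by rewrite (le_lt_trans xs h1).
have [p cp lp] : exists2 p, chain I x p & last x p = y.
  apply: cousin => // t txy.
  have [Ut|nUt] := pselect (U t).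
    have := oU; rewrite openE => /(_ t Ut)[r /= r0 Hr]; exists r => //.
    split=> s h1 h2 h3; left; apply/asboolP => z /=; rewrite in_itv /= => /andP[z1 z2];
      apply: Hr; rewrite /ball_ /=.
      by rewrite ger0_norm ?subr_ge0 //; lra.
    by rewrite ler0_norm ?subr_le0 ?(ltW z1) //; lra.
  have [|r r0 Hr] := (_ : forall e, 0 < e -> exists2 r, 0 < r & forall s, x <= s <= y ->
      `|s - t| < r -> `|W s - W t| <= (if s <= t then S s t else S t s) + e * `|s - t|) e1 e10.
    by apply: contrapT => h; apply: nUt; apply: AU => /(_ txy).
  exists r => //; case/andP: txy => xt ty; split=> s h1 h2 h3; right.
    have sxy : x <= s <= y by rewrite h1 (le_trans h2 ty).
    have := Hr s sxy; rewrite ler0_norm ?subr_le0 // opprB h2 distrC; exact.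
  have [->|st] := eqVneq s t.
    by rewrite !subrr normr0 mulr0 addr0 S0.
  have sxy : x <= s <= y by rewrite h2 (le_trans xt h1).
  have st' : (s <= t) = false by apply/negbTE; rewrite -ltNge lt_neqAle eq_sym st h1.
  by have := Hr s sxy; rewrite st' ger0_norm ?subr_ge0 //; exact.
have cT := chain_impl (J := fun _ _ => True) (fun _ _ _ => Logic.I) cp.
exists p; split => //.
pose SB s t := if B s t then `|W t - W s| else 0.
have hB : psum SB x p < e / 2.
  apply: Hd => //; first by rewrite lp.
  apply: le_lt_trans (_ : psum (fun s t => m t - m s) x p < d).
    apply: ler_psum cT => s t xs st tp _; case: ifP => Bst; first exact: mB.
    by rewrite subr_ge0 mono.
  rewrite psum_telescope lp; apply: le_lt_trans (_ : m y < d).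
    by rewrite gerBl fine_ge0.
  rewrite -lte_fin fineK //; apply: le_lt_trans Ud; exact: le_lebesgue.
rewrite -lp; apply: le_trans (ler_norm_psum _ _ _) _.
apply: le_trans (_ : psum (fun s t => S s t + (e1 * (t - s) + SB s t)) x p <= _).
  apply: ler_psum cp => s t xs st tp Ist; rewrite lp in tp; rewrite /SB.
  have S0' := S0 s t xs st tp; have e1t : 0 <= e1 * (t - s) by rewrite mulr_ge0 ?subr_ge0 // ltW.
  case: ifP => Bst; first by rewrite addrA lerDr addr_ge0.
  by case: Ist => [|]; [rewrite Bst|rewrite addr0].
rewrite !psumD psumZ psum_telescope lp lerD2l.
have : e1 * (y - x) <= e / 2.
  rewrite /e1 mulrAC ler_pdivrMr // ler_wpM2l ?divr_ge0 ?(ltW e0) //.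
  by rewrite lerDl.
by move: hB; lra.
Qed.

Definition clamp (R : realType) (a b t : R) : R := Num.max a (Num.min b t).

Lemma clamp_id (R : realType) (a b t : R) : a <= t <= b -> clamp a b t = t.
Proof. by move=> /andP[h1 h2]; rewrite /clamp (min_idPr h2) (max_idPr h1). Qed.

Lemma clamp_itv (R : realType) (a b t : R) : a <= b -> a <= clamp a b t <= b.
Proof. by move=> ab; rewrite /clamp le_max lexx ge_max ab ge_min lexx. Qed.

Lemma clamp_dist (R : realType) (a b s t : R) : s <= t ->
  0 <= clamp a b t - clamp a b s <= t - s.
Proof.
move=> st.
have hmin : 0 <= Num.min b t - Num.min b s <= t - s.
  by case: (leP b s); case: (leP b t) => *; apply/andP; split; lra.
have hmax u v : u <= v -> 0 <= Num.max a v - Num.max a u <= v - u.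
  by case: (leP a u); case: (leP a v) => *; apply/andP; split; lra.
case/andP: hmin => m1 m2; rewrite subr_ge0 in m1.
by have /andP[h1 h2] := hmax _ _ m1; rewrite h1 (le_trans h2 m2).
Qed.

Lemma chain_ac_clamp_continuous (R : realType) (a b : R) (f : R -> R) : a <= b ->
  chain_ac a b f -> continuous (fun t => f (clamp a b t)).
Proof.
move=> ab acf t; apply/cvgrPdist_lt => e e0; have [d d0 Hd] := acf e e0.
have key s u : s <= u -> u - s < d -> `|f (clamp a b u) - f (clamp a b s)| < e.
  move=> su sud; have /andP[c1 c2] := clamp_dist a b su.
  have /andP[s1 s2] := clamp_itv s ab; have /andP[u1 u2] := clamp_itv u ab.
  have := Hd (fun _ _ => true) (clamp a b s) [:: clamp a b u]; rewrite /= !addr0.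
  by apply => //; [split=> //; rewrite -subr_ge0|exact: le_lt_trans c2 sud].
exists d => // s /=; case: (leP t s) => ts.
  by rewrite ler0_norm ?subr_le0 // opprB distrC; exact: key.
by rewrite gtr0_norm ?subr_gt0 //; apply: key; exact: ltW.
Qed.

(** The integral of a nonnegative function is a supremum over the simple functions below it, hence
    monotone for arbitrary integrands. This matters because [derive1 f] is controlled only off a
    null set. *)
Lemma le_integral_nonmeasurable (R : realType) (D : set R) (f g : R -> \bar R) :
  (forall x, D x -> (0 <= f x)%E) -> (forall x, D x -> (f x <= g x)%E) ->
  (\int[lebesgue_measure]_(x in D) f x <= \int[lebesgue_measure]_(x in D) g x)%E.
Proof.
move=> f0 fg; have g0 x : D x -> (0 <= g x)%E by move=> Dx; exact: (le_trans (f0 x Dx) (fg x Dx)).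
rewrite !ge0_integralE //; apply: ereal_sup_le => _ [h /= hf <-]; exists h => //= x.
apply: le_trans (hf x) _; rewrite /patch; case: ifPn => // /set_mem; exact: fg.
Qed.

(** The fundamental theorem of calculus as an inequality. The primitive [V] of [|f' - A'|], cut off
    to the ball, is monotone, increases by at most [C], and has derivative [|f' - A'|] almost
    everywhere in the ball. Applied with the increments of [V] as majorant, which telescope,
    [ac_increment] bounds the increment of [f - A]. *)
Lemma l1_increment (R : realType) (a b : R) (f : R -> R) (A : {poly R}) (x rho C : R) :
  chain_ac a b f ->
  {ae lebesgue_measure, forall t : R, a <= t <= b -> has_derivative f t (derive1 f t)} ->
  0 < rho -> a <= x - rho -> x + rho <= b ->
  (\int[lebesgue_measure]_(y in ball x rho) `|derive1 f y - A^`().[y]|%:E <= C%:E)%E ->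
  forall y, `|y - x| < rho -> `|(f y - A.[y]) - (f x - A.[x])| <= C.
Proof.
move=> acf [A0 [mA0 A00 badA0]] rho0 ax xb intC y yx.
have A0E (t : R) : ~ A0 t -> a <= t <= b -> has_derivative f t (derive1 f t).
  by move=> nA; apply: contrapT => h; apply: nA; exact: badA0.
have ab : a <= b by lra.
(* Removing [A0] leaves points where [derive1 f] is a true limit of difference quotients, so that
   the integrand is measurable on [E]. *)
pose E : set R := ball x rho `\` A0.
have mball : measurable (ball x rho : set R) by exact: measurable_realfun.measurable_ball.
have mE : measurable E by exact: measurableD.
have Eab t : E t -> a <= t < b.
  move=> [/=]; rewrite /ball /= ltr_norml => /andP[h1 h2] _; apply/andP; split; lra.
pose g t := `|derive1 f t - A^`().[t]|.
pose fc t := f (clamp a b t).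
have cfc : continuous fc by exact: chain_ac_clamp_continuous.
have cs (c : R) : continuous (fun t => fc (t + c)).
  move=> t; apply: (@continuous_comp _ _ _ (fun t => t + c) fc); last exact: cfc.
  by apply: cvgD; [exact: cvg_id|exact: cvg_cst].
(* Difference quotients with step [1/(n+1)]. The clamped extension makes them continuous on the
   line; as points of [E] are below [b], they eventually involve only values of [f] on [[a, b]]. *)
pose h (n : nat) t := `|n.+1%:R * (fc (t + n.+1%:R^-1) - fc t) - A^`().[t]|.
have mg : measurable_fun E g.
  apply: (measurable_realfun.measurable_fun_cvg (h := h)) => [n|t Et].
    apply: measurable_funTS; apply: measurable_realfun.continuous_measurable_fun => t.
    apply: cvg_norm; apply: cvgB; last exact: continuous_horner.
    apply: cvgMr; apply: cvgB; last exact: cfc.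
    exact: cs.
  have /andP[at_ tb] := Eab t Et.
  have [H] : has_derivative f t (derive1 f t).
    by apply: A0E; [case: Et|rewrite at_ ltW].
  apply/cvgrPdist_le => e e0; have [d d0 Hd] := H e e0.
  have m0 : 0 < Num.min d (b - t) by rewrite lt_min d0 subr_gt0.
  near=> n; have nm : n.+1%:R^-1 < Num.min d (b - t).
    by near: n; exact: (near_infty_natSinv_lt (PosNum m0)).
  move: nm; rewrite lt_min => /andP[nd nb].
  have n0 : 0 < n.+1%:R^-1 :> R by rewrite invr_gt0.
  have := Hd (t + n.+1%:R^-1); rewrite addrAC subrr add0r gtr0_norm // => /(_ nd).
  rewrite /g /h /fc !clamp_id; last 2 first.
  - by rewrite at_ ltW.
  - by rewrite (le_trans at_) ?lerDl ?(ltW n0) //= ltW // -ltrBrDl.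
  move=> h1; apply: le_trans (ler_dist_dist _ _) _.
  set D := _ - f t in h1 *.
  have -> : derive1 f t - A^`().[t] - (n.+1%:R * D - A^`().[t]) =
      - (n.+1%:R * (D - derive1 f t * n.+1%:R^-1)).
    have N0 : n.+1%:R != 0 :> R by rewrite pnatr_eq0.
    by move: n.+1%:R N0 => N N0; field.
  by rewrite normrN normrM normr_nat mulrC -ler_pdivlMr.
pose w := g \_ E.
have w0 t : 0 <= w t by rewrite /w /patch; case: ifP => // _; rewrite normr_ge0.
have mw : measurable_fun setT w := (measurable_restrictT g mE).1 mg.
have intw : (\int[lebesgue_measure]_t (w t)%:E <= C%:E)%E.
  apply: le_trans intC; rewrite [leRHS]integral_mkcond.
  apply: le_integral_nonmeasurable => t _; first by rewrite lee_fin.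
  rewrite /w /patch; case: ifPn => [/set_mem[bt _]|_]; first by rewrite mem_set.
  by case: ifP => // _; rewrite lee_fin normr_ge0.
have iw : lebesgue_measure.-integrable [set: R] (EFin \o w).
  apply/integrableP; split; first exact/measurable_realfun.measurable_EFinP.
  under eq_integral do rewrite /= ger0_norm //.
  by apply: le_lt_trans intw _; rewrite ltry.
have iwS (D : set R) : measurable D -> lebesgue_measure.-integrable D (EFin \o w).
  by move=> mD; apply: integrableS iw.
pose V t := \int[lebesgue_measure]_(u in `]-oo, t]) w u.
have [A1 [mA1 A10 badA1]] : {ae lebesgue_measure, forall t, derivable V t 1 /\ derive1 V t = w t}.
  apply: FTC1Ny => [u|]; first exact: iwS.
  by apply: open_integrable_locally => //; exact: openT.
have VB s t : s <= t -> V t - V s = \int[lebesgue_measure]_(u in `]s, t]) w u.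
  by move=> st; rewrite /V Rintegral_itvB //; apply: iwS.
have V0 s t : s <= t -> 0 <= V t - V s by move=> st; rewrite VB // Rintegral_ge0.
have VC s t : s <= t -> V t - V s <= C.
  move=> st; rewrite VB // /Rintegral.
  have le : (\int[lebesgue_measure]_(u in `]s, t]) (w u)%:E <= C%:E)%E.
    apply: le_trans intw; apply: ge0_subset_integral => //.
      exact/measurable_realfun.measurable_EFinP.
    by move=> u _; rewrite lee_fin.
  rewrite -lee_fin fineK // ge0_fin_numE; first by rewrite (le_lt_trans le) ?ltry.
  by apply: integral_ge0 => u _; rewrite lee_fin.
pose phi t := f t - A.[t].
have acphi : chain_ac a b phi.
  have [M M0 HM] : exists2 M : R, 0 <= M & forall t, a <= t <= b -> `|A^`().[t]| <= M.
    by apply: cont_bounded; exact: continuous_horner.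
  have acA : chain_ac a b (horner A).
    apply: (@lipschitz_chain_ac _ _ _ M) => s t as_ st tb.
    rewrite -[X in _ * X](ger0_norm (x := t - s)) ?subr_ge0 //.
    apply: (MVT_itv (has_derivative_horner A) _ _ HM).
      by rewrite as_ (le_trans st tb).
    by rewrite tb (le_trans as_ st).
  apply: (@chain_ac_lin _ _ _ 1 _ _ _ acf acA) => s t _ _ _; rewrite mul1r.
  have -> : phi t - phi s = (f t - f s) - (A.[t] - A.[s]) by rewrite /phi; ring.
  exact: ler_normB.
suff key lo hi : lo <= hi -> `|lo - x| < rho -> `|hi - x| < rho -> `|phi hi - phi lo| <= C.
  have xx : `|x - x| < rho by rewrite subrr normr0.
  have [xy|/ltW yx'] := leP x y; first exact: key.
  by rewrite distrC; exact: key.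
move=> lh; rewrite !ltr_norml => /andP[l1 l2] /andP[h1 h2].
apply/ler_addgt0Pr => e e0.
have [|||p [cp lp Hp]] := @ac_increment _ phi (fun s t => V t - V s) lo hi lh _ _ _ e e0.
- by apply: chain_ac_sub acphi; lra.
- by move=> s t _ st _; exact: V0.
- have nU : (@lebesgue_measure R).-negligible (A0 `|` A1).
    by apply: negligibleU; [exists A0; split|exists A1; split].
  apply: negligibleS nU => t /= Ht; apply: contrapT => nA; apply: Ht => lth d d0.
  have nA0 : ~ A0 t by move=> ?; apply: nA; left.
  have nA1 : ~ A1 t by move=> ?; apply: nA; right.
  have tball : ball x rho t.
    rewrite /ball /= ltr_norml; case/andP: lth => ? ?; apply/andP; split; lra.
  have wt : w t = `|derive1 f t - A^`().[t]| by rewrite /w /patch mem_set.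
  have tab : a <= t <= b by case/andP: lth => ? ?; apply/andP; split; lra.
  have [dphi] : has_derivative phi t (derive1 f t - A^`().[t]).
    by apply: has_derivativeB; [exact: A0E|exact: has_derivative_horner].
  have [dV] : has_derivative V t (w t).
    apply/has_derivativeP; have [dV1 dV2] : derivable V t 1 /\ derive1 V t = w t.
      by apply: contrapT => nd; apply: nA1; exact: badA1.
    by rewrite -dV2 derive1E; apply: DeriveDef.
  have d2 : 0 < d / 2 by rewrite divr_gt0.
  have [r1 r10 Hr1] := dphi _ d2; have [r2 r20 Hr2] := dV _ d2.
  exists (Num.min r1 r2); first by rewrite lt_min r10.
  move=> s slh; rewrite lt_min => /andP[/Hr1 k1 /Hr2 k2].
  have k3 : `|phi s - phi t| <= w t * `|s - t| + d / 2 * `|s - t|.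
    rewrite wt -normrM; set q := (_ - _) * _ in k1 *.
    have -> : phi s - phi t = q + (phi s - phi t - q) by ring.
    by apply: le_trans (ler_normD _ _) _; rewrite lerD2l.
  apply: le_trans k3 _; move: k2; rewrite ler_norml => /andP[k2 k2'].
  case: (leP s t) => st.
    have E1 : `|s - t| = - (s - t) by rewrite ler0_norm ?subr_le0.
    move: k2'; rewrite E1; clear.
    by move: (s - t) (V s) (V t) (w t) => q v v' ww; lra.
  have E1 : `|s - t| = s - t by rewrite gtr0_norm ?subr_gt0.
  move: k2; rewrite E1; clear.
  by move: (s - t) (V s) (V t) (w t) => q v v' ww; lra.
apply: (le_trans Hp); rewrite lerD2r psum_telescope lp; exact: VC.
Unshelve. all: by end_near.
Qed.

(** * Uniform Peano expansions off small sets *)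

Lemma poly_antiderivative (R : realType) (P : {poly R}) n : (size P <= n)%N ->
  exists2 A : {poly R}, (size A <= n.+1)%N & A^`() = P.
Proof.
(* For [i = 0] the division by zero yields the constant coefficient 0. *)
move=> sP; exists (\poly_(i < n.+1) (P`_i.-1 / i%:R)); first exact: size_poly.
apply/polyP => i; rewrite coef_deriv coef_poly; case: ltnP => h.
  by rewrite -[LHS]mulr_natr divfK // pnatr_eq0.
by rewrite mul0rn nth_default // (leq_trans sP).
Qed.

(** The inequality is required on all of [[a, b]] and the coefficients are bounded by the same [N]
    as the remainder: for fixed [N] the pairs [(x, v)] then form a closed subset of a compact box,
    and the condition weakens as [N] grows. *)
Definition peano_at (R : realType) (a b : R) (f : R -> R) n (N : R) (x : R) : Prop :=
  a <= x <= b /\ exists v : 'rV[R]_n.+1, (forall i, `|v ord0 i| <= N) /\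
    forall z, a <= z <= b ->
      `|f z - taylor n.+1 (fun k => v ord0 (inord k)) (z - x)| <= N * `|z - x| ^+ n.+1.

Lemma peano_atW (R : realType) (a b : R) (f : R -> R) n (N M : R) (x : R) :
  N <= M -> peano_at a b f n N x -> peano_at a b f n M x.
Proof.
move=> NM [xab [v [vN vf]]]; split=> //; exists v; split=> [i|z zab].
  exact: le_trans (vN i) NM.
by apply: le_trans (vf z zab) _; rewrite ler_wpM2r ?exprn_ge0.
Qed.

Lemma ler_norm_taylor (R : realType) n (c : nat -> R) (s l M : R) :
  (forall k, (k < n)%N -> `|c k| <= M) -> `|s| <= l -> 1 <= l -> 0 <= M ->
  `|taylor n c s| <= n%:R * M * l ^+ n.
Proof.
move=> cM sl l1 M0; rewrite /taylor; apply: le_trans (ler_norm_sum _ _ _) _.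
apply: le_trans (_ : \sum_(k < n) M * l ^+ n <= _); last first.
  by rewrite sumr_const card_ord -[leLHS]mulr_natl mulrA.
apply: ler_sum => k _; rewrite normrM normrX; apply: ler_pM => //.
  rewrite normrM normfV normr_nat ler_pdivrMr ?ltr0n ?fact_gt0 //.
  by apply: le_trans (cM k _) _ => //; rewrite ler_peMr // ler1n fact_gt0.
apply: le_trans (_ : l ^+ k <= _); last by rewrite ler_weXn2l // ltnW.
by rewrite lerXn2r ?nnegrE // (le_trans _ l1).
Qed.

(** Integrating the approximation of [f'] by [P] gains one order and turns a mean estimate into a
    pointwise one for [f] and the antiderivative of [P]. Far from [x], boundedness of [f] is enough
    because [|z - x|] is bounded below. *)
Lemma L1_differentiable_peano (R : realType) (a b : R) (f : R -> R) n x :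
  chain_ac a b f ->
  {ae lebesgue_measure, forall t : R, a <= t <= b -> has_derivative f t (derive1 f t)} ->
  L1_differentiable a b n (derive1 f) x -> exists N : nat, peano_at a b f n N%:R x.
Proof.
move=> acf df [/andP[ax xb] [P [sP HP]]].
have [A sA AP] := poly_antiderivative sP.
have [rho0 /= rho00 Hrho] := HP 1 ltr01.
pose r := Num.min rho0 (Num.min (x - a) (b - x)).
have r0 : 0 < r by rewrite !lt_min rho00 !subr_gt0 ax.
(* The antiderivative is determined up to a constant, so the term of degree 0 is taken to be [f x].
   The normalized derivatives of [A] include a division by [k!], undone here. *)
pose c k := if k is 0%N then f x else k`!%:R * A^`N(k).[x].
(* With [d = |z - x|], the ball of radius [2 d] contains [z], and the mean estimate with constant 1
   bounds the integral by [2 (2 d) (2 d)^n = Q d^(n+1)]. *)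
pose Q : R := 2 ^+ n.+2.
have near_est z : `|z - x| < r / 2 -> `|f z - taylor n.+2 c (z - x)| <= Q * `|z - x| ^+ n.+1.
  have [->|zx] := eqVneq z x; first by rewrite subrr taylor_at0 subrr normr0 mulr_ge0 ?exprn_ge0.
  move=> zr; have d0 : 0 < `|z - x| by rewrite normr_gt0 subr_eq0.
  have rr : 2 * `|z - x| < r by lra.
  move: (rr); rewrite !lt_min => /and3P[h1 h2 h3].
  have rho_gt0 : 0 < 2 * `|z - x| by rewrite mulr_gt0.
  have := Hrho (2 * `|z - x|); rewrite /ball_ /= sub0r normrN gtr0_norm // => /(_ h1 rho_gt0).
  rewrite mul1r -AP => hint.
  have int_le : (\int[lebesgue_measure]_(y in ball x (2 * `|z - x|)%R)
      `|derive1 f y - A^`().[y]|%:E <= (Q * `|z - x| ^+ n.+1)%:E)%E.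
    have -> : Q * `|z - x| ^+ n.+1 = (2 * (2 * `|z - x|)) * (2 * `|z - x|) ^+ n.
      by rewrite /Q exprMn !exprS; ring.
    rewrite EFinM -lee_pdivrMl ?mulr_gt0 //.
  have := @l1_increment _ a b f A x (2 * `|z - x|) _ acf df rho_gt0 _ _ int_le z.
  have -> : f z - taylor n.+2 c (z - x) = f z - A.[z] - (f x - A.[x]).
    have -> : A.[z] = A.[x + (z - x)] by congr horner; ring.
    rewrite (nderiv_taylor_wide (mulrC _ _) sA) /taylor.
    rewrite [X in _ - X = _]big_ord_recl [X in _ = _ - X - _]big_ord_recl /=.
    rewrite !expr0 !mulr1 nderivn0 divr1.
    have -> : \sum_(i < n.+1) c (bump 0 i) / (bump 0 i)`!%:R * (z - x) ^+ bump 0 i =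
      \sum_(i < n.+1) A^`N(bump 0 i).[x] * (z - x) ^+ bump 0 i.
      apply: eq_bigr => i _; rewrite /bump /= add1n /c; congr (_ * _).
      by rewrite mulrAC divff ?mul1r // pnatr_eq0 -lt0n fact_gt0.
    by ring.
  apply; [by lra|by lra|by lra].
have ab : a <= b by lra.
have [F F0 HF] : exists2 F : R, 0 <= F & forall z, a <= z <= b -> `|f z| <= F.
  have [F F0 HF] := cont_bounded a b (chain_ac_clamp_continuous ab acf).
  by exists F => // z zab; have := HF z zab; rewrite clamp_id.
pose M := \sum_(k < n.+2) `|c k|.
have M0 : 0 <= M by apply: sumr_ge0.
have cM k : (k < n.+2)%N -> `|c k| <= M.
  by move=> kn; rewrite /M (bigD1 (Ordinal kn)) //= lerDl sumr_ge0.
pose l := b - a + 1; have l1 : 1 <= l by rewrite lerDr subr_ge0.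
pose E := F + n.+1%:R * M * l ^+ n.+1.
have E0 : 0 <= E by rewrite addr_ge0 // !mulr_ge0 ?exprn_ge0 // (le_trans _ l1).
have far_est z : a <= z <= b -> `|f z - taylor n.+1 c (z - x)| <= E.
  move=> zab; apply: le_trans (ler_normB _ _) _; rewrite lerD ?HF //.
  apply: ler_norm_taylor => // [k kn|]; first by rewrite cM // ltnW.
  by case/andP: zab => *; rewrite ler_norml /l; apply/andP; split; lra.
(* Near [x], [near_est] keeps a term of degree [n + 1], which [M] absorbs into the remainder. At
   distance at least [r / 2], the crude bound [E] is divided by the least value of
   [|z - x|^(n+1)]. *)
pose N' := Q + M + E / (r / 2) ^+ n.+1.
have rn : 0 < (r / 2) ^+ n.+1 by rewrite exprn_gt0 // divr_gt0.
have Q0 : 0 <= Q by rewrite exprn_ge0.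
have EN : 0 <= E / (r / 2) ^+ n.+1 by rewrite divr_ge0 // ltW.
exists (Num.bound N'); apply: (@peano_atW _ _ _ _ _ N').
  by apply/ltW/archi_boundP; rewrite !addr_ge0.
split; first by rewrite !ltW.
exists (\row_i c i); split=> [i|z zab].
  rewrite mxE; apply: le_trans (cM i _) _; first by rewrite ltnW // ltnS.
  by rewrite /N' -addrA addrCA lerDl addr_ge0.
have -> : taylor n.+1 (fun k => (\row_(i < n.+1) c i) ord0 (inord k)) (z - x) =
          taylor n.+1 c (z - x).
  by apply: eq_bigr => i _; rewrite mxE inordK.
have [zr|zr] := ltP `|z - x| (r / 2).
  have := near_est z zr; rewrite taylorS => h.
  set T := taylor n.+1 c (z - x) in h *; set q := c n.+1 / _ * _ in h.
  have -> : f z - T = (f z - (T + q)) + q by ring.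
  apply: le_trans (ler_normD _ _) _.
  apply: le_trans (_ : (Q + M) * `|z - x| ^+ n.+1 <= _); last first.
    by rewrite ler_wpM2r ?exprn_ge0 // lerDl.
  rewrite mulrDl lerD // /q normrM normrX ler_wpM2r ?exprn_ge0 //.
  rewrite normrM normfV normr_nat ler_pdivrMr ?ltr0n ?fact_gt0 //.
  by apply: le_trans (cM n.+1 _) _ => //; rewrite ler_peMr // ler1n fact_gt0.
apply: le_trans (far_est z zab) _.
apply: le_trans (_ : E / (r / 2) ^+ n.+1 * `|z - x| ^+ n.+1 <= _); last first.
  by rewrite ler_wpM2r ?exprn_ge0 // lerDr addr_ge0.
rewrite mulrAC ler_pdivlMr // ler_wpM2l // lerXn2r ?nnegrE //.
by rewrite divr_ge0 // ltW.
Qed.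

Lemma small_eq0 (R : realType) (d Q r0 : R) : 0 < r0 ->
  (forall r, 0 < r -> r <= r0 -> `|d| <= Q * r) -> d = 0.
Proof.
move=> r00 H; apply/eqP; rewrite -normr_le0 leNgt; apply/negP => d0.
have Q1 : 0 < `|Q| + 1 by rewrite ltr_wpDl.
pose r := Num.min r0 (`|d| / 2 / (`|Q| + 1)).
have r_gt0 : 0 < r by rewrite lt_min r00 !divr_gt0.
have := H r r_gt0; rewrite ge_min lexx => /(_ isT) h.
have : Q * r <= `|d| / 2.
  apply: le_trans (_ : (`|Q| + 1) * r <= _).
    by rewrite ler_wpM2r ?(ltW r_gt0) // (le_trans (ler_norm Q)) // lerDl.
  by rewrite mulrC -ler_pdivlMr // ge_min lexx orbT.
lra.
Qed.

(** The expansions of different orders are chosen independently, but their coefficients are unique: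
    those of orders [n] and [n + 1] differ by a polynomial that is [O(r^(n+1))], so each difference
    of coefficients is [O(r)] for all small [r]. The diagonal [V x k k] is then a single jet. *)
Lemma peano_jets (R : realType) (a b : R) (f : R -> R) (K : set R) (N : nat -> R) :
  a < b -> (forall n x, K x -> peano_at a b f n (N n) x) ->
  exists al : nat -> R -> R, (forall k x, K x -> `|al k x| <= N k) /\
    forall n x z, K x -> a <= z <= b ->
      `|f z - taylor n.+1 (al^~ x) (z - x)| <= N n * `|z - x| ^+ n.+1.
Proof.
move=> ab HK.
have [V HV] : exists V : R -> nat -> nat -> R, forall x n, K x ->
    (forall k, (k <= n)%N -> `|V x n k| <= N n) /\
    forall z, a <= z <= b -> `|f z - taylor n.+1 (V x n) (z - x)| <= N n * `|z - x| ^+ n.+1.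
  suff H (x : R) (n : nat) : exists v : nat -> R, K x -> (forall k, (k <= n)%N -> `|v k| <= N n) /\
    forall z, a <= z <= b -> `|f z - taylor n.+1 v (z - x)| <= N n * `|z - x| ^+ n.+1.
    have H' x : exists Vx : nat -> nat -> R, forall n, K x ->
        (forall k, (k <= n)%N -> `|Vx n k| <= N n) /\ forall z, a <= z <= b ->
        `|f z - taylor n.+1 (Vx n) (z - x)| <= N n * `|z - x| ^+ n.+1.
      by have [Vx HVx] := choice (H x); exists Vx.
    by have [V HV] := choice H'; exists V.
  have [Kx|nKx] := pselect (K x); last by exists (fun=> 0).
  have [_ [v [vN vf]]] := HK n x Kx; exists (fun k => v ord0 (inord k)) => _.
  by split=> // k kn.
have N0 n x : K x -> 0 <= N n.
  by move=> Kx; apply: le_trans ((HV x n Kx).1 0%N _).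
have step_eq x n k : K x -> (k <= n)%N -> V x n k = V x n.+1 k.
  move=> Kx kn; have [vN vf] := HV x n Kx; have [wN wf] := HV x n.+1 Kx.
  have [/andP[ax xb] _] := HK n x Kx.
  have [C C0 HC] := taylor_coef_bound R n.
  pose d j := V x n j - V x n.+1 j; pose Q := N n + N n.+1 + N n.+1.
  have Q0 : 0 <= Q by rewrite !addr_ge0 // (N0 _ x).
  have key sg r : `|sg| = 1 -> 0 < r -> r <= 1 ->
      (forall s, 0 <= s <= r -> a <= x + sg * s <= b) -> `|d k| <= C * Q * r.
    move=> sg1 r0 r1 Hs.
    have h : `|d k| * r ^+ k <= C * (Q * r ^+ n.+1).
      apply: (HC d sg r) => // s /[dup] sr /andP[s0 s_r].
      have zab := Hs s sr; have := vf _ zab; have := wf _ zab.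
      have -> : x + sg * s - x = sg * s by ring.
      have -> : `|sg * s| = s by rewrite normrM sg1 mul1r ger0_norm.
      rewrite [taylor n.+2 _ _]taylorS; set T1 := taylor n.+1 (V x n) _.
      set T2 := taylor n.+1 (V x n.+1) _; set q := V x n.+1 n.+1 / _ * _ => h2 h1.
      have -> : taylor n.+1 d (sg * s) = T1 - T2.
        by rewrite /T1 /T2 /taylor -sumrB; apply: eq_bigr => i _; rewrite /d !mulrBl.
      have hq : `|q| <= N n.+1 * s ^+ n.+1.
        rewrite /q normrM normrX normrM sg1 mul1r (ger0_norm s0).
        rewrite ler_wpM2r ?exprn_ge0 // normrM normfV normr_nat.
        rewrite ler_pdivrMr ?ltr0n ?fact_gt0 //.
        apply: le_trans (wN n.+1 _) _ => //.
        by rewrite ler_peMr ?(N0 _ x) // ler1n fact_gt0.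
      have s2 : N n.+1 * s ^+ n.+2 <= N n.+1 * s ^+ n.+1.
        rewrite ler_wpM2l ?(N0 _ x) // exprS ler_piMl ?exprn_ge0 //.
        exact: le_trans s_r r1.
      have -> : T1 - T2 = (f (x + sg * s) - (T2 + q)) - (f (x + sg * s) - T1) + q by ring.
      apply: le_trans (ler_normD _ _) _; apply: le_trans (lerD (ler_normB _ _) hq) _.
      apply: le_trans (_ : Q * s ^+ n.+1 <= _); last first.
        by rewrite ler_wpM2l // lerXn2r ?nnegrE // ltW.
      by rewrite /Q; move: h1 h2 s2; lra.
    have rk : 0 < r ^+ k by rewrite exprn_gt0.
    rewrite -(ler_pM2r rk); apply: (le_trans h); rewrite mulrA -!mulrA ler_wpM2l //.
    rewrite ler_wpM2l // -exprS; apply: ler_wiXn2l => //; exact: ltW.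
  apply/eqP; rewrite -subr_eq0; apply/eqP.
  have m0 : 0 < Num.min 1 ((b - a) / 2) by rewrite lt_min ltr01 divr_gt0 ?subr_gt0.
  apply: (@small_eq0 _ _ (C * Q) _ m0) => r r0; rewrite le_min => /andP[r1 rab].
  (* The comparison is made on the side of [x] that contains at least half of [[a, b]], as [x] may
     be an end point. *)
  have [h|h] := leP (x - a) ((b - a) / 2).
    apply: (key 1) => //; first by rewrite normr1.
    by move=> s /andP[s0 sr]; apply/andP; split; lra.
  apply: (key (-1)) => //; first by rewrite normrN1.
  by move=> s /andP[s0 sr]; apply/andP; split; lra.
exists (fun k x => V x k k).
have E x n k : K x -> (k <= n)%N -> V x k k = V x n k.
  move=> Kx; elim: n => [|n IH]; first by rewrite leqn0 => /eqP ->.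
  rewrite leq_eqVlt => /orP[/eqP-> //|kn].
  by rewrite IH // step_eq.
split=> [k x Kx|n x z Kx zab]; first by have [h _] := HV x k Kx; exact: h.
have [_ /(_ z zab)] := HV x n Kx.
suff -> : taylor n.+1 (V x n) (z - x) = taylor n.+1 (fun k => V x k k) (z - x) by [].
by apply: eq_bigr => i _; rewrite (E x n) // -ltnS.
Qed.

Lemma closed_le_fun (R : realType) (T : topologicalType) (F G : T -> R) :
  continuous F -> continuous G -> closed [set p | F p <= G p].
Proof.
move=> cF cG; rewrite (_ : [set p | _] = (fun p => G p - F p) @^-1` [set x | 0 <= x]).
  apply: closed_comp; last exact: closed_ge.
  by move=> p _; apply: cvgB; [exact: cG|exact: cF].
by apply/seteqP; split=> p /=; rewrite subr_ge0.
Qed.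

Lemma continuous_expn (R : realType) (T : topologicalType) (F : T -> R) k :
  continuous F -> continuous (fun p => F p ^+ k).
Proof.
move=> cF; elim: k => [|k IH]; first by move=> p; exact: cvg_cst.
rewrite (_ : (fun p => F p ^+ k.+1) = fun p => F p * F p ^+ k).
  by move=> p; apply: cvgM; [exact: cF|exact: IH].
by apply/funext => p; rewrite exprS.
Qed.

Lemma continuous_taylor (R : realType) (T : topologicalType) n (c : T -> nat -> R)
    (s : T -> R) :
  (forall k, continuous (c^~ k)) -> continuous s ->
  continuous (fun p => taylor n (c p) (s p)).
Proof.
move=> cc cs; elim: n => [|n IH].
  rewrite (_ : (fun p => taylor 0 (c p) (s p)) = fun=> 0).
    by move=> p; exact: cvg_cst.
  by apply/funext => p; rewrite /taylor big_ord0.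
rewrite (_ : (fun p => taylor n.+1 (c p) (s p)) =
  fun p => taylor n (c p) (s p) + c p n / n`!%:R * s p ^+ n).
  move=> p; apply: cvgD; first exact: IH.
  apply: cvgM; last exact: continuous_expn.
  by apply: cvgM; [exact: cc|exact: cvg_cst].
by apply/funext => p; rewrite taylorS.
Qed.

(** It is the projection of a compact set of pairs [(x, v)]: for each [z] the number [f z] is a
    constant and the inequality is closed in [(x, v)]. Measurability for the exhaustion and
    closedness of [K] both follow. *)
Lemma compact_peano_at (R : realType) (a b : R) (f : R -> R) n (N : R) :
  compact [set x | peano_at a b f n N x].
Proof.
pose T : topologicalType := (R * 'rV[R]_n.+1)%type.
pose box : set 'rV[R]_n.+1 := [set v | forall i, `[- N, N]%classic (v ord0 i)].
pose S : set T := [set p : T | [/\ a <= p.1 <= b, box p.2 & forall z, a <= z <= b ->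
  `|f z - taylor n.+1 (fun k => p.2 ord0 (inord k)) (z - p.1)| <= N * `|z - p.1| ^+ n.+1]].
have cfst : continuous (fst : T -> R) by move=> p; exact: cvg_fst.
have cS : compact S.
  have cbox : compact box.
    by apply: (rV_compact (A := fun=> `[- N, N]%classic)) => i; exact: segment_compact.
  apply: (subclosed_compact _ (compact_setX (@segment_compact R a b) cbox)); last first.
    by move=> [x v] [/= xab bv _]; split; rewrite //= in_itv.
  pose D z : set T := [set p : T | a <= z <= b ->
    `|f z - taylor n.+1 (fun k => p.2 ord0 (inord k)) (z - p.1)| <= N * `|z - p.1| ^+ n.+1].
  have -> : S = (`[a, b]%classic `*` box) `&` \bigcap_(z in [set: R]) D z.
    apply/seteqP; split=> [[x v] [/= xab bv H]|[x v] [[/= xab bv] H]].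
      by split; [split; rewrite //= in_itv|move=> z _ zab; exact: H].
    by split=> // z; exact: (H z Logic.I).
  apply: closedI.
    apply: compact_closed; last exact: compact_setX (@segment_compact R a b) cbox.
    exact: norm_hausdorff.
  apply: closed_bigI => z _; rewrite /D.
  have [zab|nz] := boolP (a <= z <= b); last first.
    rewrite (_ : [set p | _] = setT); first exact: closedT.
    by apply/seteqP; split.
  rewrite (_ : [set p | _] = [set p : T | `|f z - taylor n.+1 (fun k => p.2 ord0 (inord k))
     (z - p.1)| <= N * `|z - p.1| ^+ n.+1]); last first.
    by apply/seteqP; split=> p /=; [apply|].
  have czp : continuous (fun p : T => z - p.1).
    by move=> p; apply: cvgB; [exact: cvg_cst|exact: cfst].
  apply: closed_le_fun => p.
    apply: cvg_norm; apply: cvgB; first exact: cvg_cst.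
    apply: (continuous_taylor (c := fun (p : T) k => p.2 ord0 (inord k))) => // k q.
    apply: (@continuous_comp _ _ _ snd (fun v : 'rV[R]_n.+1 => v ord0 (inord k))).
      exact: cvg_snd.
    exact: coord_continuous.
  apply: cvgMr; apply: (continuous_expn (F := fun p : T => `|z - p.1|)) => q.
  by apply: cvg_norm; exact: czp.
rewrite (_ : [set x | _] = fst @` S).
  by apply: continuous_compact => //; exact: continuous_subspaceT.
apply/seteqP; split=> [x [xab [v [vN vf]]]|x [[y v] [/= xab bv H] <-]].
  exists (x, v) => //; split=> // i /=.
  by rewrite in_itv /= -ler_norml.
by split=> //; exists v; split=> // i; have := bv i; rewrite /= in_itv /= -ler_norml.
Qed.

Lemma ae_exhaustion (R : realType) (a b e : R) (A : nat -> set R) : 0 < e ->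
  (forall n, measurable (A n)) -> (forall n, A n `<=` A n.+1) ->
  {ae lebesgue_measure, forall x : R, a <= x <= b -> exists n, A n x} ->
  exists n, (lebesgue_measure (`[a, b] `\` A n) < e%:E)%E.
Proof.
move=> e0 mA sA aeA; pose B n : set R := `[a, b] `\` A n.
have mB n : measurable (B n) by exact: measurableD.
have finab : (lebesgue_measure (`[a, b] : set R) < +oo)%E.
  by rewrite lebesgue_measure_itv /=; case: ifP => _; rewrite ?ltry // -EFinB ltry.
have mcap : measurable (\bigcap_n B n) by exact: bigcap_measurable.
have cap0 : lebesgue_measure (\bigcap_n B n) = 0%E.
  have [M [mM M0 BM]] := aeA.
  have sub : \bigcap_n B n `<=` M.
    move=> x Bx; apply: BM => /= H; have [xab _] := Bx 0%N Logic.I.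
    have [n An] : exists n, A n x by apply: H; move: xab; rewrite /= in_itv.
    by have [_] := Bx n Logic.I; apply.
  apply/eqP; rewrite eq_le measure_ge0 andbT.
  by apply: le_trans (le_lebesgue sub : (_ <= lebesgue_measure M)%E) _; rewrite [leLHS]M0.
have cv : (lebesgue_measure (B n) @[n --> \oo] --> 0)%E.
  rewrite -cap0; apply: nonincreasing_cvg_mu => //.
    by apply: le_lt_trans finab; apply: le_lebesgue => //; exact: subDsetl.
  apply/nonincreasing_seqP => n; apply/subsetPset => x [xab nA]; split=> // An.
  by apply: nA; exact: sA.
have /cv[n _ Hn] : nbhs (0 : \bar R)%E [set x | (x < e%:E)%E].
  by apply: open_nbhs_nbhs; split; [exact: open_ereal_lt_ereal|rewrite /= lte_fin].
by exists n; apply: (Hn n) => /=.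
Qed.

Lemma choose_closed (R : realType) (a b e : R) (A : nat -> nat -> set R) : 0 < e ->
  (forall m n, measurable (A m n)) -> (forall m n, A m n `<=` A m n.+1) ->
  (forall m, {ae lebesgue_measure, forall x : R, a <= x <= b -> exists n, A m n x}) ->
  exists N : nat -> nat, (lebesgue_measure (`[a, b] `\` \bigcap_m A m (N m)) < e%:E)%E.
Proof.
move=> e0 mA sA aeA; have e2 : 0 < e / 2 by rewrite divr_gt0.
(* The errors [e / 2 / 2^(m+1)] add up to at most [e / 2], which leaves room for the strict
   inequality. *)
have em (m : nat) : 0 < e / 2 / (2 ^ m.+1)%:R by rewrite divr_gt0 // ltr0n expn_gt0.
have [N HN] := choice (fun m => ae_exhaustion (em m) (mA m) (sA m) (aeA m)).
exists N; pose B m : set R := `[a, b] `\` A m (N m).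
have mB m : measurable (B m) by exact: measurableD.
have mcap : measurable (\bigcap_m A m (N m)) by apply: bigcap_measurable.
apply: le_lt_trans (_ : _ <= \big[+%E/0%R]_(0 <= m <oo) lebesgue_measure (B m))%E _.
  apply: measure_sigma_subadditive => //; first exact: measurableD.
  move=> x [xab nA]; apply: contrapT => H; apply: nA => m _.
  by apply: contrapT => nAm; apply: H; exists m.
apply: le_lt_trans (_ : _ <= (e / 2)%:E)%E _; last by rewrite lte_fin; lra.
apply: le_trans (epsilon_trick0 xpredT (ltW e2)).
apply: lee_nneseries => [m *|m *]; first exact: measure_ge0.
exact: ltW (HN m).
Qed.

(** * Defect of the area *)

(* Cutting [w] off outside [a, b] makes it integrable on the whole line. *)
Lemma smooth_antiderivative_itv (R : realType) (w : R -> R) (a b : R) : smooth w -> a < b ->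
  exists W w1, [/\ smooth W, smooth w1, forall t, has_derivative W t (w1 t) &
    forall t, a <= t <= b -> w1 t = w t].
Proof.
move=> sw ab; pose l := 2 / (b - a); pose m := (a + b) / 2.
have l0 : 0 < l by rewrite divr_gt0 ?subr_gt0.
pose w1 t := w t * cutoff (l * t + (- l * m)).
have sw1 : smooth w1 by apply: smoothM => //; exact/smooth_affine/smooth_cutoff.
have lE t : l * t + (- l * m) = (t - m) / ((b - a) / 2).
  by rewrite /l; field; rewrite subr_eq0 gt_eqF.
have h0 : 0 < (b - a) / 2 by rewrite divr_gt0 ?subr_gt0.
have w1E t : a <= t <= b -> w1 t = w t.
  move=> /andP[at_ tb]; rewrite /w1 cutoff1 ?mulr1 // lE normrM normfV (gtr0_norm h0).
  by rewrite ler_pdivrMr // mul1r ler_norml /m; apply/andP; split; lra.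
(* [p + 1] is the left end of the support of the cutoff: [W] vanishes up to there, and beyond it [t]
   lies strictly inside the interval of integration, as the differentiation theorem demands. *)
pose p := m - (b - a) - 1.
have w10 t : t <= p + 1 -> w1 t = 0.
  move=> tp; rewrite /w1 cutoff0 ?mulr0 // lE normrM normfV (gtr0_norm h0).
  by rewrite ler_pdivlMr // ler_normr; apply/orP; right; move: tp; rewrite /p /m; lra.
pose W t := \int[lebesgue_measure]_(u in `[p, t]) w1 u.
have W0 t : t <= p + 1 -> W t = 0.
  move=> tp; rewrite /W (@eq_Rintegral _ _ _ _ _ (fun=> 0)); last first.
    move=> u; rewrite inE /= in_itv /= => /andP[_ ut]; rewrite w10 //.
    exact: le_trans ut tp.
  by rewrite Rintegral_cst ?mul0r.
have dW t : has_derivative W t (w1 t).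
  have [tp|pt] := ltP t (p + 1).
    rewrite w10 ?(ltW tp) //.
    apply: (@near_has_derivative _ _ (fun=> 0) _ _ (p + 1 - t)); rewrite ?subr_gt0 //.
      by move=> s; rewrite ltr_norml => /andP[_ h]; rewrite W0 //; lra.
    exact: has_derivative_cst.
  have cw1 := smooth_cont sw1.
  have iw : lebesgue_measure.-integrable `[p, t + 1] (EFin \o w1).
    apply: continuous_compact_integrable; first exact: segment_compact.
    exact: continuous_subspaceT.
  have tt : t < t + 1 by rewrite ltrDl.
  have pt' : p < t by apply: lt_le_trans pt; rewrite ltrDl.
  have [dW W'] := continuous_FTC1_closed tt iw pt' (cw1 t).
  by apply/has_derivativeP; rewrite -W' derive1E; apply: DeriveDef.
exists W, w1; split=> //; exact: (smooth_antiderivative dW).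
Qed.

Lemma smooth_lipschitz (R : realType) (F : R -> R) (a b : R) : smooth F ->
  exists2 M : R, 0 <= M & (forall t, a <= t <= b -> `|F t| <= M /\ `|derive1 F t| <= M) /\
    (forall s t, a <= s <= b -> a <= t <= b -> `|F t - F s| <= M * `|t - s|).
Proof.
move=> sF; have [M M0 HM] := smooth_bounded 1 a b sF; exists M => //; split=> [t tab|s t sab tab].
  by split; [exact: (HM 0%N)|exact: (HM 1%N)].
apply: (MVT_itv (F' := derive1 F) _ sab tab) => [u|u uab]; last exact: (HM 1%N).
exact: smooth_has_derivative.
Qed.

Lemma smooth_chain_ac (R : realType) (F : R -> R) (a b : R) : smooth F -> chain_ac a b F.
Proof.
move=> sF; have [M _ [_ HM]] := smooth_lipschitz a b sF.
apply: (@lipschitz_chain_ac _ _ _ M) => s t as_ st tb.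
rewrite -[X in _ * X]ger0_norm ?subr_ge0 //; apply: HM.
  by rewrite as_ (le_trans st tb).
by rewrite tb (le_trans as_ st).
Qed.

Lemma chain_acD (R : realType) (a b : R) (F G : R -> R) :
  chain_ac a b F -> chain_ac a b G -> chain_ac a b (fun t => F t + G t).
Proof.
move=> acF acG; apply: (@chain_ac_lin _ _ _ 1 _ _ _ acF acG) => s t _ _ _; rewrite mul1r.
have -> : F t + G t - (F s + G s) = (F t - F s) + (G t - G s) by ring.
exact: ler_normD.
Qed.

Lemma chain_acB (R : realType) (a b : R) (F G : R -> R) :
  chain_ac a b F -> chain_ac a b G -> chain_ac a b (fun t => F t - G t).
Proof.
move=> acF acG; apply: (@chain_ac_lin _ _ _ 1 _ _ _ acF acG) => s t _ _ _; rewrite mul1r.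
have -> : F t - G t - (F s - G s) = (F t - F s) - (G t - G s) by ring.
exact: ler_normB.
Qed.

Lemma chain_ac_bounded (R : realType) (a b : R) (F : R -> R) : a <= b ->
  chain_ac a b F -> exists2 M : R, 0 <= M & forall t, a <= t <= b -> `|F t| <= M.
Proof.
move=> ab acF; have [M M0 HM] := cont_bounded a b (chain_ac_clamp_continuous ab acF).
by exists M => // t tab; have := HM t tab; rewrite clamp_id.
Qed.

Lemma chain_acM (R : realType) (a b : R) (F G : R -> R) : a <= b ->
  chain_ac a b F -> chain_ac a b G -> chain_ac a b (fun t => F t * G t).
Proof.
move=> ab acF acG.
have [M M0 HM] := chain_ac_bounded ab acF; have [N N0 HN] := chain_ac_bounded ab acG.
apply: (@chain_ac_lin _ _ _ (M + N) _ _ _ acF acG) => s t as_ st tb.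
have sab : a <= s <= b by rewrite as_ (le_trans st tb).
have tab : a <= t <= b by rewrite tb (le_trans as_ st).
have -> : F t * G t - F s * G s = F t * (G t - G s) + (F t - F s) * G s by ring.
apply: le_trans (ler_normD _ _) _; rewrite !normrM mulrDr addrC lerD //.
  by rewrite mulrC ler_wpM2r // (le_trans (HN s sab)) // lerDr.
by rewrite ler_wpM2r // (le_trans (HM t tab)) // lerDl.
Qed.

Lemma ae_impl (R : realType) (P Q : R -> Prop) : (forall t, P t -> Q t) ->
  {ae lebesgue_measure, forall t : R, P t} -> {ae lebesgue_measure, forall t : R, Q t}.
Proof.
by move=> PQ; apply: negligibleS => t /= nQ Pt; apply: nQ; exact: PQ.
Qed.

Definition ae_horizontal (R : realType) (a b : R) (f g h : R -> R) : Prop :=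
  {ae lebesgue_measure, forall t : R, a <= t <= b -> exists c d,
    [/\ has_derivative f t c, has_derivative g t d &
      has_derivative h t (2 * (c * g t - d * f t))]}.

(** The vertical speed of the horizontal lift of the plane curve [(f, g)]. *)
Definition area_form (R : realType) (f g : R -> R) (t : R) : R :=
  2 * (derive1 f t * g t - derive1 g t * f t).

(* Bounds [W' = 2 (2 f0' v - 2 u g0' + u' v - u v')] along increments of [f] and [g]. *)
Lemma discrepancy_estimate (R : realType) (f g h f0 g0 Om : R -> R) (x y M eta : R) :
  x <= y -> chain_ac x y f -> chain_ac x y g -> chain_ac x y h ->
  ae_horizontal x y f g h -> smooth f0 -> smooth g0 -> smooth Om ->
  (forall t, x <= t <= y -> derive1 Om t = area_form f0 g0 t) ->
  0 <= eta -> 0 <= M ->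
  (forall t, x <= t <= y -> [/\ `|f t - f0 t| <= eta, `|g t - g0 t| <= eta,
     `|derive1 f0 t| <= M & `|derive1 g0 t| <= M]) ->
  f x = f0 x -> g x = g0 x -> f y = f0 y -> g y = g0 y ->
  forall e, 0 < e -> exists p, [/\ chain (fun _ _ => True) x p, last x p = y &
    `|(h y - h x) - (Om y - Om x)| <= 12 * M * eta * (y - x) +
       2 * eta * (psum (fun s t => `|f t - f s|) x p + psum (fun s t => `|g t - g s|) x p) + e].
Proof.
move=> xy acf acg ach aeH sf0 sg0 sOm OmE eta0 M0 HM fx gx fy gy e e0.
pose u t := f t - f0 t; pose v t := g t - g0 t.
(* The two products vanish at [x] and [y]. They perform an integration by parts that removes [u' g0]
   and [v' f0], where a derivative of [u] or [v] has a factor that is not small; each remaining term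
   contains [u] or [v] itself. *)
pose W t := h t - Om t - 2 * (u t * g0 t) + 2 * (f0 t * v t).
have acc (k : R) : chain_ac x y (fun=> k) by exact/smooth_chain_ac/smooth_cst.
have acu : chain_ac x y u by apply: chain_acB => //; exact: smooth_chain_ac.
have acv : chain_ac x y v by apply: chain_acB => //; exact: smooth_chain_ac.
have acW : chain_ac x y W.
  apply: chain_acD; last first.
    by apply: chain_acM => //; apply: chain_acM => //; exact: smooth_chain_ac.
  apply: chain_acB; first by apply: chain_acB => //; exact: smooth_chain_ac.
  by apply: chain_acM => //; apply: chain_acM => //; exact: smooth_chain_ac.
pose S s t := 12 * M * eta * (t - s) + 2 * eta * (`|f t - f s| + `|g t - g s|).
have S0 s t : x <= s -> s <= t -> t <= y -> 0 <= S s t.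
  by move=> _ st _; rewrite addr_ge0 ?mulr_ge0 ?subr_ge0 ?addr_ge0.
have [|p [cp lp Hp]] := @ac_increment _ W S x y xy acW S0 _ e e0.
- apply: ae_impl aeH => t Ht txy d d0.
  have [c1 [c2 [df dg dh]]] := Ht txy; have [u_le v_le f0_le g0_le] := HM t txy.
  have df0 := smooth_has_derivative t sf0; have dg0 := smooth_has_derivative t sg0.
  have dOm := smooth_has_derivative t sOm.
  have du := has_derivativeB df df0; have dv := has_derivativeB dg dg0.
  pose W' := 2 * (2 * (derive1 f0 t * v t) - 2 * (u t * derive1 g0 t) +
    (c1 - derive1 f0 t) * v t - u t * (c2 - derive1 g0 t)).
  have [dW] : has_derivative W t W'.
    have d1 := has_derivativeB dh dOm.
    have d2 := has_derivativeB d1 (has_derivativeZ 2 (has_derivativeM du dg0)).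
    have d3 := has_derivativeD d2 (has_derivativeZ 2 (has_derivativeM df0 dv)).
    by apply: has_derivative_eq d3 _; rewrite OmE // /area_form /W' /u /v; ring.
  (* The three differentiation errors [d / k], of [W] with weight 1 and of [f] and [g] with weight
     [2 eta], add up to exactly [d]. *)
  pose k := 1 + 4 * eta; have k0 : 0 < k by rewrite ltr_wpDr // mulr_ge0.
  have dk : 0 < d / k by rewrite divr_gt0.
  have [r1 r10 Hr1] := dW _ dk.
  have [r2 r20 Hr2] := (let: HasDerivative H := df in H) _ dk.
  have [r3 r30 Hr3] := (let: HasDerivative H := dg in H) _ dk.
  exists (Num.min r1 (Num.min r2 r3)); first by rewrite !lt_min r10 r20.
  move=> s sxy; rewrite !lt_min => /and3P[/Hr1 k1 /Hr2 k2 /Hr3 k3].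
  set q := `|s - t| in k1 k2 k3 *.
  have q0 : 0 <= q by rewrite /q normr_ge0.
  have c1q : `|c1| * q <= `|f s - f t| + d / k * q.
    rewrite -normrM; have -> : c1 * (s - t) = (f s - f t) - (f s - f t - c1 * (s - t)) by ring.
    by apply: le_trans (ler_normB _ _) _; rewrite lerD2l.
  have c2q : `|c2| * q <= `|g s - g t| + d / k * q.
    rewrite -normrM; have -> : c2 * (s - t) = (g s - g t) - (g s - g t - c2 * (s - t)) by ring.
    by apply: le_trans (ler_normB _ _) _; rewrite lerD2l.
  have W'q : `|W'| * q <= 12 * M * eta * q + 2 * eta * (`|c1| * q + `|c2| * q).
    have : `|W'| <= 2 * (2 * (M * eta) + 2 * (eta * M) + (`|c1| + M) * eta + eta * (`|c2| + M)).
      rewrite /W' normrM ger0_norm // ler_wpM2l //.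
      apply: le_trans (ler_normB _ _) _; apply: lerD.
        apply: le_trans (ler_normD _ _) _; apply: lerD.
          apply: le_trans (ler_normB _ _) _; rewrite !normrM (ger0_norm (x := 2)) //.
          by apply: lerD; rewrite ler_wpM2l // ler_pM.
        rewrite normrM ler_pM //; apply: le_trans (ler_normB _ _) _; exact: lerD.
      rewrite normrM ler_pM //; apply: le_trans (ler_normB _ _) _; exact: lerD.
    move/(ler_wpM2r q0)/le_trans; apply.
    by rewrite le_eqVlt; apply/orP; left; apply/eqP; ring.
  have Wst : `|W s - W t| <= `|W'| * q + d / k * q.
    rewrite -normrM; have -> : W s - W t = W' * (s - t) + (W s - W t - W' * (s - t)) by ring.
    by apply: le_trans (ler_normD _ _) _; rewrite lerD2l.
  have key : `|W s - W t| <= 12 * M * eta * q + 2 * eta * (`|f s - f t| + `|g s - g t|) + d * q.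
    apply: (le_trans Wst); apply: le_trans (lerD W'q (lexx _)) _.
    have e2 : 0 <= 2 * eta by rewrite mulr_ge0.
    have := ler_wpM2l e2 (lerD c1q c2q).
    have dE : d * q = d / k * q + 2 * eta * (d / k * q + d / k * q).
      by rewrite /k; field; rewrite gt_eqF.
    by rewrite dE; move: (d / k * q) => dk'; clear; lra.
  apply: (le_trans key); rewrite lerD2r /S /q.
  case: (leP s t) => st; last by rewrite gtr0_norm ?subr_gt0.
  by rewrite ler0_norm ?subr_le0 // opprB (distrC (f s)) (distrC (g s)).
exists p; split => //.
have -> : h y - h x - (Om y - Om x) = W y - W x.
  by rewrite /W /u /v fx gx fy gy !subrr; ring.
apply: (le_trans Hp); rewrite lerD2r /S !psumD !psumZ psum_telescope lp.
by rewrite psumD.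
Qed.

(** On an interval shorter than [del], absolute continuity keeps the variations of [f] and [g] below
    1, and the factor [eta] in [discrepancy_estimate] is of order [(y - x)^(n+1)]. On longer
    intervals boundedness of [h] and [Om] suffices. *)
Lemma discrepancy (R : realType) (a b : R) (K : set R) (f g h f1 g1 Om : R -> R) :
  a < b -> (forall x, K x -> a <= x <= b) ->
  chain_ac a b f -> chain_ac a b g -> chain_ac a b h -> ae_horizontal a b f g h ->
  smooth f1 -> smooth g1 -> smooth Om ->
  (forall t, a <= t <= b -> derive1 Om t = area_form f1 g1 t) ->
  (forall n, exists C, forall x z, K x -> a <= z <= b -> `|f z - f1 z| <= C * `|z - x| ^+ n.+1) ->
  (forall n, exists C, forall x z, K x -> a <= z <= b -> `|g z - g1 z| <= C * `|z - x| ^+ n.+1) ->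
  forall n, exists2 C : R, 0 <= C & forall x y, K x -> K y -> x < y ->
    `|(h y - h x) - (Om y - Om x)| <= C * (y - x) ^+ n.
Proof.
move=> ab Kab acf acg ach aeH sf1 sg1 sOm OmE Hf Hg n.
have [Cf HCf] := Hf n; have [Cg HCg] := Hg n.
have fK x : K x -> f x = f1 x.
  move=> Kx; have [C HC] := Hf 0%N; have := HC x x Kx (Kab x Kx).
  by rewrite subrr normr0 expr1 mulr0 normr_le0 subr_eq0 => /eqP.
have gK x : K x -> g x = g1 x.
  move=> Kx; have [C HC] := Hg 0%N; have := HC x x Kx (Kab x Kx).
  by rewrite subrr normr0 expr1 mulr0 normr_le0 subr_eq0 => /eqP.
have [df df0 Hdf] := acf 1 ltr01; have [dg dg0 Hdg] := acg 1 ltr01.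
have [Mf Mf0 [HMf _]] := smooth_lipschitz a b sf1.
have [Mg Mg0 [HMg _]] := smooth_lipschitz a b sg1.
have [Mh Mh0 HMh] := chain_ac_bounded (ltW ab) ach.
have [MO MO0 [HMO _]] := smooth_lipschitz a b sOm.
pose del := Num.min df dg; have del0 : 0 < del by rewrite lt_min df0.
pose M := Mf + Mg; have M0 : 0 <= M by rewrite addr_ge0.
pose c := `|Cf| + `|Cg|; have c0 : 0 <= c by rewrite addr_ge0.
pose L := b - a; have L0 : 0 < L by rewrite subr_gt0.
have A1 : 0 <= 12 * M * L + 4 by rewrite addr_ge0 // mulr_ge0 ?(ltW L0) // mulr_ge0.
have A0 : 0 <= c * L * (12 * M * L + 4) by rewrite mulr_ge0 // mulr_ge0 // ltW.
have B0 : 0 <= 2 * (Mh + MO) / del ^+ n.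
  by rewrite divr_ge0 ?exprn_ge0 ?(ltW del0) // mulr_ge0 // addr_ge0.
(* With both variations at most 1 the estimate is at most [eta * (12 M L + 4)], and
   [eta <= c L (y - x)^n]. The second summand serves when [(y - x) / del >= 1]. *)
exists (c * L * (12 * M * L + 4) + 2 * (Mh + MO) / del ^+ n); first exact: addr_ge0.
move=> x y Kx Ky xy; have xab := Kab x Kx; have yab := Kab y Ky.
have [ax xb] := andP xab; have [ay yb] := andP yab.
pose l := y - x; have l0 : 0 < l by rewrite subr_gt0.
have lL : l <= L by rewrite /l /L; lra.
have ln0 : 0 <= l ^+ n by rewrite exprn_ge0 // ltW.
rewrite -/l mulrDl; have [ldel|dell] := ltP l del; last first.
  apply: le_trans (_ : 2 * (Mh + MO) <= _).
    apply: le_trans (ler_normB _ _) _.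
    have h1 := HMh x xab; have h2 := HMh y yab.
    have [h3 _] := HMO x xab; have [h4 _] := HMO y yab.
    have h5 := ler_normB (h y) (h x); have h6 := ler_normB (Om y) (Om x).
    by move: h1 h2 h3 h4 h5 h6; clear; lra.
  apply: le_trans (_ : 2 * (Mh + MO) / del ^+ n * l ^+ n <= _).
    rewrite mulrAC ler_pdivlMr ?exprn_gt0 // ler_wpM2l //.
      by rewrite mulr_ge0 // addr_ge0.
    by rewrite lerXn2r ?nnegrE // ltW.
  by rewrite lerDr mulr_ge0.
apply: le_trans (_ : c * L * (12 * M * L + 4) * l ^+ n <= _); last first.
  by rewrite lerDl mulr_ge0.
pose eta := c * l ^+ n.+1; have eta0 : 0 <= eta by rewrite mulr_ge0 ?exprn_ge0 // ltW.
have sub (F : R -> R) : chain_ac a b F -> chain_ac x y F by exact: chain_ac_sub.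
have tab t : x <= t <= y -> a <= t <= b.
  by move=> /andP[h1 h2]; rewrite (le_trans ax h1) (le_trans h2 yb).
have zl t : x <= t <= y -> `|t - x| ^+ n.+1 <= l ^+ n.+1.
  move=> /andP[h1 h2]; rewrite lerXn2r ?nnegrE ?(ltW l0) //.
  by rewrite ger0_norm ?subr_ge0 // lerB.
apply/ler_addgt0Pr => e e0.
have [|||p [cp lp]] := @discrepancy_estimate _ f g h f1 g1 Om x y M eta (ltW xy)
  (sub f acf) (sub g acg) (sub h ach) _ sf1 sg1 sOm _ eta0 M0 _
  (fK x Kx) (gK x Kx) (fK y Ky) (gK y Ky) e e0.
- by apply: ae_impl aeH => t Ht /tab.
- by move=> t /tab; exact: OmE.
- move=> t txy; have t_ab := tab t txy; have z := zl t txy; split.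
  + apply: le_trans (HCf x t Kx t_ab) _.
    apply: le_trans (_ : c * `|t - x| ^+ n.+1 <= _); last exact: ler_wpM2l.
    by rewrite ler_wpM2r ?exprn_ge0 // (le_trans (ler_norm _)) // lerDl.
  + apply: le_trans (HCg x t Kx t_ab) _.
    apply: le_trans (_ : c * `|t - x| ^+ n.+1 <= _); last exact: ler_wpM2l.
    by rewrite ler_wpM2r ?exprn_ge0 // (le_trans (ler_norm _)) // lerDr.
  + by have [_ h1] := HMf t t_ab; rewrite (le_trans h1) // lerDl.
  + by have [_ h1] := HMg t t_ab; rewrite (le_trans h1) // lerDr.
move/le_trans; apply; rewrite lerD2r.
have py : last x p <= b by rewrite lp.
have pf : psum (fun s t => `|f t - f s|) x p < 1.
  apply: (Hdf (fun _ _ => true) x p ax py cp).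
  by rewrite (psum_telescope id) lp; apply: lt_le_trans ldel _; rewrite ge_min lexx.
have pg : psum (fun s t => `|g t - g s|) x p < 1.
  apply: (Hdg (fun _ _ => true) x p ax py cp).
  by rewrite (psum_telescope id) lp; apply: lt_le_trans ldel _; rewrite ge_min lexx orbT.
apply: le_trans (_ : eta * (12 * M * L + 4) <= _).
  rewrite -/l; have h1 : 12 * M * eta * l <= 12 * M * eta * L.
    by apply: ler_wpM2l lL; rewrite mulr_ge0 // mulr_ge0.
  have h2 : 2 * eta * (psum (fun s t => `|f t - f s|) x p + psum (fun s t => `|g t - g s|) x p)
     <= 2 * eta * (1 + 1).
    by apply: ler_wpM2l; [exact: mulr_ge0|apply: lerD; exact: ltW].
  by apply: le_trans (lerD h1 h2) _; rewrite le_eqVlt; apply/orP; left; apply/eqP; ring.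
rewrite [leRHS]mulrAC ler_wpM2r // /eta exprS mulrA ler_wpM2r //.
exact: ler_wpM2l.
Qed.

(** The root is chosen so that [L * e >= 0], which makes [J * e ^+ 2 <= D] independently of the size
    of [L]. *)
Lemma quad_root (R : realType) (J D L : R) : 0 < J -> 0 <= D ->
  exists e, J * e ^+ 2 + L * e = D /\ J * e ^+ 2 <= D.
Proof.
move=> J0 D0; wlog L0 : L / 0 <= L.
  move=> W; have [|/ltW L0] := leP 0 L; first exact: W.
  have [|e [e1 e2]] := W (- L); first by rewrite oppr_ge0.
  by exists (- e); rewrite sqrrN; split=> //; rewrite -e1; ring.
pose r := Num.sqrt (L ^+ 2 + 4 * J * D).
have r2 : r ^+ 2 = L ^+ 2 + 4 * J * D.
  by rewrite sqr_sqrtr // addr_ge0 ?sqr_ge0 // !mulr_ge0 // ltW.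
have rL : L <= r.
  rewrite -(ler_pXn2r (n := 2)) ?nnegrE ?sqrtr_ge0 // r2 lerDl.
  by rewrite !mulr_ge0 // ltW.
pose e := (r - L) / (2 * J); have e0 : 0 <= e.
  by rewrite divr_ge0 ?subr_ge0 // mulr_ge0 // ltW.
have eE : J * e ^+ 2 + L * e = D.
  have -> : J * e ^+ 2 + L * e = (r ^+ 2 - L ^+ 2) / (4 * J).
    by rewrite /e; field; rewrite gt_eqF.
  by rewrite r2; field; rewrite gt_eqF.
by exists e; split=> //; rewrite -[leRHS]eE lerDl mulr_ge0.
Qed.

Lemma bump_square_integral (R : realType) : exists BB : R -> R,
  [/\ smooth BB, forall t, 0 <= t <= 1 -> derive1 BB t = bump_fun t ^+ 2 & BB 0 < BB 1].
Proof.
have sb : smooth (fun t : R => bump_fun t ^+ 2).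
  by under eq_fun do rewrite expr2; apply: smoothM; exact: smooth_bump_fun.
have [BB [w [sBB sw dBB wE]]] := smooth_antiderivative_itv sb (@ltr01 R).
exists BB; split=> // [t t01|]; first by rewrite (has_derivative_derive1 (dBB t)) wE.
rewrite -subr_gt0; have [|t /[!in_itv]/= /andP[t0 t1] ->] := @MVT _ BB w 0 1 ltr01 (fun t _ => (has_derivativeP _ _ _).1 (dBB t)).
  by apply: continuous_subspaceT => z; exact: (smooth_cont sBB).
by rewrite subr0 mulr1 wE ?(ltW t0) ?(ltW t1) // exprn_gt0 // bump_fun_gt0 // t0.
Qed.

Lemma compact_support_bounded (R : realType) (F : R -> R) : smooth F ->
  (forall t, t <= 0 \/ 1 <= t -> F t = 0) ->
  exists S : nat -> R, forall k, 0 <= S k /\ forall t, `|derive1n k F t| <= S k.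
Proof.
move=> sF F0; suff H k : exists Sk : R, 0 <= Sk /\ forall t, `|derive1n k F t| <= Sk.
  by have [S HS] := choice H; exists S.
have [S S0 HS] := smooth_bounded k 0 1 sF; exists S; split=> // t.
have z : derive1n k (fun=> 0) t = 0 :> R by rewrite derive1n_cst; case: (k).
have [t0|t0] := ltP t 0.
  rewrite (@derive1n_near _ k F (fun=> 0) t (- t)) ?z ?normr0 ?oppr_gt0 //.
    exact: smooth_cst.
  by move=> s; rewrite ltr_norml => /andP[_ h]; rewrite F0 //; left; lra.
have [t1|t1] := ltP 1 t; last by apply: HS; rewrite // t0.
rewrite (@derive1n_near _ k F (fun=> 0) t (t - 1)) ?z ?normr0 ?subr_gt0 //.
  exact: smooth_cst.
by move=> s; rewrite ltr_norml => /andP[h _]; rewrite F0 //; right; lra.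
Qed.

(** * Repairing the area on gaps *)

Lemma area_formE (R : realType) (f g : R -> R) (t f' g' : R) :
  has_derivative f t f' -> has_derivative g t g' ->
  area_form f g t = 2 * (f' * g t - g' * f t).
Proof.
by move=> /has_derivative_derive1 <- /has_derivative_derive1 <-.
Qed.

Lemma smooth_area_form (R : realType) (f g : R -> R) :
  smooth f -> smooth g -> smooth (area_form f g).
Proof.
move=> sf sg; apply: smoothZ; apply: smoothB; apply: smoothM => //; exact: smooth_derive1.
Qed.

(* The correction is quadratic in its amplitude [e], so that [e] is of the order of the
   square root of the prescribed defect [D], whatever the linear term is. *)
Lemma gap_correction (R : realType) : exists (S : nat -> R) (J : R),
  [/\ 0 < J, forall k, 0 <= S k &
  forall (f g Om : R -> R) (c d D : R), smooth f -> smooth g -> smooth Om -> c < d ->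
    (forall t, c <= t <= d -> derive1 Om t = area_form f g t) ->
    exists P Q : R -> R, [/\ smooth P, smooth Q,
      forall t, t <= c \/ d <= t -> P t = 0 /\ Q t = 0,
      forall k t, `|derive1n k P t| * (d - c) ^+ k <= S k * Num.sqrt (`|D| / J) /\
        `|derive1n k Q t| * (d - c) ^+ k <= S k * Num.sqrt (`|D| / J) &
      forall Om1 : R -> R, smooth Om1 ->
        (forall t, c <= t <= d ->
           derive1 Om1 t = area_form (fun t => f t + P t) (fun t => g t + Q t) t) ->
        Om1 d - Om1 c = Om d - Om c + D]].
Proof.
(* The Wronskian [P0' Q0 - Q0' P0] equals the square of [bump_fun], hence has a strictly positive
   integral. *)
pose P0 (t : R) := t * bump_fun t; pose Q0 (t : R) := bump_fun t.
have sQ0 : smooth Q0 by exact: smooth_bump_fun.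
have sP0 : smooth P0 by apply: smoothM => //; exact: smooth_id.
have zQ0 t : t <= 0 \/ 1 <= t -> Q0 t = 0 by exact: bump_fun0.
have zP0 t : t <= 0 \/ 1 <= t -> P0 t = 0 by move=> h; rewrite /P0 bump_fun0 ?mulr0.
have [SP HSP] := compact_support_bounded sP0 zP0.
have [SQ HSQ] := compact_support_bounded sQ0 zQ0.
have [BB [sBB dBB BB01]] := bump_square_integral R.
(* The area form is invariant under reparametrization: rescaling to [[c, d]] multiplies the
   Wronskian by [1 / (d - c)] and the length by [d - c], so [J] is common to all gaps. *)
pose J := 2 * (BB 1 - BB 0); have J0 : 0 < J by rewrite mulr_gt0 // subr_gt0.
exists (fun k => SP k + SQ k), J; split=> // [k|].
  by rewrite addr_ge0 //; [case: (HSP k)|case: (HSQ k)].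
move=> f g Om c d D sf sg sOm cd dOm.
have l0 : 0 < d - c by rewrite subr_gt0.
have ln0 : d - c != 0 by rewrite gt_eqF.
pose l := (d - c)^-1; pose m := - c / (d - c).
have tauE t : l * t + m = (t - c) / (d - c) by rewrite /l /m; ring.
have tauc : l * c + m = 0 by rewrite tauE subrr mul0r.
have taud : l * d + m = 1 by rewrite tauE divff.
have tau_out t : t <= c \/ d <= t -> l * t + m <= 0 \/ 1 <= l * t + m.
  rewrite tauE => -[h|h]; [left|right].
    by rewrite pmulr_lle0 ?invr_gt0 // subr_le0.
  by rewrite ler_pdivlMr // mul1r lerB.
have tau_in t : c <= t <= d -> 0 <= l * t + m <= 1.
  move=> /andP[h1 h2]; rewrite tauE divr_ge0 ?subr_ge0 ?(ltW cd) //=.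
  by rewrite ler_pdivrMr // mul1r lerB.
pose p0 t := P0 (l * t + m); pose q0 t := Q0 (l * t + m).
have sp0 : smooth p0 by exact: smooth_affine.
have sq0 : smooth q0 by exact: smooth_affine.
(* Changing the sign of the second perturbation changes that of the quadratic part, which is thus
   given the sign of [D]. *)
pose sg' : R := if 0 <= D then 1 else -1.
have sgD : sg' * D = `|D|.
  rewrite /sg'; case: (leP 0 D) => h; first by rewrite mul1r ger0_norm.
  by rewrite mulN1r ltr0_norm.
have sg2 : sg' * sg' = 1 by rewrite /sg'; case: ifP => _; rewrite ?mul1r ?mulN1r ?opprK.
have sg1 : `|sg'| = 1 by rewrite /sg'; case: ifP => _; rewrite ?normrN normr1.
(* The coefficient of [e] in the area form of the perturbed pair. *)
pose lam t := 2 * ((derive1 p0 t * g t - derive1 g t * p0 t) +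
   sg' * (derive1 f t * q0 t - derive1 q0 t * f t)).
have slam : smooth lam.
  apply: smoothZ; apply: smoothD; last apply: smoothZ;
    apply: smoothB; apply: smoothM => //; exact: smooth_derive1.
have [La [la1 [sLa _ dLa la1E]]] := smooth_antiderivative_itv slam cd.
(* The equation [sg' * J * e^2 + (La d - La c) * e = D] multiplied by [sg'], so that the right-hand
   side becomes [|D|]. *)
have [e [eE eD]] := quad_root (sg' * (La d - La c)) J0 (normr_ge0 D).
have e_le : `|e| <= Num.sqrt (`|D| / J).
  by rewrite -sqrtr_sqr ler_wsqrtr // ler_pdivlMr // mulrC.
pose P t := e * p0 t; pose Q t := (sg' * e) * q0 t.
have sP : smooth P by exact: smoothZ.
have sQ : smooth Q by exact: smoothZ.
exists P, Q; split=> // [t /tau_out h|k t|Om1 sOm1 dOm1].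
- by rewrite /P /Q /p0 /q0 zP0 // zQ0 // !mulr0.
- have lk : `|l ^+ k| * (d - c) ^+ k = 1.
    rewrite ger0_norm ?exprn_ge0 ?invr_ge0 ?(ltW l0) //.
    by rewrite -exprMn mulVf // expr1n.
  have [SP0 HP] := HSP k; have [SQ0 HQ] := HSQ k.
  have bound e' F SF : smooth F -> `|e'| <= Num.sqrt (`|D| / J) ->
      (forall t, `|derive1n k F t| <= SF) -> SF <= SP k + SQ k ->
      `|derive1n k (fun t => e' * F (l * t + m)) t| * (d - c) ^+ k <=
        (SP k + SQ k) * Num.sqrt (`|D| / J).
    move=> sF he HF HS; rewrite derive1nZ; last exact: smooth_affine.
    rewrite derive1n_affine // !normrM.
    have -> : `|e'| * (`|l ^+ k| * `|derive1n k F (l * t + m)|) * (d - c) ^+ k =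
        (`|l ^+ k| * (d - c) ^+ k) * (`|derive1n k F (l * t + m)| * `|e'|) by ring.
    by rewrite lk mul1r ler_pM // (le_trans (HF _)).
  split; first by apply: (bound e P0 (SP k)) => //; rewrite lerDl.
  by apply: (bound (sg' * e) Q0 (SQ k)) => //; rewrite ?normrM ?sg1 ?mul1r // lerDr.
(* The expansion of the new area in powers of [e]: [e * La] is the linear part and the [BB] term the
   quadratic one, so [Z] has zero derivative on [[c, d]]. *)
- pose Z t := Om1 t - Om t - e * La t - (2 * sg' * e ^+ 2) * BB (l * t + m).
  have sZ : smooth Z.
    apply: smoothB; first by apply: smoothB; [exact: smoothB|exact: smoothZ].
    by apply: smoothZ; exact: smooth_affine.
  have dZ t : c <= t <= d -> derive1 Z t = 0.
    move=> tcd; apply: has_derivative_derive1.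
    have h1 := smooth_has_derivative t sOm1; have h2 := smooth_has_derivative t sOm.
    have h3 := dLa t; rewrite la1E // in h3.
    have h4 := smooth_has_derivative (l * t + m) sBB.
    have h5 := has_derivativeZ (2 * sg' * e ^+ 2) (has_derivative_affine h4).
    have h6 := has_derivativeB (has_derivativeB (has_derivativeB h1 h2) (has_derivativeZ e h3)) h5.
    apply: has_derivative_eq h6 _; rewrite dOm // dOm1 // dBB; last exact: tau_in.
    have hf := smooth_has_derivative t sf; have hg := smooth_has_derivative t sg.
    have hp := smooth_has_derivative t sp0; have hq := smooth_has_derivative t sq0.
    rewrite (area_formE (has_derivativeD hf (has_derivativeZ e hp))
      (has_derivativeD hg (has_derivativeZ (sg' * e) hq))).
    rewrite (area_formE hf hg) /lam.
    have hb := smooth_has_derivative (l * t + m) (smooth_bump_fun R).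
    rewrite (has_derivative_unique hq (has_derivative_affine hb)).
    have hP := has_derivative_affine (has_derivativeM (has_derivative_id (l * t + m)) hb).
    rewrite (has_derivative_unique hp hP) /Q /P /q0 /p0 /Q0 /P0.
    by ring: sg2.
  have ccd : c <= c <= d by rewrite lexx ltW.
  have dcd : c <= d <= d by rewrite lexx andbT ltW.
  have := MVT_itv (M := 0) (fun t => smooth_has_derivative t sZ) ccd dcd.
  rewrite mul0r normr_le0 subr_eq0 => H.
  have /eqP : Z d == Z c by apply: H => t tcd; rewrite dZ // normr0.
  rewrite /Z tauc taud => ZE.
  have eE' : e * (La d - La c) + 2 * sg' * e ^+ 2 * (BB 1 - BB 0) = D.
    have -> : D = sg' * `|D| by rewrite -sgD mulrA sg2 mul1r.
    by rewrite -eE /J; ring: sg2.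
  by rewrite -eE'; move: ZE; clear; lra.
Qed.

(** At points of [K] the functions [f] and [F] share all Taylor polynomials. Only the jets of [F]
    matter, so the lemma applies both before and after the repair. *)
Lemma taylor_close (R : realType) (a b : R) (K : set R) (f F : R -> R) (al : nat -> R -> R)
    (N : nat -> R) :
  (forall x, K x -> a <= x <= b) -> smooth F -> (forall k x, K x -> derive1n k F x = al k x) ->
  (forall n x z, K x -> a <= z <= b ->
     `|f z - taylor n.+1 (al^~ x) (z - x)| <= N n * `|z - x| ^+ n.+1) ->
  forall n, exists C, forall x z, K x -> a <= z <= b -> `|f z - F z| <= C * `|z - x| ^+ n.+1.
Proof.
move=> Kab sF Fal fT n; have [M M0 HM] := smooth_bounded n.+1 a b sF.
exists (N n + M) => x z Kx zab.
have h1 := fT n x z Kx zab.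
have h2 := taylor_remainder (n := n.+1) sF (Kab x Kx) zab (fun t tab => HM n.+1 t (leqnn _) tab).
rewrite (_ : (fun k => derive1n k F x) = al^~ x) in h2; last first.
  by apply/funext => k; exact: Fal.
have -> : f z - F z = (f z - taylor n.+1 (al^~ x) (z - x)) -
  (F z - taylor n.+1 (al^~ x) (z - x)) by ring.
by apply: le_trans (ler_normB _ _) _; rewrite mulrDl lerD.
Qed.

(** [K] may be totally disconnected, so a zero derivative along [K] proves nothing by itself.
    Equality at the ends of gaps allows an extension that is constant on every gap and has jet
    [(psi, 0, 0, ...)] on [K]; it is smooth on the line with zero derivative everywhere. *)
Lemma constant_on (R : realType) (a b : R) (K : set R) (psi : R -> R) (C M : R) :
  closed K -> K !=set0 ->
  (forall x y, K x -> K y -> `|psi y - psi x| <= C * (y - x) ^+ 2) ->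
  (forall x, K x -> `|psi x| <= M) ->
  (forall c d, K c -> K d -> c < d -> (forall x, K x -> x <= c \/ d <= x) -> psi c = psi d) ->
  exists k, forall x, K x -> psi x = k.
Proof.
move=> cK K0 H HM Hgap; have [x0 Kx0] := K0.
pose al k x := if k is 0%N then psi x else 0.
have M0 : 0 <= M by apply: le_trans (HM x0 Kx0).
have bM k c t : K c -> `|derive1n k (fun=> psi c) t| <= M.
  by move=> Kc; rewrite derive1n_cst; case: k => [|k]; rewrite ?normr0 // HM.
have [|||F [sF Fal Fgap]] := @glue_gaps _ K al (fun c _ _ => psi c) (fun c _ => psi c)
  (fun=> `|C|) (fun=> M) cK K0.
- move=> [|k] x y Kx Ky; rewrite /al; last by rewrite !(mul0r, subr0) normr0 mulr_ge0 ?sqr_ge0.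
  rewrite mul0r subr0; apply: le_trans (H x y Kx Ky) _.
  by rewrite ler_wpM2r ?sqr_ge0 // ler_norm.
- move=> c d Kc Kd cd gp; split; first exact: smooth_cst.
  + by move=> k; rewrite derive1n_cst.
  + by move=> k; rewrite derive1n_cst /al (Hgap c d).
  + by move=> k t _; exact: bM.
- move=> c Kc; split; first exact: smooth_cst.
    by move=> k; rewrite derive1n_cst.
  by move=> k t; exact: bM.
exists (F x0) => x Kx; have -> : psi x = F x by rewrite -[F x]/(derive1n 0 F x) Fal.
have F'0 t : derive1 F t = 0.
  rewrite -[LHS]/(derive1n 1 F t); have [Kt|nKt] := pselect (K t); first by rewrite Fal.
  by case: (Fgap 1%N t nKt) => [[c [d [_ _ _ _ ->]]]|[c [_ _ ->]]]; rewrite derive1n_cst.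
pose lo := Num.min x0 x; pose hi := Num.max x0 x.
have := @MVT_itv _ F (derive1 F) lo hi x0 x 0 (fun t => smooth_has_derivative t sF).
rewrite mul0r normr_le0 subr_eq0 => h; apply/eqP; apply: h.
- by rewrite ge_min le_max !lexx.
- by rewrite ge_min le_max !lexx !orbT.
- by move=> t _; rewrite F'0 normr0.
Qed.

Lemma horizontal_extension (R : realType) (a b : R) (K : set R) (f g h : R -> R)
    (N : nat -> R) :
  a < b -> closed K -> K !=set0 ->
  chain_ac a b f -> chain_ac a b g -> chain_ac a b h -> ae_horizontal a b f g h ->
  (forall n x, K x -> peano_at a b f n (N n) x) ->
  (forall n x, K x -> peano_at a b g n (N n) x) ->
  exists f1 g1 h1 : R -> R, [/\ smooth f1, smooth g1, smooth h1,
    forall t, a <= t <= b -> derive1 h1 t = area_form f1 g1 t &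
    forall x, K x -> [/\ f1 x = f x, g1 x = g x & h1 x = h x]].
Proof.
move=> ab cK K0 acf acg ach aeH Kf Kg.
have Kab x : K x -> a <= x <= b by move=> /(Kf 0%N)[].
have [al [alN alT]] := peano_jets ab Kf; have [be [beN beT]] := peano_jets ab Kg.
have [f0 [sf0 f0al]] := whitney cK Kab alN alT.
have [g0 [sg0 g0be]] := whitney cK Kab beN beT.
have [Om0 [w0 [sOm0 _ dOm0 w0E]]] := smooth_antiderivative_itv (smooth_area_form sf0 sg0) ab.
have Om0E t : a <= t <= b -> derive1 Om0 t = area_form f0 g0 t.
  by move=> tab; rewrite (has_derivative_derive1 (dOm0 t)) w0E.
have disc0 := discrepancy ab Kab acf acg ach aeH sf0 sg0 sOm0 Om0E
  (taylor_close Kab sf0 f0al alT) (taylor_close Kab sg0 g0be beT).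
have [C0 HC0] : exists C : nat -> R, forall n, 0 <= C n /\ forall x y, K x -> K y -> x < y ->
    `|(h y - h x) - (Om0 y - Om0 x)| <= C n * (y - x) ^+ n.
  suff H n : exists Cn : R, 0 <= Cn /\ forall x y, K x -> K y -> x < y ->
    `|(h y - h x) - (Om0 y - Om0 x)| <= Cn * (y - x) ^+ n by have [C HC] := choice H; exists C.
  by have [Cn] := disc0 n; exists Cn.
have [S [J [J0 S0 Hcorr]]] := gap_correction R.
pose D c d := (h d - h c) - (Om0 d - Om0 c).
have [PQ HPQ] : exists PQ : R -> R -> (R -> R) * (R -> R), forall c d,
    a <= c -> d <= b -> c < d ->
    [/\ smooth (PQ c d).1, smooth (PQ c d).2,
      forall t, t <= c \/ d <= t -> (PQ c d).1 t = 0 /\ (PQ c d).2 t = 0,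
      forall k t, `|derive1n k (PQ c d).1 t| * (d - c) ^+ k <= S k * Num.sqrt (`|D c d| / J) /\
        `|derive1n k (PQ c d).2 t| * (d - c) ^+ k <= S k * Num.sqrt (`|D c d| / J) &
      forall Om1 : R -> R, smooth Om1 ->
        (forall t, c <= t <= d -> derive1 Om1 t =
           area_form (fun t => f0 t + (PQ c d).1 t) (fun t => g0 t + (PQ c d).2 t) t) ->
        Om1 d - Om1 c = Om0 d - Om0 c + D c d].
  suff H (c d : R) : exists pq : (R -> R) * (R -> R), a <= c -> d <= b -> c < d ->
    [/\ smooth pq.1, smooth pq.2, forall t, t <= c \/ d <= t -> pq.1 t = 0 /\ pq.2 t = 0,
      forall k t, `|derive1n k pq.1 t| * (d - c) ^+ k <= S k * Num.sqrt (`|D c d| / J) /\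
        `|derive1n k pq.2 t| * (d - c) ^+ k <= S k * Num.sqrt (`|D c d| / J) &
      forall Om1 : R -> R, smooth Om1 ->
        (forall t, c <= t <= d -> derive1 Om1 t =
           area_form (fun t => f0 t + pq.1 t) (fun t => g0 t + pq.2 t) t) ->
        Om1 d - Om1 c = Om0 d - Om0 c + D c d].
    have H' c : exists F : R -> (R -> R) * (R -> R), forall d, a <= c -> d <= b -> c < d ->
      [/\ smooth (F d).1, smooth (F d).2,
      forall t, t <= c \/ d <= t -> (F d).1 t = 0 /\ (F d).2 t = 0,
      forall k t, `|derive1n k (F d).1 t| * (d - c) ^+ k <= S k * Num.sqrt (`|D c d| / J) /\
        `|derive1n k (F d).2 t| * (d - c) ^+ k <= S k * Num.sqrt (`|D c d| / J) &
      forall Om1 : R -> R, smooth Om1 ->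
        (forall t, c <= t <= d -> derive1 Om1 t =
           area_form (fun t => f0 t + (F d).1 t) (fun t => g0 t + (F d).2 t) t) ->
        Om1 d - Om1 c = Om0 d - Om0 c + D c d].
      by have [F HF] := choice (H c); exists F.
    by have [F HF] := choice H'; exists F.
  have [[[ac db] cd]|nH] := pselect ((a <= c /\ d <= b) /\ c < d); last first.
    by exists (fun=> 0, fun=> 0) => *; exfalso; apply: nH.
  have [|P [Q HH]] := Hcorr f0 g0 Om0 c d (D c d) sf0 sg0 sOm0 cd.
    by move=> t /andP[h1 h2]; apply: Om0E; rewrite (le_trans ac h1) (le_trans h2 db).
  by exists (P, Q).
(* Decay of order [2 k] of the defect makes its square root [O((d - c)^k)], which is what the [k]-th
   derivative of a rescaled bump loses. The result depends on [k] only. *)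
pose M k := S k * Num.sqrt (C0 (2 * k)%N / J).
have M0 k : 0 <= M k by rewrite mulr_ge0 // sqrtr_ge0.
have D_le c d k : K c -> K d -> c < d ->
    Num.sqrt (`|D c d| / J) <= Num.sqrt (C0 (2 * k)%N / J) * (d - c) ^+ k.
  move=> Kc Kd cd; have l0 : 0 <= d - c by rewrite subr_ge0 ltW.
  have -> : (d - c) ^+ k = Num.sqrt ((d - c) ^+ (2 * k)).
    by rewrite mulnC exprM sqrtr_sqr ger0_norm ?exprn_ge0.
  have [C00 HC] := HC0 (2 * k)%N.
  rewrite -sqrtrM ?divr_ge0 ?(ltW J0) // ler_wsqrtr // mulrAC ler_wpM2r ?invr_ge0 ?(ltW J0) //.
  exact: HC.
have bound c d k (r : R) : K c -> K d -> c < d ->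
    r * (d - c) ^+ k <= S k * Num.sqrt (`|D c d| / J) -> r <= M k.
  move=> Kc Kd cd h1; have lk : 0 < (d - c) ^+ k by rewrite exprn_gt0 // subr_gt0.
  rewrite -(ler_pM2r lk); apply: (le_trans h1); rewrite /M -mulrA ler_wpM2l //.
  exact: D_le.
have zero_l F k (c d : R) : smooth F -> (forall t, t <= c \/ d <= t -> F t = 0) ->
    derive1n k F c = 0 /\ derive1n k F d = 0.
  move=> sF F0; have z t : derive1n k (fun=> 0) t = 0 :> R by rewrite derive1n_cst; case: (k).
  split.
    transitivity (derive1n k (fun=> 0 : R) c); last exact: z.
    apply: derive1n_left => //; first exact: smooth_cst.
    by move=> s sc; rewrite F0 //; left.
  transitivity (derive1n k (fun=> 0 : R) d); last exact: z.
  apply: derive1n_right => //; first exact: smooth_cst.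
  by move=> s sc; rewrite F0 //; right.
(* The perturbations have zero jets at the ends of their gaps, so they are glued with zero jets on
   [K] and with zero beyond it; [sel] is [fst] or [snd]. *)
have glue_one (sel : (R -> R) * (R -> R) -> R -> R) :
    (forall c d, a <= c -> d <= b -> c < d -> [/\ smooth (sel (PQ c d)),
       forall t, t <= c \/ d <= t -> sel (PQ c d) t = 0 &
       forall k t, `|derive1n k (sel (PQ c d)) t| * (d - c) ^+ k <=
         S k * Num.sqrt (`|D c d| / J)]) ->
    exists p, [/\ smooth p, forall k x, K x -> derive1n k p x = 0 &
      forall c d k t, K c -> K d -> c < d -> (forall x, K x -> x <= c \/ d <= x) ->
        c <= t <= d -> derive1n k p t = derive1n k (sel (PQ c d)) t].
  move=> Hsel.
  have [|||p [sp pK pgap]] := @glue_gaps _ K (fun _ _ => 0) (fun c d => sel (PQ c d))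
    (fun _ _ => 0) (fun=> 0) M cK K0.
  - by move=> k x y _ _; rewrite !(mul0r, subr0) normr0.
  - move=> c d Kc Kd cd gp; have /andP[ac _] := Kab c Kc; have /andP[_ db] := Kab d Kd.
    have [s1 s2 s3] := Hsel c d ac db cd; split=> // [k|k|k t _].
    + by have [] := zero_l (sel (PQ c d)) k c d s1 s2.
    + by have [] := zero_l (sel (PQ c d)) k c d s1 s2.
    + exact: (bound c d).
  - move=> c Kc; split; first exact: smooth_cst.
      by move=> k; rewrite derive1n_cst; case: k.
    by move=> k t; rewrite derive1n_cst; case: k => *; rewrite normr0.
  exists p; split=> // c d k t Kc Kd cd gp /andP[ct td].
  have /andP[ac _] := Kab c Kc; have /andP[_ db] := Kab d Kd.
  have [s1 s2 s3] := Hsel c d ac db cd; have [zc zd] := zero_l (sel (PQ c d)) k c d s1 s2.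
  move: ct; rewrite le_eqVlt => /orP[/eqP <-|ct]; first by rewrite pK.
  move: td; rewrite le_eqVlt => /orP[/eqP ->|td]; first by rewrite pK.
  have nKt : ~ K t by move=> /gp; rewrite leNgt ct leNgt td => -[].
  case: (pgap k t nKt) => [[c' [d' [Kc' Kd' /andP[ct' td'] gp' ->]]]|[c' [_ side _]]]; last first.
    exfalso; case: side => side.
      by move: td; rewrite ltNge (side d Kd).
    by move: ct; rewrite ltNge (side c Kc).
    (* Two gaps of [K] containing the same point have the same ends. *)
    have -> : c' = c.
      apply/eqP; rewrite eq_le; apply/andP; split.
        by case: (gp c' Kc') => // h1; move: ct'; rewrite ltNge (le_trans (ltW td) h1).
      by case: (gp' c Kc) => // h1; move: ct; rewrite ltNge (le_trans (ltW td') h1).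
  have -> // : d' = d.
  apply/eqP; rewrite eq_le; apply/andP; split.
    by case: (gp' d Kd) => // h1; move: td; rewrite ltNge (le_trans h1 (ltW ct')).
  by case: (gp d' Kd') => // h1; move: td'; rewrite ltNge (le_trans h1 (ltW ct)).
have [p [sp pK pgap]] : exists p, [/\ smooth p, forall k x, K x -> derive1n k p x = 0 &
    forall c d k t, K c -> K d -> c < d -> (forall x, K x -> x <= c \/ d <= x) ->
    c <= t <= d -> derive1n k p t = derive1n k (PQ c d).1 t].
  apply: (glue_one fst) => c d ac db cd; have [s1 _ s3 s4 _] := HPQ c d ac db cd.
  by split=> // [t /s3[]|k t] //; case: (s4 k t).
have [q [sq qK qgap]] : exists p, [/\ smooth p, forall k x, K x -> derive1n k p x = 0 &
    forall c d k t, K c -> K d -> c < d -> (forall x, K x -> x <= c \/ d <= x) ->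
    c <= t <= d -> derive1n k p t = derive1n k (PQ c d).2 t].
  apply: (glue_one snd) => c d ac db cd; have [_ s2 s3 s4 _] := HPQ c d ac db cd.
  by split=> // [t /s3[]|k t] //; case: (s4 k t).
pose f1 t := f0 t + p t; pose g1 t := g0 t + q t.
have sf1 : smooth f1 by exact: smoothD.
have sg1 : smooth g1 by exact: smoothD.
have f1al k x : K x -> derive1n k f1 x = al k x.
  by move=> Kx; rewrite derive1nD // f0al // pK // addr0.
have g1be k x : K x -> derive1n k g1 x = be k x.
  by move=> Kx; rewrite derive1nD // g0be // qK // addr0.
have [Om1 [w1 [sOm1 _ dOm1 w1E]]] := smooth_antiderivative_itv (smooth_area_form sf1 sg1) ab.
have Om1E t : a <= t <= b -> derive1 Om1 t = area_form f1 g1 t.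
  by move=> tab; rewrite (has_derivative_derive1 (dOm1 t)) w1E.
have close_f := taylor_close Kab sf1 f1al alT.
have close_g := taylor_close Kab sg1 g1be beT.
(* The perturbation leaves the jets on [K] unchanged, so the estimate holds for the repaired pair as
   well; exponent 2 is what [constant_on] takes. *)
have [C C_ge0 HC] := discrepancy ab Kab acf acg ach aeH sf1 sg1 sOm1 Om1E close_f close_g 2.
pose psi t := h t - Om1 t.
have acpsi : chain_ac a b psi by apply: chain_acB => //; exact: smooth_chain_ac.
have [Mp _ HMp] := chain_ac_bounded (ltW ab) acpsi.
have [k0 psiK] : exists k, forall x, K x -> psi x = k.
  apply: (@constant_on _ a b K psi C Mp) => //.
  - move=> x y Kx Ky.
    have E u v : psi v - psi u = (h v - h u) - (Om1 v - Om1 u) by rewrite /psi; ring.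
    case: (ltgtP x y) => [xy|yx|->].
    + by rewrite E; exact: HC.
    + have -> : (y - x) ^+ 2 = (x - y) ^+ 2 by ring.
      by rewrite distrC E; exact: HC.
    + by rewrite !subrr normr0 mulr_ge0 ?sqr_ge0.
  - by move=> x Kx; apply: HMp; exact: Kab.
  move=> c d Kc Kd cd gp; have /andP[ac cb] := Kab c Kc; have /andP[ad db] := Kab d Kd.
  have [s1 s2 s3 s4 s5] := HPQ c d ac db cd.
  (* On the gap, [p] and [q] and their first derivatives are those of the local perturbation, so
     [Om1] gains exactly the missing [D c d] and its increment becomes that of [h]. *)
  have : Om1 d - Om1 c = Om0 d - Om0 c + D c d.
    apply: s5 => // t /[dup] tcd /andP[ct td].
    rewrite Om1E; last by rewrite (le_trans ac ct) (le_trans td db).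
    have e0 := pgap c d 0%N t Kc Kd cd gp tcd; have e1 := pgap c d 1%N t Kc Kd cd gp tcd.
    have e2 := qgap c d 0%N t Kc Kd cd gp tcd; have e3 := qgap c d 1%N t Kc Kd cd gp tcd.
    rewrite /= in e0 e1 e2 e3.
    have hf := smooth_has_derivative t sf0; have hg := smooth_has_derivative t sg0.
    rewrite (area_formE (has_derivativeD hf (smooth_has_derivative t sp))
      (has_derivativeD hg (smooth_has_derivative t sq))).
    rewrite (area_formE (has_derivativeD hf (smooth_has_derivative t s1))
      (has_derivativeD hg (smooth_has_derivative t s2))).
    by rewrite e0 e1 e2 e3.
  by rewrite /psi /D; clear; lra.
exists f1, g1, (fun t => Om1 t + k0); split=> //.
- by apply: smoothD => //; exact: smooth_cst.
- move=> t tab; rewrite -Om1E //; apply: has_derivative_derive1.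
  have := has_derivativeD (smooth_has_derivative t sOm1) (has_derivative_cst k0 t).
  by rewrite addr0.
move=> x Kx; split.
- have [Cf HCf] := close_f 0%N; have := HCf x x Kx (Kab x Kx).
  by rewrite subrr normr0 expr1 mulr0 normr_le0 subr_eq0 => /eqP.
- have [Cg HCg] := close_g 0%N; have := HCg x x Kx (Kab x Kx).
  by rewrite subrr normr0 expr1 mulr0 normr_le0 subr_eq0 => /eqP.
- by rewrite -(psiK x Kx) /psi; ring.
Qed.

(** * Curves in the Heisenberg group *)

Lemma is_derive_pair (R : realType) (V W : normedModType R) (F : R -> V) (G : R -> W)
    (x : R) (v : V) (w : W) :
  is_derive x (1 : R) F v -> is_derive x (1 : R) G w ->
  is_derive x (1 : R) (fun t => (F t, G t)) (v, w).
Proof.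
move=> [dF Fv] [dG Gw].
have cv : (fun k : R => k^-1 *: (((fun t => (F t, G t)) \o shift x) (k *: (1 : R)) - (F x, G x)))
    @ 0^' --> (v, w).
  apply: (@cvg_pair _ _ _ 0^' (nbhs v) (nbhs w) _ _ _
    (fun k : R => k^-1 *: ((F \o shift x) (k *: (1 : R)) - F x))
    (fun k : R => k^-1 *: ((G \o shift x) (k *: (1 : R)) - G x))).
    by rewrite -Fv; exact: dF.
  by rewrite -Gw; exact: dG.
split; first by apply/cvg_ex; exists (v, w).
by apply: cvg_lim cv; exact: norm_hausdorff.
Qed.

Lemma is_derive_fst (R : realType) (V W : normedModType R) (F : R -> V * W)
    (x : R) (v : V * W) :
  is_derive x (1 : R) F v -> is_derive x (1 : R) (fun t => (F t).1) v.1.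
Proof.
move=> [dF Fv].
have cv : (fun k : R => k^-1 *: (((fun t => (F t).1) \o shift x) (k *: (1 : R)) - (F x).1))
    @ 0^' --> v.1.
  apply: (@cvg_comp _ _ _ (fun k : R => k^-1 *: ((F \o shift x) (k *: (1 : R)) - F x)) fst
    0^' (nbhs v) (nbhs v.1)); last exact: cvg_fst.
  by rewrite -Fv; exact: dF.
split; first by apply/cvg_ex; exists v.1.
by apply: cvg_lim cv; exact: norm_hausdorff.
Qed.

Lemma is_derive_snd (R : realType) (V W : normedModType R) (F : R -> V * W)
    (x : R) (v : V * W) :
  is_derive x (1 : R) F v -> is_derive x (1 : R) (fun t => (F t).2) v.2.
Proof.
move=> [dF Fv].
have cv : (fun k : R => k^-1 *: (((fun t => (F t).2) \o shift x) (k *: (1 : R)) - (F x).2))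
    @ 0^' --> v.2.
  apply: (@cvg_comp _ _ _ (fun k : R => k^-1 *: ((F \o shift x) (k *: (1 : R)) - F x)) snd
    0^' (nbhs v) (nbhs v.2)); last exact: cvg_snd.
  by rewrite -Fv; exact: dF.
split; first by apply/cvg_ex; exists v.2.
by apply: cvg_lim cv; exact: norm_hausdorff.
Qed.

Lemma is_derive_triple (R : realType) (f g h : R -> R) (t c d e : R) :
  is_derive t (1 : R) (fun s => (f s, g s, h s)) (c, d, e) <->
  [/\ has_derivative f t c, has_derivative g t d & has_derivative h t e].
Proof.
split=> [H|[/has_derivativeP df /has_derivativeP dg /has_derivativeP dh]].
  have H1 := is_derive_fst H; split; apply/has_derivativeP.
  - exact: is_derive_fst H1.
  - exact: is_derive_snd H1.
  - exact: is_derive_snd H.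
by apply: is_derive_pair dh; exact: is_derive_pair.
Qed.

Lemma smooth_on_triple (R : realType) (a b : R) (f g h : R -> R) :
  smooth f -> smooth g -> smooth h -> smooth_on a b (fun t => (f t, g t, h t)).
Proof.
move=> sf sg sh; exists (fun t => (f t, g t, h t)); split=> // n t.
have H m s : is_derive s (1 : R) (fun t => (derive1n m f t, derive1n m g t, derive1n m h t))
    (derive1n m.+1 f s, derive1n m.+1 g s, derive1n m.+1 h s).
  by apply/is_derive_triple; split; exact: smooth_has_derivative_n.
suff -> : derive1n n (fun t => (f t, g t, h t)) =
    fun t => (derive1n n f t, derive1n n g t, derive1n n h t) by have [] := H n t.
elim: n => [|n IH] //; apply/funext => s.
by rewrite derive1nS IH derive1E; have [] := H n s.
Qed.

Lemma horizontal_coordinates (R : realType) (a b : R) (f g h : R -> R) :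
  horizontal a b (fun t => (f t, g t, h t)) ->
  [/\ chain_ac a b f, chain_ac a b g, chain_ac a b h & ae_horizontal a b f g h].
Proof.
move=> [ac ae]; split; first 3 last.
- apply: ae_impl ae => t H tab; have [|c [d H1]] := H; first by rewrite in_itv.
  exists c, d; apply/is_derive_triple; apply: is_derive_eq H1 _.
  by congr (_, _, _); rewrite /= /GRing.scale /=; ring.
- by apply: abs_continuous_chain ac _ => s t; rewrite prod_normE /= prod_normE !le_max lexx.
- by apply: abs_continuous_chain ac _ => s t; rewrite prod_normE /= prod_normE !le_max lexx ?orbT.
- by apply: abs_continuous_chain ac _ => s t; rewrite prod_normE /= prod_normE !le_max lexx ?orbT.
Qed.

Lemma lipschitz_abs_continuous (R : realType) (V : normedModType R) (a b M : R) (F : R -> V) :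
  0 <= M ->
  (forall s t, a <= s -> s <= t -> t <= b -> `|F t - F s| <= M * (t - s)) ->
  abs_continuous a b F.
Proof.
move=> M0 FM e e0; have M1 : 0 < M + 1 by rewrite ltr_wpDl.
exists (e / (M + 1)); first by rewrite divr_gt0.
move=> n u v uv _; rewrite ltr_pdivlMr // mulrC; apply: le_lt_trans.
rewrite mulr_sumr; apply: ler_sum => i _; have [au uvi vb] := uv i.
by apply: le_trans (FM _ _ au uvi vb) _; rewrite ler_wpM2r ?subr_ge0 // lerDl.
Qed.

Lemma smooth_horizontal (R : realType) (a b : R) (f g h : R -> R) :
  smooth f -> smooth g -> smooth h ->
  (forall t, a <= t <= b -> derive1 h t = area_form f g t) ->
  horizontal a b (fun t => (f t, g t, h t)).
Proof.
move=> sf sg sh hE; split.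
  have [Mf f0 [_ Hf]] := smooth_lipschitz a b sf.
  have [Mg g0 [_ Hg]] := smooth_lipschitz a b sg.
  have [Mh h0 [_ Hh]] := smooth_lipschitz a b sh.
  apply: (@lipschitz_abs_continuous _ _ _ _ (Mf + Mg + Mh)).
    by rewrite !addr_ge0.
  move=> s t as_ st tb; have st0 : 0 <= t - s by rewrite subr_ge0.
  have sab : a <= s <= b by rewrite as_ (le_trans st).
  have tab : a <= t <= b by rewrite tb (le_trans as_).
  have /= := (Hf s t sab tab, Hg s t sab tab, Hh s t sab tab); rewrite (ger0_norm st0) => H.
  rewrite prod_normE /= prod_normE /= !ge_max -andbA; apply/and3P; split.
  - by apply: le_trans H.1.1 _; rewrite ler_wpM2r // -addrA lerDl addr_ge0.
  - by apply: le_trans H.1.2 _; rewrite ler_wpM2r // addrAC lerDr addr_ge0.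
  - by apply: le_trans H.2 _; rewrite ler_wpM2r // lerDr addr_ge0.
apply: aeW => t; rewrite in_itv /= => tab.
exists (derive1 f t), (derive1 g t).
have H : is_derive t (1 : R) (fun t => (f t, g t, h t)) (derive1 f t, derive1 g t, derive1 h t).
  by apply/is_derive_triple; split; exact: smooth_has_derivative.
apply: is_derive_eq H _; rewrite (hE t tab) /area_form.
by congr (_, _, _); rewrite /= /GRing.scale /=; ring.
Qed.

(** The conditions on [f] and [g] are intersected before exhausting, so one constant per order
    serves both; the intersection over all orders is still closed. *)
Lemma exhaust_peano (R : realType) (a b e : R) (f g : R -> R) : 0 < e ->
  chain_ac a b f -> chain_ac a b g ->
  {ae lebesgue_measure, forall t : R, a <= t <= b ->
    has_derivative f t (derive1 f t) /\ has_derivative g t (derive1 g t)} ->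
  (forall m, {ae lebesgue_measure, forall x : R, a <= x <= b ->
     L1_differentiable a b m (derive1 f) x /\ L1_differentiable a b m (derive1 g) x}) ->
  exists N : nat -> R, exists K : set R,
    [/\ closed K, (lebesgue_measure (`[a, b] `\` K) < e%:E)%E &
    forall n x, K x -> peano_at a b f n (N n) x /\ peano_at a b g n (N n) x].
Proof.
move=> e0 acf acg ae L1.
pose A m n : set R := [set x | peano_at a b f m n%:R x] `&` [set x | peano_at a b g m n%:R x].
have cA m n : closed (A m n).
  by apply: closedI; apply: compact_closed (@compact_peano_at _ _ _ _ _ _); exact: norm_hausdorff.
have [m n|m n x []|m|N HN] := choose_closed (a := a) (b := b) (A := A) e0.
- exact: measurable_realfun.closed_measurable.
- by split; apply: peano_atW (_ : n%:R <= n.+1%:R) _ => //; rewrite ler_nat.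
- apply: ae_impl (L1 m) => x H xab; have [Lf Lg] := H xab.
  have [|n1 H1] := L1_differentiable_peano acf _ Lf.
    by apply: ae_impl ae => t Ht /Ht[].
  have [|n2 H2] := L1_differentiable_peano acg _ Lg.
    by apply: ae_impl ae => t Ht /Ht[].
  exists (maxn n1 n2); split.
    by apply: peano_atW H1; rewrite ler_nat leq_maxl.
  by apply: peano_atW H2; rewrite ler_nat leq_maxr.
exists (fun m => (N m)%:R), (\bigcap_m A m (N m)); split=> //.
- exact: closed_bigI.
- by move=> n x /(_ n I).
Qed.

Theorem theorem6p1 (R : realType) (a b : R) (f g h : R -> R) :
  a <= b ->
  horizontal a b (fun t => (f t, g t, h t)) ->
  (forall m : nat, {ae lebesgue_measure, forall x : R, x \in `[a, b] ->
     L1_differentiable a b m (derive1 f) x /\ L1_differentiable a b m (derive1 g) x}) ->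
  lusin_infty a b (fun t => (f t, g t, h t)).
Proof.
move=> ab /horizontal_coordinates[acf acg ach hor] L1 e e0.
(* If the whole interval has measure below [e], the zero curve will do. This covers a one-point
   interval and the case of an empty [K]. *)
have constant : (lebesgue_measure (`[a, b]%classic : set R) < e%:E)%E ->
    exists G' : R -> heis R, [/\ smooth_on a b G', horizontal a b G' &
      (lebesgue_measure [set x | x \in `[a, b] /\ G' x <> (f x, g x, h x)] < e%:E)%E].
  move=> abe; have s0 : smooth (fun=> 0 : R) := smooth_cst 0.
  exists (fun=> (0, 0, 0)); split.
  - exact: smooth_on_triple.
  - apply: smooth_horizontal => // t _.
    by rewrite /area_form (has_derivative_derive1 (has_derivative_cst 0 t)); ring.
  - by apply: le_lt_trans abe; apply: le_lebesgue => x [].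
have [eab|nab] := eqVneq a b.
  by apply: constant; rewrite eab set_itv1 lebesgue_measure_set1 lte_fin.
have {ab nab}ab : a < b by rewrite lt_neqAle nab.
have [|m|N [K [cK Ke HK]]] := exhaust_peano e0 acf acg.
- apply: ae_impl hor => t H tab; have [c [d [df dg _]]] := H tab.
  by rewrite (has_derivative_derive1 df) (has_derivative_derive1 dg).
- by apply: ae_impl (L1 m) => x H xab; apply: H; rewrite in_itv.
have [K0|/set0P K0] := eqVneq K set0.
  by apply: constant; move: Ke; rewrite K0 setD0.
have [||f1 [g1 [h1 [sf sg sh hE fgh]]]] := horizontal_extension ab cK K0 acf acg ach hor (N := N).
- by move=> n x /(HK n)[].
- by move=> n x /(HK n)[].
exists (fun t => (f1 t, g1 t, h1 t)); split.
- exact: smooth_on_triple.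
- exact: smooth_horizontal.
- apply: le_lt_trans Ke; apply: le_lebesgue => x [xab ne].
  by split=> // Kx; apply: ne; have [-> -> ->] := fgh x Kx.
Qed.
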